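(* Let $p\geq5$ be a prime, and let the integers $a(n),b(n),c(n)$ be defined by $$\sum_{n=1}^\infty a(n)q^n:=\eta^6(4z),\qquad \sum_{n=1}^\infty b(n)q^n:=\eta^3(6z)\,\eta^3(2z),\qquad \sum_{n=1}^\infty c(n)q^n:=\eta^2(8z)\,\eta(4z)\,\eta(2z)\,\eta^2(z),$$ where $\eta$ is Dedekind's eta function and $q=e^{2\pi iz}$. Then $$\sum_{n=0}^{p-1}\frac{(3n)!(2n)!}{n!^5}108^{-n}\equiv b(p)\pmod{p^2},$$ $$\sum_{n=0}^{p-1}\frac{(4n)!}{n!^4}256^{-n}\equiv c(p)\pmod{p^2},$$ $$\sum_{n=0}^{p-1}\frac{(6n)!}{(3n)!\,n!^3}1728^{-n}\equiv\gamma(p)\,a(p)\pmod{p^2},$$ where $\gamma(p):=-1$ if $p\equiv5\pmod{12}$ and $\gamma(p):=1$ otherwise.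
   Context: Dedekind's eta function is $\eta(z):=q^{1/24}\prod_{n=1}^\infty(1-q^n)$, where $q:=e^{2\pi iz}$ and $\mathrm{Im}(z)>0$. The three eta products are weight three newforms in $S_3(\Gamma_0(16),(\frac{-4}{d}))$, $S_3(\Gamma_0(12),(\frac{-3}{d}))$ and $S_3(\Gamma_0(8),(\frac{-2}{d}))$, respectively. The congruences are between rational numbers with denominators prime to $p$ (i.e. in $\mathbb{Z}_{(p)}$, equivalently in $\mathbb{Z}_p$). *)

(* Defs.v *)
From HB Require Import structures.
From mathcomp Require Import all_boot all_order all_algebra.
From mathcomp Require Import all_classical all_reals all_analysis.
From mathcomp Require Import complex.

Set Implicit Arguments.
Unset Strict Implicit.
Unset Printing Implicit Defensive.

Import Order.TTheory GRing.Theory Num.Theory.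
Import numFieldNormedType.Exports.

Local Open Scope classical_set_scope.
Local Open Scope complex_scope.
Local Open Scope ring_scope.

Section ModularForms.
Context {R : realType}.

(* The libraries have no complex exponential:
   e^(x + i y) = e^x (cos y + i sin y). *)
Definition cexp (z : R[i]) : R[i] :=
  (expR (complex.Re z))%:C * (cos (complex.Im z) +i* sin (complex.Im z)).

(* [expq s z] is q^s with the branch e^(2 pi i s z), as in the factor q^(1/24)
   of eta. *)
Definition expq (s z : R[i]) : R[i] := cexp (2 * pi%:C * 'i * s * z).

Definition nome (z : R[i]) : R[i] := expq 1 z.

(* Limits are taken in [R[i]^o], the normed space C over itself; [R[i]] carries
   no topology of its own.
   [limn] is a total operator; the product converges for 0 < Im z, and eta is
   only meaningful there. *)
Definition eta (z : R[i]) : R[i] :=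
  expq 24^-1 z *
  limn (fun N : nat => \prod_(1 <= n < N.+1) (1 - nome z ^+ n) : R[i]^o).

(* f(z) = sum_(n >= 1) a(n) q^n on the upper half-plane; a(0) is ignored. *)
Definition q_expansion (a : nat -> int) (f : R[i] -> R[i]) : Prop :=
  forall z : R[i], 0 < complex.Im z ->
    (fun N : nat => \sum_(1 <= n < N.+1) (a n)%:~R * nome z ^+ n : R[i]^o)
      @ \oo --> (f z : R[i]^o).

End ModularForms.

(* For p prime: x lies in the localization Z_(p). *)
Definition p_integral (p : nat) (x : rat) : bool := coprime p `|denq x|%N.

(* For p prime: x and y lie in Z_(p) and are congruent modulo p^k Z_(p). *)
Definition p_congr (p k : nat) (x y : rat) : bool :=
  [&& p_integral p x, p_integral p y & p_integral p ((x - y) / p%:R ^+ k)].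

Definition gamma_sign (p : nat) : int := if (p %% 12 == 5)%N then -1 else 1.

(* Main.v *)
From HB Require Import structures.
Require Import Defs.
From mathcomp Require Import all_boot all_order all_fingroup all_algebra all_solvable all_field.
From mathcomp Require Import all_classical all_reals all_analysis.
From mathcomp Require Import complex.
From mathcomp Require Import ring lra zify.


(** The bridge between the two sides of each congruence is a Jacobi sum
    J = J(chi, phi) with phi quadratic and chi of order 2D, where D is 3, 4 or 6
    for the three sums.

    Hypergeometric side.  The summands are (1/2)_n (1/D)_n (1 - 1/D)_n / n!^3, and
    they are polynomials in s = -(D-1)/D^2 ([hyp_coef]).  For s = m(m+1) the sum
    terminates and equals 0 for m odd and (C(m, m/2) / 2^m)^2 for m even
    ([sq_sumE], by a Wilf-Zeilberger pair).  Modulo p^2 the truncated sum is affine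
    on s + pZ, and the given s lies on the segment between two such points, with
    m = k and m = p-1-k for k the integer part of p/D ([trunc_sum_interp]).  So the
    sum is 0 modulo p^2 when k is odd ([hyp_sum_odd]), and otherwise
    C((p-1)/2, k/2)^2 times an explicit 1 + p (combination of harmonic numbers)
    ([trunc_sum_even]).

    Jacobi sums.  All computations modulo p^2 take place in the ring of Witt vectors
    of length 2 over a field with q = p or q = p^2 elements: it is Z/p^2 or its
    unramified quadratic extension, and it contains the Teichmueller roots of unity,
    so J can be written there.  As phi(1-x) is an explicit combination of powers of
    1 - x ([qchar_teich]), J is a combination of binomial coefficients
    ([jac_teich]); a version modulo p^2 of Lucas' congruence ([binomial_witt]) then
    shows that the truncated sum is J^2 if p = 1 mod 2D ([trunc_sum_split], q = p),
    and J up to sign if p = D-1 mod 2D ([trunc_sum_inert], q = p^2).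

    Over the integers, J lies in an imaginary quadratic order and has norm q
    ([jac_value6], [jac_value8], [jac_value12]).  J is a unit modulo p^2 and its conjugate is q / J,
    so modulo p^2 the square of the conjugate vanishes when q = p, and so does the conjugate itself when
    q = p^2.  Adding it turns J^2, respectively J, into a trace, and the truncated
    sums become 2(x^2 - 3y^2), 2(x^2 - 2y^2) and plus or minus 2(x^2 - y^2) for p
    represented by x^2 + 3y^2, x^2 + 2y^2 and x^2 + y^2.  The sign, lost when q = p^2,
    is recovered from J modulo p for D = 4 and from J modulo 4 for D = 6
    ([jac_value12_sign]).

    Modular side.  Each of the three eta products is a product of two theta series:
    eta^3 is Jacobi's series [jacobi], and the third product is F(q) F(q^2) with
    F = sum (3t+1) q^(3t^2+2t) ([quintuple]).  The coefficient of q^p is thus a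
    weighted sum over the representations of p by x^2 + D y^2 with D = 1, 3, 2;
    these are unique up to signs ([form_unique]), and the sum is 2(x^2 - D y^2) if
    they exist and 0 otherwise ([coef_aE], [coef_bE], [coef_cE]).  The identities are
    congruences of polynomials modulo powers of the variable, obtained from the
    q-binomial theorem.  Finally the coefficients of an expansion of an analytic eta
    product are those of the formal product, by comparing both on the imaginary axis
    as the nome tends to 0 ([eta_product_coef]). *)

Set Implicit Arguments.
Unset Strict Implicit.
Unset Printing Implicit Defensive.

Import Order.TTheory GRing.Theory Num.Theory.
Import numFieldNormedType.Exports.

Local Open Scope ring_scope.

(** * The defect of additivity of the p-th power *)

Lemma finField_prim_root (F : finFieldType) :
  exists g : F, (#|F|.-1).-primitive_root g.
Proof.
have q1 : (1 < #|F|)%N := finNzRing_gt1 F.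
have n_gt0 : (0 < #|F|.-1)%N by rewrite -ltnS prednK // ltnW.
have /hasP[g _ gP] : has (#|F|.-1).-primitive_root (rem 0 (enum F));
  last by exists g.
apply: has_prim_root => //.
- apply/allP=> x; rewrite (mem_rem_uniq _ (enum_uniq F)) !inE => /andP[x0 _].
  rewrite unity_rootE -(inj_eq (mulfI x0)) -exprS prednK ?expf_card ?mulr1 //.
  exact: ltnW.
- exact: rem_uniq (enum_uniq F).
by rewrite size_rem ?mem_enum // -cardE.
Qed.

Section PowerDefect.
Variable p : nat.

(** ((x + y)^p - x^p - y^p) / p, with integral coefficients so that it makes sense
    in characteristic p. *)
Definition power_defect (S : comPzRingType) (x y : S) : S :=
  \sum_(1 <= i < p) ('C(p, i) %/ p)%:R * (x ^+ (p - i) * y ^+ i).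

Lemma power_defectE (S : comPzRingType) (x y : S) : prime p ->
  (x + y) ^+ p = x ^+ p + y ^+ p + p%:R * power_defect x y.
Proof.
move=> p_pr; have p_gt0 := prime_gt0 p_pr.
rewrite exprDn -(big_mkord xpredT (fun i => (x ^+ (p - i) * y ^+ i) *+ 'C(p, i))).
rewrite big_nat_recr //= big_ltn // subn0 subnn bin0 binn expr0 mulr1 mul1r !mulr1n.
rewrite addrAC /power_defect mulr_sumr; congr (_ + _).
apply: eq_big_nat => i /andP[i1 ip].
rewrite mulrA -natrM mulnC divnK ?prime_dvd_bin ?i1 //.
by rewrite mulr_natl.
Qed.

Lemma rmorph_power_defect (S T : comPzRingType) (f : {rmorphism S -> T}) x y :
  f (power_defect x y) = power_defect (f x) (f y).
Proof.
rewrite /power_defect rmorph_sum; apply: eq_bigr => i _.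
by rewrite !rmorphM rmorph_nat !rmorphXn.
Qed.

Lemma power_defectM (S : comPzRingType) (u x y : S) :
  power_defect (u * x) (u * y) = u ^+ p * power_defect x y.
Proof.
rewrite /power_defect mulr_sumr; apply: eq_big_nat => i /andP[i1 ip].
rewrite !exprMn mulrACA -exprD subnK ?(ltnW ip) //; exact: mulrCA.
Qed.

Lemma power_defect0 (S : comPzRingType) (x : S) : power_defect x 0 = 0.
Proof.
rewrite /power_defect big_nat big1 // => i /andP[i1 ip].
by rewrite expr0n gtn_eqF // !mulr0.
Qed.

(** Every finite field is a quotient of the torsion-free domain Z[X], sending X
    to a primitive root; identities divided by p can be checked there. *)
Lemma finField_poly_lift (F : finFieldType) :
  exists f : {rmorphism {poly int} -> F}, forall x, exists P, f P = x.
Proof.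
have [g gP] := finField_prim_root F.
exists (horner_eval g \o map_poly intr) => x.
have [->|x0] := eqVneq x 0; first by exists 0; rewrite rmorph0.
have : x ^+ #|F|.-1 = 1.
  apply: (mulfI x0); rewrite -exprS prednK ?expf_card ?mulr1 //.
  exact: ltnW (finNzRing_gt1 F).
case/(prim_rootP gP) => i ->; exists 'X^i.
by rewrite /= map_polyXn /horner_eval hornerXn.
Qed.

(** In a torsion-free ring both sides are (x + y + z)^p - x^p - y^p - z^p divided by
    p.  This is the associativity of Witt vector addition. *)
Lemma power_defect_cocycle (F : finFieldType) (x y z : F) : prime p ->
  power_defect x (y + z) + power_defect y z =
  power_defect (x + y) z + power_defect x y.
Proof.
move=> p_pr; have [f fP] := finField_poly_lift F.
case: (fP x) (fP y) (fP z) => [X <-] [Y <-] [Z <-].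
rewrite -!rmorphD -!rmorph_power_defect -!rmorphD; congr (f _).
have p0 : p%:R != 0 :> {poly int}.
  by rewrite -polyC_natr polyC_eq0 pnatr_eq0 -lt0n prime_gt0.
apply: (mulfI p0); rewrite !mulrDr.
have e1 := power_defectE X (Y + Z) p_pr; have e2 := power_defectE Y Z p_pr.
have e3 := power_defectE (X + Y) Z p_pr; have e4 := power_defectE X Y p_pr.
rewrite addrA in e1.
apply: (addrI (X ^+ p + Y ^+ p + Z ^+ p)).
transitivity ((X + Y + Z) ^+ p); [rewrite e1 e2 | rewrite e3 e4]; ring.
Qed.

Lemma power_defectC (F : finFieldType) (x y : F) : prime p ->
  power_defect x y = power_defect y x.
Proof.
move=> p_pr; have [f fP] := finField_poly_lift F.
case: (fP x) (fP y) => [X <-] [Y <-].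
rewrite -!rmorph_power_defect; congr (f _).
have p0 : p%:R != 0 :> {poly int}.
  by rewrite -polyC_natr polyC_eq0 pnatr_eq0 -lt0n prime_gt0.
apply: (mulfI p0); apply: (addrI (X ^+ p + Y ^+ p)).
by rewrite -power_defectE // [X ^+ p + _]addrC -power_defectE // addrC.
Qed.

End PowerDefect.

(** * Witt vectors of length two over a finite field *)

Section Witt2.
Variable F : finFieldType.

Definition fchar : nat := s2val (finPcharP F).

Lemma fchar_prime : prime fchar. Proof. exact: (s2valP (finPcharP F)). Qed.
Lemma fchar_pchar : fchar \in [pchar F]. Proof. exact: (s2valP' (finPcharP F)). Qed.

(** p-typical Witt vectors in Witt coordinates: (a, b) stands for
    [a] + p [b^(1/p)], where [a] is the Teichmueller representative. *)
Definition witt2 : Type := (F * F)%type.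
HB.instance Definition _ := Choice.copy witt2 (F * F)%type.

Let p := fchar.
Let p_pr : prime p := fchar_prime.
Let FrobD (x y : F) : (x + y) ^+ p = x ^+ p + y ^+ p.
Proof. exact: (pFrobenius_autD_comm fchar_pchar (mulrC _ _)). Qed.

Definition witt2_zero : witt2 := (0, 0).
Definition witt2_add (a b : witt2) : witt2 :=
  (a.1 + b.1, a.2 + b.2 - power_defect p a.1 b.1).
Definition witt2_opp (a : witt2) : witt2 :=
  (- a.1, - a.2 + power_defect p a.1 (- a.1)).
Definition witt2_one : witt2 := (1, 0).
Definition witt2_mul (a b : witt2) : witt2 :=
  (a.1 * b.1, a.1 ^+ p * b.2 + b.1 ^+ p * a.2).

Lemma witt2_addA : associative witt2_add.
Proof.
move=> a b c; congr (_, _) => /=; first exact: addrA.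
have := power_defect_cocycle a.1 b.1 c.1 p_pr; rewrite -/p => E.
have -> : power_defect p a.1 (b.1 + c.1) = power_defect p (a.1 + b.1) c.1 +
  power_defect p a.1 b.1 - power_defect p b.1 c.1 by rewrite -E addrK.
ring.
Qed.

Lemma witt2_addC : commutative witt2_add.
Proof.
move=> a b; congr (_, _) => /=; first exact: addrC.
by rewrite power_defectC // [a.2 + _]addrC.
Qed.

Lemma witt2_add0 : left_id witt2_zero witt2_add.
Proof.
by case=> a1 a2; rewrite /witt2_add /= power_defectC // power_defect0 subr0 !add0r.
Qed.

Lemma witt2_addN : left_inverse witt2_zero witt2_opp witt2_add.
Proof.
case=> a1 a2; congr (_, _) => /=; first exact: addNr.
rewrite [power_defect p (- a1) _]power_defectC //; ring.
Qed.

HB.instance Definition _ := GRing.isZmodule.Build witt2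
  witt2_addA witt2_addC witt2_add0 witt2_addN.

Lemma witt2_mulA : associative witt2_mul.
Proof.
move=> a b c; congr (_, _) => /=; first exact: mulrA.
rewrite !exprMn; ring.
Qed.

Lemma witt2_mulC : commutative witt2_mul.
Proof. by move=> a b; congr (_, _) => /=; [exact: mulrC|exact: addrC]. Qed.

Lemma witt2_mul1 : left_id witt2_one witt2_mul.
Proof.
by case=> a1 a2; rewrite /witt2_mul /= expr1n !mul1r mulr0 addr0.
Qed.

Lemma witt2_mulD : left_distributive witt2_mul witt2_add.
Proof.
move=> a b c; congr (_, _) => /=; first exact: mulrDl.
rewrite ![_ * c.1]mulrC power_defectM FrobD; ring.
Qed.

Lemma witt2_1neq0 : witt2_one != witt2_zero.
Proof. by apply/eqP => -[/eqP]; rewrite oner_eq0. Qed.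

HB.instance Definition _ := GRing.Zmodule_isComNzRing.Build witt2
  witt2_mulA witt2_mulC witt2_mul1 witt2_mulD witt2_1neq0.

Definition witt2_inv (a : witt2) : witt2 :=
  if a.1 == 0 then a else (a.1^-1, - a.2 / a.1 ^+ p / a.1 ^+ p).

Lemma witt2_mulV : {in [pred a : witt2 | a.1 != 0], left_inverse 1 witt2_inv *%R}.
Proof.
case=> a1 a2; rewrite inE /= => a0; rewrite /witt2_inv /= (negPf a0).
congr (_, _) => /=; first exact: mulVf.
rewrite exprVn; field.
by rewrite expf_neq0.
Qed.

Lemma witt2_unitP (a b : witt2) : b * a = 1 -> a.1 != 0.
Proof.
case=> E _; apply: contraTneq (oner_neq0 F) => a0.
by rewrite -E a0 mulr0 eqxx.
Qed.

Lemma witt2_inv_out : {in [predC [pred a : witt2 | a.1 != 0]], witt2_inv =1 id}.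
Proof. by move=> a; rewrite !inE negbK /witt2_inv => ->. Qed.

HB.instance Definition _ := GRing.ComNzRing_hasMulInverse.Build witt2
  witt2_mulV witt2_unitP witt2_inv_out.

Definition witt2_fst (a : witt2) : F := a.1.
Lemma witt2_fst_zmod : zmod_morphism witt2_fst.
Proof. by []. Qed.
Lemma witt2_fst_monoid : monoid_morphism witt2_fst.
Proof. by []. Qed.
HB.instance Definition _ := GRing.isZmodMorphism.Build witt2 F witt2_fst witt2_fst_zmod.
HB.instance Definition _ := GRing.isMonoidMorphism.Build witt2 F witt2_fst witt2_fst_monoid.

(** The multiplicative section of [witt2_fst]; its values are 0 and the roots of
    unity of order dividing q - 1. *)
Definition teich (x : F) : witt2 := (x, 0).

Lemma teich1 : teich 1 = 1. Proof. by []. Qed.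
Lemma teichM : {morph teich : x y / x * y}.
Proof. by move=> x y; congr (_, _); rewrite /= !mulr0 addr0. Qed.
Lemma teichX n : {morph teich : x / x ^+ n}.
Proof. by move=> x; elim: n => // n IH; rewrite !exprS teichM IH. Qed.
Lemma witt2_fst_teich x : witt2_fst (teich x) = x. Proof. by []. Qed.

Lemma witt2_unitE (a : witt2) : (a \is a GRing.unit) = (witt2_fst a != 0).
Proof. by []. Qed.

(** The ghost map on integers: n has Witt coordinates n and (n - n^p)/p. *)
Lemma witt2_p_eq : p%:R = (0, 1) :> witt2.
Proof.
have [f _] := finField_poly_lift F.
have p0 : p%:R != 0 :> int by rewrite pnatr_eq0 -lt0n prime_gt0.
have H n : exists2 z : int, p%:R * z = n%:R - n%:R ^+ p & n%:R = (n%:R, z%:~R) :> witt2.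
  elim: n => [|n [z zE nE]].
    by exists 0; rewrite ?mulr0 // expr0n gtn_eqF ?prime_gt0 ?subrr.
  have := power_defectE (n%:R : int) 1 p_pr; rewrite expr1n -natr1 => E.
  exists (z - power_defect p n%:R 1).
    by rewrite mulrBr zE E; ring.
  rewrite -natr1 nE; congr (_, _) => /=.
    by rewrite -natr1.
  rewrite addr0 rmorphB; congr (_ - _).
  by rewrite rmorph_power_defect rmorph_nat rmorph1.
have [z zE ->] := H p; rewrite (pcharf0 fchar_pchar); congr (_, _).
have -> : z = 1 - p%:R ^+ p.-1.
  apply: (mulfI p0); rewrite zE mulrBr mulr1 -exprS prednK //.
  exact: prime_gt0.
rewrite rmorphB rmorphXn /= rmorph_nat (pcharf0 fchar_pchar) expr0n.
by rewrite -subn1 subn_eq0 leqNgt prime_gt1 ?subr0.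
Qed.

Lemma witt2_pM (a : witt2) : p%:R * a = (0, witt2_fst a ^+ p).
Proof.
rewrite witt2_p_eq; congr (_, _); rewrite /= ?mul0r // mulr1 expr0n.
by rewrite gtn_eqF ?prime_gt0 // mul0r add0r.
Qed.

Lemma witt2_fchar_congr (a b : witt2) :
  witt2_fst a = witt2_fst b -> p%:R * a = p%:R * b.
Proof. by move=> ab; rewrite !witt2_pM ab. Qed.

Lemma witt2_fchar_sqr : p%:R * p%:R = 0 :> witt2.
Proof.
by rewrite witt2_pM rmorph_nat (pcharf0 fchar_pchar) expr0n gtn_eqF ?prime_gt0.
Qed.

(** The isomorphism of F with the ideal generated by p: as p w depends only on the
    first coordinate of w, everything of order p is recorded by an element of F. *)
Definition eps (a : F) : witt2 := p%:R * teich a.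

Lemma eps_additive : zmod_morphism eps.
Proof.
move=> a b; rewrite /eps -mulrBr; apply: witt2_fchar_congr.
by rewrite rmorphB !witt2_fst_teich.
Qed.
HB.instance Definition _ := GRing.isZmodMorphism.Build F witt2 eps eps_additive.

Lemma mul_eps (w : witt2) a : w * eps a = eps (witt2_fst w * a).
Proof.
rewrite /eps mulrCA; apply: witt2_fchar_congr.
by rewrite rmorphM !witt2_fst_teich.
Qed.

Lemma eps_mul a b : eps a * eps b = 0.
Proof. by rewrite /eps mulrACA witt2_fchar_sqr mul0r. Qed.

Lemma fst_eps a : witt2_fst (eps a) = 0.
Proof. by rewrite rmorphM rmorph_nat (pcharf0 fchar_pchar) mul0r. Qed.

Lemma eps1M a b : (1 + eps a) * (1 + eps b) = 1 + eps (a + b).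
Proof.
by rewrite mulrDl mul1r mulrDr mulr1 eps_mul addr0 raddfD addrA addrAC.
Qed.

Lemma eps1X a n : (1 + eps a) ^+ n = 1 + eps (n%:R * a).
Proof.
elim: n => [|n IH]; first by rewrite mul0r raddf0 addr0.
by rewrite exprS IH eps1M -natr1 mulrDl mul1r [a + _]addrC.
Qed.

Lemma eps1_unit a : 1 + eps a \is a GRing.unit.
Proof.
by rewrite witt2_unitE -[X in X != 0]/(witt2_fst 1 + witt2_fst (eps a)) fst_eps addr0 oner_neq0.
Qed.

End Witt2.

Section Witt2Arith.
Variables (F : finFieldType) (p k : nat).
Hypotheses (p_pr : prime p) (k_gt0 : (0 < k)%N) (cardF : #|F| = (p ^ k)%N).
Local Notation W := (witt2 F).
Local Notation wfst := (@witt2_fst F).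

Let pF : p \in [pchar F] := card_finPcharP cardF p_pr.

Lemma fchar_card : fchar F = p.
Proof.
by apply/eqP; have := pF; rewrite (pcharf_eq (fchar_pchar F)) inE eq_sym.
Qed.

Lemma witt2_pE (a : W) : p%:R * a = (0, wfst a ^+ p).
Proof. by have := witt2_pM a; rewrite fchar_card. Qed.

Lemma witt2_p_congr (a b : W) : wfst a = wfst b -> p%:R * a = p%:R * b.
Proof. by move=> ab; rewrite !witt2_pE ab. Qed.

Lemma witt2_pp : p%:R * p%:R = 0 :> W.
Proof.
by rewrite witt2_pE rmorph_nat (pcharf0 pF) expr0n gtn_eqF ?prime_gt0.
Qed.

(** The kernel of the first projection is generated by p because F is perfect: the
    second coordinate has a p-th root. *)
Lemma witt2_fst_eq (a b : W) : wfst a = wfst b -> exists r, a = b + p%:R * r.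
Proof.
move=> ab; pose c := (a - b).2.
have cE : c ^+ (p ^ k.-1) ^+ p = c.
  by rewrite -exprM mulnC -expnS prednK // -cardF expf_card.
(* c^(p^(k-1)) is the p-th root of c. *)
exists (teich (c ^+ (p ^ k.-1))); rewrite witt2_pE witt2_fst_teich cE.
apply/eqP; rewrite addrC -subr_eq; apply/eqP.
rewrite [LHS]surjective_pairing; congr (_, _).
by have : wfst a - wfst b = 0 by rewrite ab subrr.
Qed.

Lemma pchar_natr_eq0 n : (n%:R == 0 :> F) = (p %| n)%N.
Proof. by rewrite (dvdn_pcharf pF). Qed.

Lemma pchar_intr_eq0 (z : int) : (z%:~R == 0 :> F) = (p%:Z %| z)%Z.
Proof.
case: z => n; first by rewrite pchar_natr_eq0 /dvdz /=.
by rewrite NegzE rmorphN oppr_eq0 pchar_natr_eq0 dvdzE /=.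
Qed.

Lemma witt2_natr_unit n : coprime n p -> (n%:R : W) \is a GRing.unit.
Proof.
rewrite coprime_sym prime_coprime // => np.
by rewrite witt2_unitE rmorph_nat pchar_natr_eq0.
Qed.

Lemma witt2_intr_eq0 (z : int) : z%:~R = 0 :> W -> ((p ^ 2)%:Z %| z)%Z.
Proof.
move=> z0; have : (p%:Z %| z)%Z.
  by rewrite -pchar_intr_eq0 -(rmorph_int wfst) z0 rmorph0.
case/dvdzP=> y zE; move: z0; rewrite zE mulrC rmorphM /= witt2_pE.
case=> /eqP; rewrite expf_eq0 prime_gt0 //= rmorph_int pchar_intr_eq0.
case/dvdzP=> x ->; apply/dvdzP; exists x; rewrite expnS expn1 PoszM; ring.
Qed.

Lemma eps_fst (w : W) : p%:R * w = eps (wfst w).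
Proof. by rewrite /eps fchar_card; apply: witt2_p_congr. Qed.

Lemma addp_eps1 (u v : W) : u \is a GRing.unit ->
  u + p%:R * v = u * (1 + eps (wfst v / wfst u)).
Proof.
move=> uu; rewrite mulrDr mulr1 mul_eps [_ * (_ / _)]mulrC divfK; first by rewrite eps_fst.
by rewrite -witt2_unitE.
Qed.

End Witt2Arith.

(** * Characters and Jacobi sums of a finite field *)

Section DiscreteLog.
Variables (F : finFieldType) (g : F).
Local Notation q1 := (#|F|.-1).
Hypothesis g_prim : q1.-primitive_root g.

Definition dlog (x : F) : nat := index x [seq g ^+ i | i <- iota 0 q1].

Lemma exp_dlog x : x != 0 -> (dlog x < q1)%N /\ g ^+ dlog x = x.
Proof.
move=> x0; have xs : x \in [seq g ^+ i | i <- iota 0 q1].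
  have : x ^+ q1 = 1.
    apply: (mulfI x0); rewrite -exprS prednK ?expf_card ?mulr1 //.
    exact: ltnW (finNzRing_gt1 F).
  case/(prim_rootP g_prim) => i ->; apply/mapP; exists (i : nat) => //.
  by rewrite mem_iota /=.
have lt : (dlog x < q1)%N by move: xs; rewrite -index_mem size_map size_iota.
split=> //; have := nth_index 0 xs; rewrite (nth_map 0%N) ?size_iota //.
by rewrite nth_iota.
Qed.

Lemma dlog_lt x : x != 0 -> (dlog x < q1)%N.
Proof. by case/exp_dlog. Qed.

Lemma dlogK x : x != 0 -> g ^+ dlog x = x.
Proof. by case/exp_dlog. Qed.

Lemma gen_neq0 : g != 0.
Proof.
apply: contraTneq (oner_neq0 F) => g0.
rewrite -(prim_expr_order g_prim) g0 expr0n gtn_eqF ?eqxx //.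
exact: prim_order_gt0 g_prim.
Qed.

Lemma genX_neq0 i : g ^+ i != 0. Proof. exact: expf_neq0 gen_neq0. Qed.

Lemma dlogX i : dlog (g ^+ i) = (i %% q1)%N.
Proof.
have [lt /eqP] := exp_dlog (genX_neq0 i).
by rewrite (eq_prim_root_expr g_prim) (modn_small lt) => /eqP.
Qed.

Lemma dlogM x y : x != 0 -> y != 0 -> dlog (x * y) = ((dlog x + dlog y) %% q1)%N.
Proof. by move=> x0 y0; rewrite -{1}(dlogK x0) -{1}(dlogK y0) -exprD dlogX. Qed.

Lemma sum_dlog (V : nmodType) (f : F -> V) :
  \sum_(x | x != 0) f x = \sum_(i < q1) f (g ^+ i).
Proof.
rewrite [RHS](partition_big (fun i : 'I_q1 => g ^+ i) (fun x => x != 0)) /=; last first.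
  by move=> i _; exact: genX_neq0.
apply: eq_bigr => x x0; rewrite (big_pred1 (Ordinal (dlog_lt x0))) /= ?dlogK // => i.
apply/eqP/eqP => [E|-> /=]; last exact: dlogK.
by apply: val_inj; rewrite /= -E dlogX modn_small.
Qed.

(** For z^(q-1) = 1 this is the multiplicative character with values in S that sends
    the generator g to z.  Taking S = algC gives norms of Jacobi sums, and taking Witt
    vectors gives their values modulo p^2. *)
Definition mchar (S : pzRingType) (z : S) (x : F) : S :=
  if x == 0 then 0 else z ^+ dlog x.

Section Mchar.
Variables (S : comPzRingType) (z : S).
Hypothesis z_q1 : z ^+ q1 = 1.

Lemma mchar0 : mchar z 0 = 0. Proof. by rewrite /mchar eqxx. Qed.

Lemma mcharX i : mchar z (g ^+ i) = z ^+ i.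
Proof. by rewrite /mchar (negPf (genX_neq0 i)) dlogX expr_mod. Qed.

Lemma mchar1 : mchar z 1 = 1. Proof. by rewrite -(expr0 g) mcharX. Qed.

Lemma mcharM : {morph mchar z : x y / x * y}.
Proof.
move=> x y; have [->|x0] := eqVneq x 0; first by rewrite mul0r mchar0 mul0r.
have [->|y0] := eqVneq y 0; first by rewrite mulr0 mchar0 mulr0.
by rewrite -(dlogK x0) -(dlogK y0) -exprD !mcharX exprD.
Qed.

Lemma mcharXn n x : mchar z (x ^+ n.+1) = mchar z x ^+ n.+1.
Proof. by elim: n => // n IH; rewrite exprS mcharM IH -exprS. Qed.

Lemma mcharV x : x != 0 -> mchar z x * mchar z x^-1 = 1.
Proof. by move=> x0; rewrite -mcharM divff // mchar1. Qed.

Lemma sum_mchar : (z - 1) * \sum_x mchar z x = 0.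
Proof.
rewrite (bigID (fun x => x == 0)) /= big_pred1_eq mchar0 add0r.
rewrite sum_dlog (eq_bigr (fun i : 'I_q1 => z ^+ i)) => [|i _]; last exact: mcharX.
by rewrite -subrX1 z_q1 subrr.
Qed.

End Mchar.

Lemma mchar_expr (S : comPzRingType) (z : S) n x :
  mchar (z ^+ n.+1) x = mchar z x ^+ n.+1.
Proof.
by rewrite /mchar; case: ifP => _; rewrite ?expr0n //= -!exprM mulnC.
Qed.

Lemma mchar_mul (S : comPzRingType) (z y : S) x :
  mchar (z * y) x = mchar z x * mchar y x.
Proof. by rewrite /mchar; case: ifP => _; rewrite ?mulr0 // exprMn. Qed.

Lemma rmorph_mchar (S T : comPzRingType) (f : {rmorphism S -> T}) (z : S) x :
  f (mchar z x) = mchar (f z) x.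
Proof. by rewrite /mchar; case: ifP; rewrite ?rmorph0 ?rmorphXn. Qed.

Hypothesis q1_even : ~~ odd q1.

(** The quadratic character, with values in Z so that it maps to every ring. *)
Definition qchar : F -> int := mchar (-1).

Lemma sign_q1 : (-1) ^+ q1 = 1 :> int.
Proof. by rewrite -signr_odd (negPf q1_even). Qed.

Lemma qchar0 : qchar 0 = 0. Proof. exact: mchar0. Qed.
Lemma qchar1 : qchar 1 = 1. Proof. exact: mchar1 sign_q1. Qed.
Lemma qcharM : {morph qchar : x y / x * y}. Proof. exact: mcharM sign_q1. Qed.

Lemma qchar_sqr x : x != 0 -> qchar x * qchar x = 1.
Proof. by move=> x0; rewrite /qchar /mchar (negPf x0) -expr2 sqrr_sign. Qed.

Lemma qcharV x : x != 0 -> qchar x^-1 = qchar x.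
Proof.
move=> x0; rewrite -[LHS]mul1r -(qchar_sqr x0) -mulrA -qcharM divff //.
by rewrite qchar1 mulr1.
Qed.

Lemma sum_qchar : \sum_x qchar x = 0.
Proof.
have /eqP := sum_mchar sign_q1; rewrite mulf_eq0 => /orP[|/eqP //].
by [].
Qed.

Lemma qchar_intr (S : comPzRingType) x : (qchar x)%:~R = mchar (-1 : S) x.
Proof.
by rewrite -[_%:~R]/(intmul 1 _) rmorph_mchar rmorphN rmorph1.
Qed.

(** The affine substitution v -> 1/w turns a quadratic with distinct roots into
    a linear polynomial. *)
Lemma sum_qchar_pair t : t != 0 -> t != 1 ->
  \sum_y qchar (1 - t * y) * qchar (1 - y) = - qchar t.
Proof.
move=> t0 t1; rewrite (reindex_inj (inv_inj (subKr 1))) /=.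
rewrite (bigD1 0) //= subr0 subrr qchar0 mulr0 add0r.
rewrite (reindex_inj (@invr_inj F)) /=.
under eq_bigl do rewrite invr_eq0.
rewrite (eq_bigr (fun w => qchar ((1 - t) * w + t))) => [|w w0]; last first.
  rewrite subKr qcharV // mulrC -qcharM; congr qchar; field.
  exact: w0.
have t1' : 1 - t != 0 by rewrite subr_eq0 eq_sym.
have : \sum_w qchar ((1 - t) * w + t) = 0.
  rewrite -[RHS]sum_qchar [RHS](reindex_inj (addIr t)).
  by rewrite [RHS](reindex_inj (mulfI t1')).
rewrite (bigD1 0) //= mulr0 add0r => /eqP.
by rewrite addrC addr_eq0 => /eqP.
Qed.

(** The Jacobi sum of the character attached to z and of the quadratic character. *)
Definition jac (S : comPzRingType) (z : S) : S :=
  \sum_x mchar z x * (qchar (1 - x))%:~R.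

(** Writing x = t * y makes the inner sum the integer of [sum_qchar_pair]. *)
Lemma jac_norm (S : idomainType) (z y : S) : z ^+ q1 = 1 -> z * y = 1 ->
  z != 1 -> z != -1 -> jac z * jac y = #|F|%:R.
Proof.
move=> zq zy z1 zN1.
have yq : y ^+ q1 = 1 by rewrite -[LHS]mul1r -zq -exprMn zy expr1n.
have zN : (- z) ^+ q1 = 1 by rewrite exprNn zq mulr1 -signr_odd (negPf q1_even).
pose K t : int := \sum_(y | y != 0) qchar (1 - t * y) * qchar (1 - y).
(* K t is the sum of sum_qchar_pair without its term y = 0; the term t = 1 has a
   double root and is counted directly. *)
have K1 : K 1 = #|F|%:R - 2.
  rewrite /K (bigD1 1) ?oner_neq0 //= mulr1 subrr qchar0 mulr0 add0r.
  rewrite (eq_bigr (fun=> 1)) => [|x /andP[x0 x1]]; last first.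
    by rewrite mul1r qchar_sqr // subr_eq0 eq_sym.
  rewrite sumr_const (_ : #|_| = (#|F| - 2)%N) ?natrB //; first exact: finNzRing_gt1.
  rewrite -(cardC [set 0; 1 : F]) cards2 eq_sym oner_neq0 addKn.
  by apply: eq_card => x; rewrite !inE negb_or.
have Kt t : t != 0 -> t != 1 -> K t = - qchar t - 1.
  move=> t0 t1; have := sum_qchar_pair t0 t1; rewrite (bigD1 0) //=.
  rewrite mulr0 subr0 qchar1 mulr1 -/(K t) => <-; ring.
have E : jac z * jac y = \sum_t mchar z t * (K t)%:~R.
  rewrite /jac big_distrlr /= exchange_big /= (bigD1 0) //= big1 ?add0r; last first.
    by move=> x _; rewrite mchar0 !mul0r mulr0.
  rewrite (eq_bigr (fun b => \sum_t mchar z t * (qchar (1 - t * b) * qchar (1 - b))%:~R)).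
    rewrite exchange_big /=; apply: eq_bigr => t _.
    by rewrite /K rmorph_sum /= mulr_sumr.
  move=> b b0; rewrite (reindex_inj (mulIf b0)) /=; apply: eq_bigr => t _.
  rewrite (mcharM zq) rmorphM /=.
  have zyb : mchar z b * mchar y b = 1.
    by rewrite /mchar (negPf b0) -exprMn zy expr1n.
  rewrite -[RHS]mulr1 -zyb; ring.
rewrite E (bigD1 1) //= (mchar1 zq) mul1r K1.
have s0 : \sum_t mchar z t = 0.
  by have /eqP := sum_mchar zq; rewrite mulf_eq0 subr_eq0 (negPf z1) => /eqP.
have s1 : \sum_t mchar (- z) t = 0.
  have /eqP := sum_mchar zN; rewrite mulf_eq0 subr_eq0 eqr_oppLR.
  by rewrite (negPf zN1) => /eqP.
have -> : \sum_(i | i != 1) mchar z i * (K i)%:~R =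
          \sum_(i | i != 1) (- mchar (- z) i - mchar z i).
  apply: eq_bigr => t t1; have [->|t0] := eqVneq t 0.
    by rewrite !mchar0 mul0r oppr0 addr0.
  rewrite Kt // rmorphB rmorphN /= qchar_intr -[- z]mulN1r mchar_mul; ring.
move: s0 s1; rewrite (bigD1 1) //= (mchar1 zq) => s0.
rewrite (bigD1 1) //= (mchar1 zN) => s1.
rewrite big_split /= !sumrN; move/eqP: s0; rewrite addrC addr_eq0 => /eqP ->.
move/eqP: s1; rewrite addrC addr_eq0 => /eqP ->.
rewrite rmorphB /= rmorph_nat; ring.
Qed.

End DiscreteLog.

Section ClassSums.
Variables (F : finFieldType) (g : F).
Local Notation q1 := (#|F|.-1).
Hypothesis g_prim : q1.-primitive_root g.
Hypothesis q1_even : ~~ odd q1.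
Local Notation dlog := (dlog g).
Local Notation mchar := (mchar g).
Local Notation qchar := (qchar g).
Local Notation jac := (jac g).

Definition power_class (d r : nat) (x : F) := (x != 0) && (dlog x %% d == r)%N.

(** The integers by which a Jacobi sum of order d is a polynomial in the root of
    unity, whatever the ring. *)
Definition class_sum (d r : nat) : int := \sum_(x | power_class d r x) qchar (1 - x).

Lemma jac_class_sum (S : comPzRingType) (z : S) d : (0 < d)%N -> z ^+ d = 1 ->
  jac z = \sum_(r < d) (class_sum d r)%:~R * z ^+ r.
Proof.
move=> d_gt0 zd; rewrite /jac (bigD1 0) //= mchar0 mul0r add0r.
rewrite (partition_big (fun x => Ordinal (ltn_pmod (dlog x) d_gt0)) xpredT) //=.
apply: eq_bigr => r _; rewrite rmorph_sum /= mulr_suml; apply: eq_big => x.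
  by rewrite -val_eqE.
case/andP=> x0 /eqP <- /=; rewrite expr_mod //= /mchar (negPf x0) mulrC.
by [].
Qed.

(** Combines opposite classes, since z^m = -1 for the roots of unity in use. *)
Definition half_sum (m r : nat) : int := class_sum (m + m) r - class_sum (m + m) (m + r).

Lemma jac_half_sum (S : comPzRingType) (z : S) m : (0 < m)%N -> z ^+ m = -1 ->
  jac z = \sum_(r < m) (half_sum m r)%:~R * z ^+ r.
Proof.
move=> m_gt0 zm; rewrite (@jac_class_sum _ z (m + m)).
- rewrite big_split_ord /= -big_split /=; apply: eq_bigr => r _ /=.
  rewrite exprD zm /half_sum rmorphB /=; ring.
- by rewrite addn_gt0 m_gt0.
- by rewrite exprD zm mulrNN mulr1.
Qed.

(** The substitution x -> x/(x - 1) exchanges the two arguments chi, phi chi^-1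
    of a Jacobi sum. *)
Lemma jac_reflect (S : comPzRingType) (z : S) e :
  z ^+ q1 = 1 -> z ^+ e.+2 = -1 ->
  jac z = mchar z (-1) * \sum_y mchar z (1 - y) * mchar (z ^+ e.+1) y.
Proof.
move=> zq zm; rewrite /jac (reindex_inj (inv_inj (subKr 1))) /=.
rewrite (bigD1 0) //= subKr qchar0 mulr0 add0r [in RHS](bigD1 0) //= mchar0 mulr0 add0r.
rewrite (reindex_inj (@invr_inj F)) /=.
under eq_bigl do rewrite invr_eq0.
rewrite mulr_sumr; apply: eq_bigr => w w0.
rewrite subKr qcharV // qchar_intr -zm !mchar_expr.
have -> : 1 - w^-1 = -1 * (1 - w) * w^-1 by field.
have := mcharV g_prim zq w0; rewrite !(mcharM g_prim zq) exprS => E.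
rewrite -[RHS]mulr1 -{}E; ring.
Qed.

(** For m even, (m-1)^2 = 1 mod 2m, so applying [jac_reflect] to z and to its power
    z^(m-1) exchanges the same two characters.  For orders 8 and 12 this extra
    symmetry confines J to an imaginary quadratic field. *)
Lemma jac_conj (S : comPzRingType) (z : S) m : ~~ odd m -> (0 < m)%N ->
  z ^+ q1 = 1 -> z ^+ m = -1 -> jac z = jac (z ^+ m.-1).
Proof.
case: m => [|[|e]] // e_even _ zq zm; rewrite /= negbK in e_even.
have z2 : z ^+ (e.+2 * 2) = 1 by rewrite exprM zm sqrrN expr1n.
have ze2 : (z ^+ e.+1) ^+ e.+1 = z.
  rewrite -exprM (_ : (_ * _ = e.+2 * 2 * e./2 + 1)%N).
    by rewrite exprD exprM z2 expr1n mul1r.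
  by have := odd_double_half e; rewrite (negPf e_even) -mul2n; nia.
have zeq : (z ^+ e.+1) ^+ q1 = 1 by rewrite -exprM mulnC exprM zq expr1n.
have zem : (z ^+ e.+1) ^+ e.+2 = -1.
  by rewrite -exprM mulnC exprM zm -signr_odd /= e_even expr1.
rewrite (jac_reflect zq zm) (jac_reflect zeq zem) ze2; congr (_ * _).
  rewrite mchar_expr -[in RHS](odd_double_half e.+1) /= e_even -mul2n /=.
  have : mchar z (-1) * mchar z (-1) = 1.
    by rewrite -(mcharM g_prim zq) mulrNN mulr1 (mchar1 g_prim zq).
  by rewrite exprS exprM expr2 => ->; rewrite expr1n mulr1.
rewrite [RHS](reindex_inj (inv_inj (subKr 1))) /=.
by apply: eq_bigr => y _; rewrite subKr mulrC.
Qed.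

Lemma dlog1 : dlog 1 = 0%N.
Proof. by rewrite -(expr0 g) (dlogX g_prim) mod0n. Qed.

(** Every phi(1 - x) is odd except at x = 1, where it vanishes. *)
Lemma class_sum_parity d r : (0 < d)%N -> exists u : int,
  class_sum d r = \sum_(x | power_class d r x) 1 - (r == 0)%N%:R + 2 * u.
Proof.
move=> d_gt0.
exists (- \sum_(x | power_class d r x) ((x != 1) && odd (dlog (1 - x)))%:R).
rewrite /class_sum mulrN.
have -> : (r == 0)%N%:R = \sum_(x | power_class d r x) (x == 1)%:R :> int.
  have [->|r0] := eqVneq r 0.
    rewrite (bigD1 1) /=; last by rewrite /power_class oner_neq0 dlog1 mod0n.
    by rewrite eqxx big1 ?addr0 // => x /andP[_ /negPf ->].
  rewrite big1 // => x; have [->|//] := eqVneq x 1.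
  by rewrite /power_class dlog1 mod0n [0%N == r]eq_sym (negPf r0) andbF.
rewrite mulr_sumr -!sumrB; apply: eq_bigr => x _.
have [->|x1] := eqVneq x 1; first by rewrite subrr qchar0 mulr0 !subr0 subrr.
rewrite /qchar /mchar subr_eq0 eq_sym (negPf x1) /= -signr_odd subr0.
by case: odd.
Qed.

Lemma power_class_shift d r s x : (d %| q1)%N -> (r < d)%N ->
  power_class d ((s + r) %% d) (g ^+ s * x) = power_class d r x.
Proof.
move=> dq rd; rewrite /power_class mulf_eq0 (negPf (genX_neq0 g_prim s)) /=.
have [->|x0] := eqVneq x 0 => //=.
rewrite (dlogM g_prim) ?(genX_neq0 g_prim) // modn_dvdm // (dlogX g_prim).
by rewrite -modnDml (modn_dvdm _ dq) modnDml eqn_modDl (modn_small rd).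
Qed.

Lemma class_count_shift d r s : (d %| q1)%N -> (r < d)%N ->
  \sum_(x | power_class d ((s + r) %% d) x) 1 =
  \sum_(x | power_class d r x) 1 :> int.
Proof.
move=> dq rd; rewrite (reindex_inj (mulfI (genX_neq0 g_prim s))).
by apply: eq_bigl => x; exact: power_class_shift.
Qed.

Lemma half_sum_parity m r : (m + m %| q1)%N -> (r < m)%N ->
  exists u : int, half_sum m r = - (r == 0)%N%:R + 2 * u.
Proof.
move=> mq rm; have m_gt0 : (0 < m + m)%N by rewrite addn_gt0 (leq_ltn_trans _ rm).
have [u uE] := class_sum_parity r m_gt0; have [v vE] := class_sum_parity (m + r) m_gt0.
exists (u - v); rewrite /half_sum uE vE -(class_count_shift m mq (ltn_addr m rm)).
rewrite modn_small ?ltn_add2l // addn_eq0 [m == 0]eqn0Ngt (leq_ltn_trans _ rm) //=.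
ring.
Qed.

(** From 1 - 1/x = -(1 - x)/x, inversion multiplies the terms by phi(-x) = phi(x),
    which is -1 on odd classes. *)
Lemma class_sum_inv d r s : (d %| q1)%N -> ~~ odd d -> (r + s = d)%N -> (s < d)%N ->
  odd r -> qchar (-1) = 1 -> class_sum d s = - class_sum d r.
Proof.
move=> dq d_even rs sd r_odd q1N; rewrite /class_sum (reindex_inj (@invr_inj F)) /=.
have rd : (r < d)%N.
  by rewrite ltn_neqAle; apply/andP; split; [apply: contraTneq r_odd => -> | lia].
have cE x : power_class d s x^-1 = power_class d r x.
  rewrite /power_class invr_eq0; have [//|x0] := eqVneq x 0 => /=.
  have := dlogM g_prim x0 (_ : x^-1 != 0); rewrite invr_eq0 => /(_ x0).
  rewrite divff // dlog1 => /esym/eqP; rewrite -/(dvdn _ _) => /(dvdn_trans dq).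
  have -> : (dlog x^-1 %% d == s)%N = (dlog x^-1 == s %[mod d]).
    by rewrite (modn_small sd).
  have -> : (dlog x %% d == r)%N = (dlog x == r %[mod d]).
    by rewrite (modn_small rd).
  move=> E; apply/idP/idP => /eqP H.
    rewrite -(eqn_modDr s) rs modnn -modnDmr -H modnDmr.
    by move/eqP: E => ->.
  rewrite -(eqn_modDl r) rs modnn -modnDml -H modnDml.
  by move/eqP: E => ->.
rewrite (eq_bigl _ _ cE) -sumrN; apply: eq_bigr => x /andP[x0 /eqP xr].
have -> : 1 - x^-1 = -1 * (1 - x) * x^-1 by field.
rewrite !(qcharM g_prim q1_even) q1N mul1r (qcharV g_prim q1_even) //.
have -> : qchar x = -1; last by rewrite mulrN1.
rewrite /qchar /mchar (negPf x0) -signr_odd (divn_eq (dlog x) d) xr.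
by rewrite oddD oddM (negPf d_even) andbF r_odd.
Qed.

Section Frobenius.
Variable p : nat.
Hypotheses (pF : p \in [pchar F]) (p_odd : odd p).

Lemma qchar_frob x : qchar (x ^+ p) = qchar x.
Proof.
rewrite -(prednK (prime_gt0 (pcharf_prime pF))) /qchar.
rewrite (mcharXn g_prim (sign_q1 q1_even)).
rewrite prednK ?(prime_gt0 (pcharf_prime pF)) //.
rewrite /mchar; case: ifP => _.
  by rewrite expr0n gtn_eqF // prime_gt0 ?(pcharf_prime pF).
by rewrite -exprM -signr_odd oddM p_odd andbT signr_odd.
Qed.

(** The Frobenius fixes phi and multiplies discrete logarithms by p. *)
Lemma class_sum_frob d r : (d %| q1)%N -> (r < d)%N -> (p * p = 1 %[mod d])%N ->
  class_sum d ((p * r) %% d) = class_sum d r.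
Proof.
move=> dq rd pp; rewrite /class_sum (reindex_inj (fmorph_inj (pFrobenius_aut pF))) /=.
apply: eq_big => [x|x _]; last first.
  rewrite -[RHS]qchar_frob; congr qchar.
  have := rmorphB (pFrobenius_aut pF) 1 x; rewrite rmorph1 => E.
  exact: esym E.
rewrite pFrobenius_autE /power_class expf_eq0 prime_gt0 ?(pcharf_prime pF) //=.
have [//|x0] := eqVneq x 0 => /=.
have -> : dlog (x ^+ p) = ((p * dlog x) %% q1)%N.
  by rewrite -{1}(dlogK g_prim x0) -exprM (dlogX g_prim) mulnC.
rewrite modn_dvdm //.
have -> : (dlog x %% d == r)%N = (dlog x == r %[mod d]) by rewrite (modn_small rd).
have ppK i : (p * (p * i) = i %[mod d])%N.
  by rewrite mulnA -modnMml pp modnMml mul1n.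
apply/eqP/eqP => E; last by rewrite -modnMmr E modnMmr.
by rewrite -(ppK (dlog x)) -modnMmr E modnMmr ppK.
Qed.

End Frobenius.
End ClassSums.

(** * Jacobi sums of orders 6, 8 and 12 *)

Lemma prim_root_half (R : idomainType) (z : R) m :
  (m + m).-primitive_root z -> z ^+ m = -1.
Proof.
move=> zP; have m_gt0 : (0 < m)%N by have := prim_order_gt0 zP; case: m {zP}.
have : (z ^+ m - 1) * (z ^+ m + 1) = 0.
  by rewrite -subr_sqr -exprM muln2 -addnn (prim_expr_order zP) expr1n subrr.
move/eqP; rewrite mulf_eq0 subr_eq0 -(prim_order_dvd zP) addr_eq0.
by case/orP=> [/(dvdn_leq m_gt0)|/eqP //]; rewrite -{3}[m]addn0 leq_add2l leqNgt m_gt0.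
Qed.

Section JacobiValues.
Variables (F : finFieldType) (g : F).
Local Notation q1 := (#|F|.-1).
Hypothesis g_prim : q1.-primitive_root g.
Hypothesis q1_even : ~~ odd q1.
Local Notation jac := (jac g).
Local Notation hs := (half_sum g).

Lemma jac_norm_half (z : algC) m : (1 < m)%N -> (m + m %| q1)%N ->
  (m + m).-primitive_root z -> jac z * jac z^-1 = #|F|%:R.
Proof.
move=> m1 mq zP; apply: (jac_norm g_prim q1_even).
- by case/dvdnP: mq => n ->; rewrite mulnC exprM (prim_expr_order zP) expr1n.
- apply: divff; apply: contraTneq (oner_neq0 algC) => z0.
  by rewrite -(prim_expr_order zP) z0 expr0n gtn_eqF ?eqxx // (prim_order_gt0 zP).
- rewrite -{1}[z]expr1 -(prim_order_dvd zP) dvdn1; lia.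
- apply: contraTneq (dvdnn (m + m)) => zN; rewrite {2}(_ : m + m = 2 + (m + m - 2))%N; last lia.
  have : (m + m %| 2)%N by rewrite (prim_order_dvd zP) zN sqrrN expr1n.
  move/dvdn_leq => /(_ isT) H; have : m = 1%N by lia.
  by move=> E; rewrite E in m1.
Qed.

(** [jac_conj] is one equation A (z - z^3) = 2 B z^2 between integers A and B; its
    square has rational coefficients and reads A^2 + 2 B^2 = 0. *)
Lemma half_sum_sym8 : (8 %| q1)%N -> hs 4 3 = hs 4 1 /\ hs 4 2 = 0.
Proof.
move=> dq; have [z zP] := C_prim_root_exists (isT : (0 < 8)%N).
have z4 : z ^+ 4 = -1 := prim_root_half (zP : (4 + 4).-primitive_root z).
have zq : z ^+ q1 = 1.
  by case/dvdnP: dq => n ->; rewrite mulnC exprM (prim_expr_order zP) expr1n.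
have := jac_conj g_prim q1_even (isT : ~~ odd 4) isT zq z4.
have z34 : (z ^+ 3) ^+ 4 = -1 by rewrite -exprM mulnC exprM z4 -signr_odd expr1.
rewrite /= (jac_half_sum g _ z4) // (jac_half_sum g _ z34) //.
rewrite !big_ord_recr !big_ord0 /= !add0r => E.
pose A := hs 4 3 - hs 4 1; pose B := hs 4 2.
have {}E : A%:~R * (z - z ^+ 3) = 2 * B%:~R * z ^+ 2 :> algC.
  apply/eqP; rewrite -subr_eq0 -oppr_eq0; apply/eqP.
  move/eqP: E; rewrite -subr_eq0 => /eqP; rewrite -!exprM.
  have -> : z ^+ (3 * 2) = - z ^+ 2 by rewrite -[(3 * 2)%N]/(4 + 2)%N exprD z4 mulN1r.
  have -> : z ^+ (3 * 3) = z by rewrite -[(3 * 3)%N]/(4 + 4 + 1)%N !exprD z4 mulrNN !mul1r.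
  move=> <-; rewrite /A /B rmorphB /=; ring.
have : (A ^+ 2 + 2 * B ^+ 2)%:~R = 0 :> algC.
  have : (A%:~R * (z - z ^+ 3)) ^+ 2 = (2 * B%:~R * z ^+ 2) ^+ 2 :> algC by rewrite E.
  have -> : (A%:~R * (z - z ^+ 3)) ^+ 2 =
     A%:~R ^+ 2 * (z ^+ 2 - 2 * z ^+ 4 + z ^+ 4 * z ^+ 2) by ring.
  have -> : (2 * B%:~R * z ^+ 2) ^+ 2 = 4 * B%:~R ^+ 2 * z ^+ 4 by ring.
  rewrite z4 => {}E; apply: (mulfI (_ : 2 != 0)); first by rewrite pnatr_eq0.
  rewrite mulr0 rmorphD rmorphM /= !rmorphXn /=.
  move/eqP: E; rewrite -subr_eq0 => /eqP <-; ring.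
move/eqP; rewrite intr_eq0 => /eqP AB.
have A0 : A = 0 by nia.
have B0 : B = 0 by nia.
by split=> //; apply/eqP; rewrite -subr_eq0 -/A A0.
Qed.

(** An element of Z[z + z^3], where (z + z^3)^2 = -2. *)
Lemma jac_value8 : (8 %| q1)%N -> exists u v : int,
  [/\ u ^+ 2 + 2 * v ^+ 2 = #|F|%:Z &
      forall (S : comPzRingType) (z : S), z ^+ 4 = -1 ->
        jac z = u%:~R + v%:~R * (z + z ^+ 3)].
Proof.
move=> dq; have [s31 s2] := half_sum_sym8 dq.
have E (S : comPzRingType) (z : S) : z ^+ 4 = -1 ->
    jac z = (hs 4 0)%:~R + (hs 4 1)%:~R * (z + z ^+ 3).
  move=> z4; rewrite (jac_half_sum g _ z4) //.
  rewrite !big_ord_recr !big_ord0 /= s31 s2; ring.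
exists (hs 4 0), (hs 4 1); split=> //.
have [z zP] := C_prim_root_exists (isT : (0 < 8)%N).
have z4 : z ^+ 4 = -1 := prim_root_half (zP : (4 + 4).-primitive_root z).
have zV : z^-1 = - z ^+ 3.
  apply: (@mulfI _ z); first by apply: contra_eq_neq z4 => ->; rewrite expr0n eq_sym oppr_eq0 oner_eq0.
  rewrite divff ?mulrN -?exprS ?z4 ?opprK //.
  by apply: contra_eq_neq z4 => ->; rewrite expr0n eq_sym oppr_eq0 oner_eq0.
have := jac_norm_half (isT : (1 < 4)%N) dq zP.
rewrite (E _ _ z4) (E algC z^-1) => [H|]; last by rewrite exprVn z4 invrN1.
apply: (intr_inj (R := algC)).
rewrite -[RHS]/(#|F|%:R) -{}H zV rmorphD rmorphM /= !rmorphXn /=.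
have -> : (- z ^+ 3) ^+ 3 = - (z ^+ 4 * z ^+ 4 * z) by ring.
rewrite z4.
transitivity ((hs 4 0)%:~R ^+ 2 - (hs 4 1)%:~R ^+ 2 * (z ^+ 2 + 2 * z ^+ 4 + z ^+ 4 * z ^+ 2)).
  rewrite z4; ring.
ring.
Qed.

Lemma cyclotomic12 (z : algC) : 12.-primitive_root z -> z ^+ 4 = z ^+ 2 - 1.
Proof.
move=> zP; have z6 : z ^+ 6 = -1 := prim_root_half (zP : (6 + 6).-primitive_root z).
have : (z ^+ 2 + 1) * (z ^+ 4 - z ^+ 2 + 1) = 0.
  transitivity (z ^+ 6 + 1); [ring | by rewrite z6 addNr].
move/eqP; rewrite mulf_eq0 => /orP[|/eqP H].
  rewrite addr_eq0 => /eqP z2; have : (12 %| 4)%N; last by [].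
  by rewrite (prim_order_dvd zP) -[4%N]/(2 * 2)%N exprM z2 sqrrN expr1n.
by apply/eqP; rewrite -subr_eq0 -H; apply/eqP; ring.
Qed.

(** As for order 8: the square of the equation given by [jac_conj] reads
    A^2 + B^2 = 0. *)
Lemma half_sum_sym12 : (12 %| q1)%N -> hs 6 5 = hs 6 1 /\ hs 6 4 = - hs 6 2.
Proof.
move=> dq; have [z zP] := C_prim_root_exists (isT : (0 < 12)%N).
have z6 : z ^+ 6 = -1 := prim_root_half (zP : (6 + 6).-primitive_root z).
have z4 := cyclotomic12 zP.
have zq : z ^+ q1 = 1.
  by case/dvdnP: dq => n ->; rewrite mulnC exprM (prim_expr_order zP) expr1n.
have := jac_conj g_prim q1_even (isT : ~~ odd 6) isT zq z6.
have z56 : (z ^+ 5) ^+ 6 = -1 by rewrite -exprM mulnC exprM z6 -signr_odd expr1.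
rewrite /= (jac_half_sum g _ z6) // (jac_half_sum g _ z56) //.
have z5 : z ^+ 5 = z ^+ 3 - z by rewrite exprSr z4; ring.
rewrite !big_ord_recr !big_ord0 /= !add0r => E.
pose A := hs 6 1 - hs 6 5; pose B := hs 6 2 + hs 6 4.
have {}E : A%:~R * (2 * z - z ^+ 3) = - B%:~R * (2 * z ^+ 2 - 1) :> algC.
  apply/eqP; rewrite -subr_eq0; apply/eqP.
  move/eqP: E; rewrite -subr_eq0 => /eqP; rewrite -!exprM.
  have -> : z ^+ (5 * 1) = z ^+ 5 by [].
  have -> : z ^+ (5 * 2) = - z ^+ 4 by rewrite -[(5 * 2)%N]/(6 + 4)%N exprD z6 mulN1r.
  have -> : z ^+ (5 * 3) = z ^+ 3.
    rewrite -[(5 * 3)%N]/(6 + 6 + 3)%N !exprD z6; ring.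
  have -> : z ^+ (5 * 4) = - z ^+ 2.
    rewrite -[(5 * 4)%N]/(6 + 6 + 6 + 2)%N !exprD z6; ring.
  have -> : z ^+ (5 * 5) = z.
    rewrite -[(5 * 5)%N]/(6 + 6 + 6 + 6 + 1)%N !exprD z6; ring.
  move=> <-; rewrite z5 z4 /A /B rmorphB [(hs 6 2 + _)%:~R]rmorphD /=; ring.
have : (A ^+ 2 + B ^+ 2)%:~R = 0 :> algC.
  have : (A%:~R * (2 * z - z ^+ 3)) ^+ 2 = (- B%:~R * (2 * z ^+ 2 - 1)) ^+ 2 :> algC.
    by rewrite E.
  have -> : (A%:~R * (2 * z - z ^+ 3)) ^+ 2 =
     A%:~R ^+ 2 * (4 * z ^+ 2 - 4 * z ^+ 4 + z ^+ 6) by ring.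
  have -> : (- B%:~R * (2 * z ^+ 2 - 1)) ^+ 2 = B%:~R ^+ 2 * (4 * z ^+ 4 - 4 * z ^+ 2 + 1) by ring.
  rewrite z6 z4 => {}E; apply: (mulfI (_ : 3 != 0)); first by rewrite pnatr_eq0.
  rewrite mulr0 rmorphD /= !rmorphXn /=.
  move/eqP: E; rewrite -subr_eq0 => /eqP <-; ring.
move/eqP; rewrite intr_eq0 => /eqP AB.
have A0 : A = 0 by nia.
have B0 : B = 0 by nia.
by split; apply/eqP; rewrite -?addr_eq0 1?addrC -/B ?B0 // eq_sym -subr_eq0 -/A A0.
Qed.

(** An element of Z[z^3], where z^3 is a square root of -1. *)
Lemma jac_value12 : (12 %| q1)%N -> exists v : int,
  let u := hs 6 0 + hs 6 2 in
  [/\ u ^+ 2 + v ^+ 2 = #|F|%:Z, exists w, u = 1 + 2 * w &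
      forall (S : comPzRingType) (z : S), z ^+ 6 = -1 -> z ^+ 4 = z ^+ 2 - 1 ->
        jac z = u%:~R + v%:~R * z ^+ 3].
Proof.
move=> dq; have [s51 s42] := half_sum_sym12 dq.
have E (S : comPzRingType) (z : S) : z ^+ 6 = -1 -> z ^+ 4 = z ^+ 2 - 1 ->
    jac z = (hs 6 0 + hs 6 2)%:~R + (hs 6 1 + hs 6 3)%:~R * z ^+ 3.
  move=> z6 z4; rewrite (jac_half_sum g _ z6) //.
  have z5 : z ^+ 5 = z ^+ 3 - z by rewrite exprSr z4; ring.
  rewrite !big_ord_recr !big_ord0 /= s51 s42 z5 z4 rmorphN !rmorphD /=; ring.
exists (hs 6 1 + hs 6 3); split=> //.
- have [z zP] := C_prim_root_exists (isT : (0 < 12)%N).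
  have z6 : z ^+ 6 = -1 := prim_root_half (zP : (6 + 6).-primitive_root z).
  have z4 := cyclotomic12 zP.
  have zV : (z^-1) ^+ 3 = - z ^+ 3.
    have z3 : z ^+ 3 != 0.
      by apply: contra_eq_neq z6 => z3; rewrite -[6%N]/(3 + 3)%N exprD z3 mul0r eq_sym oppr_eq0 oner_eq0.
    by apply: (mulfI z3); rewrite exprVn divff // mulrN -exprD z6 opprK.
  have := jac_norm_half (isT : (1 < 6)%N) dq zP.
  rewrite (E _ _ z6 z4) (E algC z^-1); first last.
  + have z0 : z != 0.
      by apply: contra_eq_neq z6 => ->; rewrite expr0n eq_sym oppr_eq0 oner_eq0.
    apply: (mulIf (expf_neq0 4 z0)); rewrite mulrBl mul1r -exprMn mulVf // expr1n.
    have -> : z^-1 ^+ 2 * z ^+ 4 = z ^+ 2 by field.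
    by rewrite z4 opprB addrC subrK.
  + by rewrite exprVn z6 invrN1.
  move=> H; apply: (intr_inj (R := algC)).
  rewrite -[RHS]/(#|F|%:R) -{}H zV rmorphD /= !rmorphXn /=.
  set u := intmul 1 _; set v := intmul 1 _.
  transitivity (u ^+ 2 - v ^+ 2 * z ^+ 6); [rewrite z6|]; ring.
have [a ->] := half_sum_parity (m := 6) g_prim dq (isT : (0 < 6)%N).
have [b ->] := half_sum_parity (m := 6) g_prim dq (isT : (2 < 6)%N).
by exists (a + b - 1); rewrite /=; ring.
Qed.

Lemma jac_value6 : (6 %| q1)%N -> exists a b : int,
  [/\ a ^+ 2 + a * b + b ^+ 2 = #|F|%:Z, exists w, b = 2 * w &
      forall (S : comPzRingType) (z : S), z ^+ 2 = z - 1 ->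
        jac z = a%:~R + b%:~R * z].
Proof.
move=> dq.
have z3P (S : comPzRingType) (z : S) : z ^+ 2 = z - 1 -> z ^+ 3 = -1.
  by move=> z2; rewrite exprSr z2 mulrBl mul1r -expr2 z2; ring.
have E (S : comPzRingType) (z : S) : z ^+ 2 = z - 1 ->
    jac z = (hs 3 0 - hs 3 2)%:~R + (hs 3 1 + hs 3 2)%:~R * z.
  move=> z2; rewrite (jac_half_sum g _ (z3P _ _ z2)) //.
  rewrite !big_ord_recr !big_ord0 /= z2 [(hs 3 0 - _)%:~R]rmorphB [(hs 3 1 + _)%:~R]rmorphD /=; ring.
exists (hs 3 0 - hs 3 2), (hs 3 1 + hs 3 2); split=> //.
- have [z zP] := C_prim_root_exists (isT : (0 < 6)%N).
  have z3 : z ^+ 3 = -1 := prim_root_half (zP : (3 + 3).-primitive_root z).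
  have z2 : z ^+ 2 = z - 1.
    have : (z + 1) * (z ^+ 2 - z + 1) = 0.
      transitivity (z ^+ 3 + 1); [ring | by rewrite z3 addNr].
    move/eqP; rewrite mulf_eq0 => /orP[|/eqP H].
      rewrite addr_eq0 => /eqP z1; have : (6 %| 2)%N; last by [].
      by rewrite (prim_order_dvd zP) z1 sqrrN expr1n.
    by apply/eqP; rewrite -subr_eq0 -H; apply/eqP; ring.
  have zV : z^-1 = 1 - z.
    have z0 : z != 0 by apply: contra_eq_neq z3 => ->; rewrite expr0n eq_sym oppr_eq0 oner_eq0.
    by apply: (mulfI z0); rewrite divff // mulrBr mulr1 -expr2 z2; ring.
  have := jac_norm_half (isT : (1 < 3)%N) dq zP.
  rewrite (E _ _ z2) (E algC z^-1); last first.
    have -> : z^-1 ^+ 2 = 1 - 2 * z + z ^+ 2 by rewrite zV; ring.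
    by rewrite zV z2; ring.
  move: (hs 3 0 - hs 3 2) (hs 3 1 + hs 3 2) => {E} u v H.
  apply: (intr_inj (R := algC)).
  rewrite -[RHS]/(#|F|%:R) -{}H zV !rmorphD rmorphM /= !rmorphXn /=.
  set a := intmul 1 u; set b := intmul 1 v.
  transitivity (a ^+ 2 + a * b + b ^+ 2 * (z - z ^+ 2)); [rewrite z2|]; ring.
have [a ->] := half_sum_parity (m := 3) g_prim dq (isT : (1 < 3)%N).
have [b ->] := half_sum_parity (m := 3) g_prim dq (isT : (2 < 3)%N).
by exists (a + b); rewrite /=; ring.
Qed.

Lemma qcharN1 : (4 %| q1)%N -> qchar g (-1) = 1.
Proof.
case/dvdnP=> n q1E.
have n_gt0 : (0 < n)%N by have := prim_order_gt0 g_prim; rewrite q1E; case: n {q1E}.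
have : g ^+ (n * 2) = -1.
  by apply: prim_root_half; rewrite -mulnDr -q1E.
move=> <-; rewrite muln2 -addnn exprD (qcharM g_prim q1_even).
by rewrite (qchar_sqr g) // (genX_neq0 g_prim).
Qed.

(** For q = p^2 the Frobenius, of order two on the 12 classes, and inversion leave
    few class sums.  The trivial and the cubic character give two linear relations:
    J is -1 for the former, and for the latter p or -p, the sign being known modulo 3.
    With the parity of the class sums these determine the real part modulo 4. *)
Lemma jac_value12_sign p : prime p -> #|F| = (p ^ 2)%N -> (p %% 12 = 5)%N ->
  exists w, hs 6 0 + hs 6 2 = 1 + 4 * w.
Proof.
move=> p_pr cF p5; have pF := card_finPcharP cF p_pr.
have pE := divn_eq p 12; rewrite p5 in pE; set k := (p %/ 12)%N in pE.
have p_odd : odd p by rewrite pE oddD oddM andbF.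
have dq : (12 %| q1)%N.
  apply/dvdnP; exists (2 * (3 * k + 1) * (2 * k + 1))%N; rewrite cF {1}pE expnS expn1; nia.
have pp : (p * p = 1 %[mod 12])%N by rewrite -modnMml -modnMmr p5.
pose N := class_sum g 12.
have frob r : (r < 12)%N -> N ((5 * r) %% 12)%N = N r.
  move=> r12; rewrite -[RHS](class_sum_frob g_prim q1_even pF p_odd dq r12 pp).
  by rewrite -(modnMml p) p5.
have N51 : N 5%N = N 1%N := frob 1%N isT.
have N10 : N 10%N = N 2%N := frob 2%N isT.
have N8 : N 8%N = N 4%N := frob 4%N isT.
have N11 : N 11%N = N 7%N := frob 7%N isT.
have qN : qchar g (-1) = 1 by apply: qcharN1; apply: dvdn_trans dq.
have N9 : N 9%N = - N 3%N by apply: class_sum_inv.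
have N7 : N 7%N = - N 5%N by apply: class_sum_inv.
(* The trivial character. *)
have one : N 0%N + N 6%N + 2 * (N 2%N + N 4%N) = -1.
  have : jac (1 : int) = -1.
    rewrite /jac (bigD1 0) //= mchar0 mul0r add0r.
    rewrite (eq_bigr (fun x => qchar g (1 - x))) => [|x x0]; last first.
      by rewrite /mchar (negPf x0) expr1n mul1r intz.
    have := sum_qchar g_prim q1_even.
    rewrite (reindex_inj (inv_inj (subKr 1))) (bigD1 0) //= subr0.
    by rewrite (qchar1 g_prim q1_even) => /eqP; rewrite addrC addr_eq0 => /eqP.
  rewrite (jac_class_sum g (isT : (0 < 12)%N) (expr1n _ _)).
  rewrite !big_ord_recr !big_ord0 /= !expr1n !mulr1 !intz.
  rewrite -/N N11 N10 N9 N8 N7 N51. lia.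
(* The cubic character: the Frobenius conjugates its values, so J is rational. *)
have cube : (N 0%N + N 6%N - (N 2%N + N 4%N)) ^+ 2 = (p%:Z) ^+ 2.
  have [z zP] := C_prim_root_exists (isT : (0 < 3)%N).
  have z3 : z ^+ 3 = 1 := prim_expr_order zP.
  have z2 : z ^+ 2 = - z - 1.
    have : (z - 1) * (z ^+ 2 + z + 1) = 0.
      transitivity (z ^+ 3 - 1); [ring | by rewrite z3 subrr].
    move/eqP; rewrite mulf_eq0 => /orP[|/eqP H].
      rewrite subr_eq0 -[z]expr1 -(prim_order_dvd zP) //.
    by apply/eqP; rewrite -subr_eq0 -H; apply/eqP; ring.
  have J (y : algC) : y ^+ 3 = 1 -> y ^+ 2 = - y - 1 ->
      jac y = (N 0%N + N 6%N - (N 2%N + N 4%N))%:~R.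
    move=> y3 y2; rewrite (jac_class_sum g (isT : (0 < 12)%N)); last first.
      by rewrite -[12%N]/(3 * 4)%N exprM y3 expr1n.
    rewrite !big_ord_recr !big_ord0 /=.
    have y4 : y ^+ 4 = y by rewrite exprSr y3 mul1r.
    have y5 : y ^+ 5 = y ^+ 2 by rewrite exprSr y4 -expr2.
    have y6 : y ^+ 6 = 1 by rewrite exprSr y5 -exprSr y3.
    have y7 : y ^+ 7 = y by rewrite exprSr y6 mul1r.
    have y8 : y ^+ 8 = y ^+ 2 by rewrite exprSr y7 -expr2.
    have y9 : y ^+ 9 = 1 by rewrite exprSr y8 -exprSr y3.
    have y10 : y ^+ 10 = y by rewrite exprSr y9 mul1r.
    have y11 : y ^+ 11 = y ^+ 2 by rewrite exprSr y10 -expr2.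
    rewrite y11 y10 y9 y8 y7 y6 y5 y4 y3 y2 -/N.
    by rewrite N11 N10 N9 N8 N7 N51 !rmorphB !rmorphD !rmorphN /=; ring.
  have zV : z * z ^+ 2 = 1 by rewrite -exprS.
  have z1 : z != 1.
    by rewrite -{1}[z]expr1 -(prim_order_dvd zP).
  have := jac_norm g_prim q1_even _ zV z1.
  have zq : z ^+ q1 = 1.
    case/dvdnP: dq => n ->; rewrite (_ : n * 12 = 3 * (4 * n))%N; last lia.
    by rewrite exprM z3 expr1n.
  move=> /(_ zq); rewrite (J z) // (J (z ^+ 2)); first last.
  - by rewrite -exprM -[(2 * 2)%N]/(3 + 1)%N exprD z3 z2; ring.
  - by rewrite -exprM mulnC exprM z3 expr1n.
  have zN : z != -1.
    apply: contra_eq_neq z3 => ->; rewrite -signr_odd expr1 eq_sym -subr_eq0 opprK.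
    by rewrite -[1 + 1]/(2%:R) pnatr_eq0.
  move=> /(_ zN) H; apply: (intr_inj (R := algC)).
  by rewrite expr2 rmorphM /= H cF rmorphXn /= natrX.
have [a aE] := class_sum_parity g_prim 6 (isT : (0 < 12)%N).
have [b bE] := class_sum_parity g_prim 4 (isT : (0 < 12)%N).
rewrite -(class_count_shift g_prim 2 dq (isT : (4 < 12)%N)) /= subr0 in bE.
rewrite /= subr0 in aE.
have E : hs 6 0 + hs 6 2 = N 0%N + N 6%N + (N 2%N + N 4%N) - 2 * N 6%N - 2 * N 4%N.
  by rewrite /half_sum -/N N8; ring.
have N64 : N 6%N - N 4%N = 2 * (a - b) by rewrite /N aE bE; ring.
have [m mE] : exists m, N 4%N = N 6%N - 2 * m by exists (a - b); rewrite -N64; ring.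
have /eqP := cube; rewrite eqf_sqr => /orP[] /eqP P.
  exists (k%:Z - N 6%N + m); rewrite E; lia.
lia.
Qed.

End JacobiValues.

(** * Jacobi sums as binomial coefficients modulo p^2 *)

Lemma residue_small Q H n j m : (H + H = Q)%N -> (0 < Q)%N -> (n <= H)%N ->
  (j < H.+1)%N -> (Q - n + j = m * Q)%N -> j = n.
Proof. by case: m => [|[|m]]; rewrite ?mulSn ?mul0n; lia. Qed.

Lemma residue_large Q H n j m : (H + H = Q)%N -> (0 < Q)%N -> (n <= H)%N ->
  (j < (H + Q).+1)%N -> (Q - n + j = m * Q)%N -> j = n \/ j = (n + Q)%N.
Proof. by case: m => [|[|[|m]]]; rewrite ?mulSn ?mul0n; lia. Qed.

Section WittJacobi.
Variables (F : finFieldType) (g : F) (p k : nat).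
Local Notation q1 := (#|F|.-1).
Hypothesis g_prim : q1.-primitive_root g.
Hypotheses (p_pr : prime p) (p_odd : odd p) (k_gt0 : (0 < k)%N).
Hypothesis cardF : #|F| = (p ^ k)%N.
Local Notation W := (witt2 F).
Local Notation B := (q1./2).
Local Notation eps := (@eps F).

Lemma q1_gt0 : (0 < q1)%N. Proof. exact: prim_order_gt0 g_prim. Qed.

Lemma q1_half : (B + B = q1)%N.
Proof.
have : odd #|F| by rewrite cardF oddX p_odd orbT.
rewrite -(ltn_predK (finNzRing_gt1 F)) /= => /negPf q1_odd.
by rewrite -[RHS]odd_double_half q1_odd addnn.
Qed.

Lemma q1_even : ~~ odd q1. Proof. by rewrite -q1_half addnn odd_double. Qed.

Lemma natr_q1 : q1%:R = -1 :> F.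
Proof.
apply/eqP; rewrite -addr_eq0 natr1 (ltn_predK (finNzRing_gt1 F)) cardF.
by rewrite -(prednK k_gt0) expnS natrM (pcharf0 (card_finPcharP cardF p_pr)) mul0r.
Qed.

Lemma teich_q1 : teich g ^+ q1 = 1.
Proof. by rewrite -teichX (prim_expr_order g_prim). Qed.

Lemma pchar_neq2 : 2 != 0 :> F.
Proof.
rewrite -[2]/(2%:R) (pchar_natr_eq0 p_pr cardF); apply: contraL p_odd => p2.
by have /eqP -> : p == 2%N by rewrite -dvdn_prime2.
Qed.

Lemma teichN1 : teich (-1 : F) = -1.
Proof.
have u2 : (teich (-1 : F) - 1) \is a GRing.unit.
  rewrite witt2_unitE -[X in X != 0]/(-1 - 1 : F) -opprD oppr_eq0.
  exact: pchar_neq2.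
apply/eqP; rewrite -addr_eq0; apply/eqP/(mulrI u2).
rewrite mulr0 -[X in _ * (_ + X)]/(1) -subr_sqr expr1n -teichX sqrrN expr1n.
by rewrite teich1 subrr.
Qed.

Lemma teich_gB : teich g ^+ B = -1.
Proof.
rewrite -teichX (_ : g ^+ B = -1) ?teichN1 //.
by apply: prim_root_half; rewrite q1_half.
Qed.

(** Orthogonality holds because a root of unity different from 1 stays different
    from 1 modulo p. *)
Lemma sum_teich e :
  \sum_(x : F | x != 0) teich x ^+ e = if (q1 %| e)%N then q1%:R else 0 :> W.
Proof.
rewrite (sum_dlog g_prim) (eq_bigr (fun i : 'I_q1 => (teich g ^+ e) ^+ i)); last first.
  by move=> i _; rewrite teichX -!exprM mulnC.
case: ifP => [/dvdnP[n ->]|ne].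
  rewrite (eq_bigr (fun=> 1)) => [|i _]; first by rewrite sumr_const card_ord.
  by rewrite -exprM -mulnA mulnC mulnAC -mulnA exprM teich_q1 expr1n.
have u : (teich g ^+ e - 1) \is a GRing.unit.
  rewrite -teichX witt2_unitE -[X in X != 0]/(g ^+ e - 1) subr_eq0.
  by rewrite -(prim_order_dvd g_prim) ne.
apply: (mulrI u); rewrite mulr0 -subrX1 -exprM mulnC exprM teich_q1 expr1n.
by rewrite subrr.
Qed.

(** Both powers of 1 - teich x equal the quadratic character up to a factor in
    1 + pW, raised to the exponents B and B - 1 modulo p; the affine combination
    cancels these factors. *)
Lemma qchar_teich (x : F) :
  (qchar g (1 - x))%:~R =
  (1 - B%:R) * (1 - teich x) ^+ B + B%:R * (1 - teich x) ^+ (B + q1) :> W.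
Proof.
have B_gt0 : (0 < B)%N by have := q1_gt0; have := q1_half; lia.
have [->|x1] := eqVneq x 1.
  rewrite !subrr qchar0 !expr0n addn_eq0 [B == 0%N]eqn0Ngt B_gt0 /=.
  by rewrite !mulr0 addr0.
have y0 : 1 - x != 0 by rewrite subr_eq0 eq_sym.
pose y := 1 - x; have [r rE] := witt2_fst_eq p_pr k_gt0 cardF
  (erefl : @witt2_fst F (1 - teich x) = witt2_fst (teich y)).
have uy : teich y \is a GRing.unit by rewrite witt2_unitE.
have [c ->] : exists c, 1 - teich x = teich y * (1 + eps c).
  by rewrite rE (addp_eps1 p_pr cardF r uy); exists (witt2_fst r / witt2_fst (teich y)).
have yq : teich y ^+ q1 = 1.
  by rewrite -[X in teich X](dlogK g_prim y0) teichX exprAC teich_q1 expr1n.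
have yB : teich y ^+ B = (qchar g y)%:~R.
  rewrite qchar_intr /mchar (negPf y0) -[X in teich X](dlogK g_prim y0) teichX exprAC.
  by rewrite teich_gB.
rewrite !exprMn exprD yq mulr1 yB !eps1X -/y.
set s := intmul 1 _.
have -> : (B + q1)%:R * c = B%:R * c - c by rewrite natrD natr_q1; ring.
have -> : (1 - B%:R) * (s * (1 + eps (B%:R * c))) + B%:R * (s * (1 + eps (B%:R * c - c)))
  = s * (1 + ((1 - B%:R) * eps (B%:R * c) + B%:R * eps (B%:R * c - c))) by ring.
rewrite !mul_eps -raddfD (_ : _ + _ = 0) ?raddf0 ?addr0 ?mulr1 //.
rewrite -[witt2_fst _]/(1 - witt2_fst B%:R) rmorph_nat; ring.
Qed.

(** By [qchar_teich] the sum expands into powers of Teichmueller representatives, of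
    which only those with exponent divisible by q - 1 contribute. *)
Lemma jac_teich n : (n <= B)%N ->
  jac g (teich g ^+ (q1 - n)) =
  q1%:R * (-1) ^+ n * ((1 - B%:R) * 'C(B, n)%:R +
     B%:R * ('C(B + q1, n)%:R + 'C(B + q1, B - n)%:R)) :> W.
Proof.
move=> nB; have B_gt0 : (0 < B)%N by have := q1_gt0; have := q1_half; lia.
pose A := (q1 - n)%N; have qB := q1_half.
have q1g := q1_gt0.
have expand M : \sum_(x : F | x != 0) teich x ^+ A * (1 - teich x) ^+ M =
    \sum_(j < M.+1) (-1) ^+ j * 'C(M, j)%:R *
       (if (q1 %| A + j)%N then q1%:R else 0) :> W.
  under eq_bigr => x _.
    rewrite exprBn mulr_sumr.
    under eq_bigr => j _ do
      rewrite expr1n mulr1 -mulr_natr mulrA mulrCA -exprD mulrAC mulrC mulrA.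
    over.
  rewrite exchange_big /=; apply: eq_bigr => j _.
  rewrite -sum_teich mulr_sumr; apply: eq_bigr => x _; ring.
have SB : \sum_(x : F | x != 0) teich x ^+ A * (1 - teich x) ^+ B =
    q1%:R * (-1) ^+ n * 'C(B, n)%:R :> W.
  rewrite expand (bigD1 (inord n)) //= inordK // (_ : A + n = q1)%N; last by rewrite /A; lia.
  rewrite dvdnn big1 => [|j jn]; first by rewrite addr0; ring.
  have jn' : nat_of_ord j <> n.
    by move=> E; case/negP: jn; apply/eqP/val_inj; rewrite /= inordK // E.
  rewrite ifF ?mulr0 //; apply/negP => /dvdnP[m mE].
  exact/jn'/(residue_small qB q1g nB _ mE)/ltn_ord.
have SBq : \sum_(x : F | x != 0) teich x ^+ A * (1 - teich x) ^+ (B + q1) =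
    q1%:R * (-1) ^+ n * ('C(B + q1, n)%:R + 'C(B + q1, B - n)%:R) :> W.
  have n1 : (n < (B + q1).+1)%N by lia.
  have n2 : (n + q1 < (B + q1).+1)%N by lia.
  rewrite expand (bigD1 (inord n)) //= inordK // (_ : A + n = q1)%N; last by rewrite /A; lia.
  rewrite dvdnn (bigD1 (inord (n + q1))) /=; last first.
    by rewrite -val_eqE /= !inordK // -[X in _ != X]addn0 eqn_add2l -lt0n.
  rewrite inordK // (_ : A + (n + q1) = q1 * 2)%N; last by rewrite /A; lia.
  rewrite dvdn_mulr // big1 => [|j /andP[jn jnq]]; last first.
    have jn' : nat_of_ord j <> n.
      by move=> E; case/negP: jn; apply/eqP/val_inj; rewrite /= inordK // E.
    have jnq' : nat_of_ord j <> (n + q1)%N.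
      by move=> E; case/negP: jnq; apply/eqP/val_inj; rewrite /= inordK // E.
    rewrite ifF ?mulr0 //; apply/negP => /dvdnP[m mE].
    by case: (residue_large qB q1g nB _ mE); first exact: ltn_ord.
  have -> : 'C(B + q1, n + q1) = 'C(B + q1, B - n).
    by rewrite -bin_sub 1?addnC; [congr 'C(_, _); lia | lia].
  rewrite exprD -[(-1) ^+ q1]signr_odd (negPf q1_even) addr0; ring.
rewrite /jac (bigD1 0) //= mchar0 mul0r add0r -/A.
rewrite (eq_bigr (fun x => (1 - B%:R) * (teich x ^+ A * (1 - teich x) ^+ B) +
    B%:R * (teich x ^+ A * (1 - teich x) ^+ (B + q1)))) => [|x x0].
  by rewrite big_split -!mulr_sumr /= SB SBq; ring.
rewrite qchar_teich.
have -> : mchar g (teich g ^+ A) x = teich x ^+ A.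
  by rewrite /mchar (negPf x0) -[in RHS](dlogK g_prim x0) teichX exprAC.
ring.
Qed.

End WittJacobi.

(** * Binomial coefficients modulo p^2 *)

Lemma central_binS k : (k.+1 * 'C(k.+1.*2, k.+1) = 2 * k.*2.+1 * 'C(k.*2, k))%N.
Proof.
have := mul_bin_down k.*2.+1 k; rewrite /= -mulnA => ->.
rewrite doubleS -(mul_bin_diag k.*2.+2 k) /=.
by rewrite (_ : k.*2.+1 - k = k.+1)%N; [rewrite -!muln2; ring | lia].
Qed.

Section BinomialsModP2.
Variables (F : finFieldType) (p k : nat).
Hypotheses (p_pr : prime p) (p_odd : odd p) (k_gt0 : (0 < k)%N).
Hypothesis cardF : #|F| = (p ^ k)%N.
Local Notation W := (witt2 F).
Local Notation eps := (@eps F).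
Let p_gt0 : (0 < p)%N := prime_gt0 p_pr.

Definition harm (n : nat) : F := \sum_(i < n) (i.+1%:R)^-1.

Lemma harmS n : harm n.+1 = harm n + n.+1%:R^-1.
Proof. by rewrite /harm big_ord_recr. Qed.

Lemma natr_neq0 n : (0 < n < p)%N -> n%:R != 0 :> F.
Proof.
case/andP=> n0 np; rewrite (pchar_natr_eq0 p_pr cardF).
by apply/negP => /(dvdn_leq n0); rewrite leqNgt np.
Qed.

Lemma natr_witt_unit n : (0 < n < p)%N -> (n%:R : W) \is a GRing.unit.
Proof. by move=> np; rewrite witt2_unitE rmorph_nat natr_neq0. Qed.

Lemma fact_witt_unit n : (n < p)%N -> (n`!%:R : W) \is a GRing.unit.
Proof.
elim: n => [|n IH] np; first by rewrite unitr1.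
by rewrite factS natrM unitrMl ?IH ?(ltnW np) // natr_witt_unit.
Qed.

Lemma p2_neq0 : 2%:R != 0 :> F.
Proof. by apply: natr_neq0; have := prime_gt1 p_pr; case: p p_odd => [|[|[]]]. Qed.

(** The terms of index i and p - i are opposite. *)
Lemma harm_pred : harm p.-1 = 0.
Proof.
have E : harm p.-1 = - harm p.-1.
  rewrite {1}/harm (reindex_inj rev_ord_inj) /= -sumrN; apply: eq_bigr => i _.
  rewrite -invrN; congr (_^-1).
  have -> : ((p.-1 - i.+1).+1 = p - i.+1)%N by have := ltn_ord i; lia.
  rewrite natrB; last by have := ltn_ord i; lia.
  by rewrite (pcharf0 (card_finPcharP cardF p_pr)) add0r.
have : 2%:R * harm p.-1 = 0 by rewrite mulr_natl mulr2n {1}E addNr.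
by move/eqP; rewrite mulf_eq0 (negPf p2_neq0) => /eqP.
Qed.

(** (ap + b)! / (ap)!. *)
Definition rising (a b : nat) : nat := \prod_(j < b) (a * p + j.+1).

Lemma rising_witt a b : (b < p)%N ->
  (rising a b)%:R = b`!%:R * (1 + eps (a%:R * harm b)) :> W.
Proof.
elim: b => [|b IH] bp.
  by rewrite /rising /harm !big_ord0 mulr0 raddf0 addr0 mul1r.
rewrite /rising big_ord_recr /= -/(rising a b) natrM IH ?(ltnW bp) //.
have u : (b.+1%:R : W) \is a GRing.unit by apply: natr_witt_unit.
have -> : (a * p + b.+1)%:R = b.+1%:R + p%:R * a%:R :> W by rewrite natrD natrM; ring.
rewrite (addp_eps1 p_pr cardF _ u) !rmorph_nat harmS.
rewrite [a%:R * (_ + _^-1)]mulrDr -eps1M factS natrM.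
ring.
Qed.

Lemma fact_rising a b :
  ((a * p + b)`! = p ^ a * a`! * ((\prod_(i < a) rising i p.-1) * rising a b))%N.
Proof.
have step n c : ((n * p + c)`! = (n * p)`! * rising n c)%N.
  elim: c => [|c IH]; first by rewrite addn0 /rising big_ord0 muln1.
  by rewrite addnS factS IH /rising big_ord_recr /= addnS; ring.
rewrite step mulnA; congr (_ * _)%N.
elim: a => [|a IH]; first by rewrite big_ord0.
have -> : (a.+1 * p = (a * p + p.-1).+1)%N by rewrite mulSn -addnS prednK // addnC.
rewrite factS step IH big_ord_recr /= factS expnS -addnS prednK //.
have -> : (a * p + p = a.+1 * p)%N by rewrite mulSn addnC.
ring.
Qed.

(** The product of the factors of (ap + b)! that are prime to p. *)
Definition prime_part (a b : nat) : nat := ((\prod_(i < a) rising i p.-1) * rising a b)%N.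

Lemma prime_part_witt a b : (b < p)%N ->
  (prime_part a b)%:R = p.-1`!%:R ^+ a * (b`!%:R * (1 + eps (a%:R * harm b))) :> W.
Proof.
move=> bp; rewrite natrM rising_witt //; congr (_ * _).
elim: a => [|a IH]; first by rewrite big_ord0.
rewrite big_ord_recr natrM IH exprSr rising_witt ?prednK //.
by rewrite harm_pred mulr0 raddf0 addr0 mulr1.
Qed.

(** Lucas' congruence refined modulo p^2.  The powers of p and the factorials of the
    leading digits cancel in the quotient of factorials, and each remaining block
    ap + 1, ..., ap + b has product b! (1 + a p H_b). *)
Lemma binomial_witt a b c d : (c <= a)%N -> (d <= b)%N -> (b < p)%N ->
  'C(a * p + b, c * p + d)%:R =
  'C(a, c)%:R * 'C(b, d)%:R *
  (1 + eps (a%:R * harm b - c%:R * harm d - (a - c)%:R * harm (b - d))) :> W.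
Proof.
move=> ca db bp.
have dp : (d < p)%N := leq_ltn_trans db bp.
have bdp : (b - d < p)%N := leq_ltn_trans (leq_subr _ _) bp.
have nat_eq : ('C(a * p + b, c * p + d) * (prime_part c d * prime_part (a - c) (b - d)) =
    'C(a, c) * prime_part a b)%N.
  have le : (c * p + d <= a * p + b)%N by rewrite leq_add // leq_mul2r ca orbT.
  have := bin_fact le.
  have -> : (a * p + b - (c * p + d) = (a - c) * p + (b - d))%N.
    by rewrite mulnBl subnDA -addnBAC ?leq_mul2r ?ca ?orbT // addnBA.
  rewrite !fact_rising -!/(prime_part _ _) -(bin_fact ca) => E.
  have pE : (p ^ a = p ^ c * p ^ (a - c))%N by rewrite -expnD subnKC.
  rewrite {}pE in E.
  have pos : (0 < p ^ c * p ^ (a - c) * (c`! * (a - c)`!))%N.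
    by rewrite !muln_gt0 !expn_gt0 p_gt0 !fact_gt0.
  apply/eqP; rewrite -(eqn_pmul2l pos); apply/eqP.
  transitivity ('C(a * p + b, c * p + d) *
    (p ^ c * c`! * prime_part c d * (p ^ (a - c) * (a - c)`! * prime_part (a - c) (b - d))))%N.
    ring.
  rewrite E; ring.
have {nat_eq} := congr1 (GRing.natmul (1 : W)) nat_eq.
rewrite (natrM _ _ (_ * _)) (natrM _ (prime_part c d)) (natrM _ 'C(a, c)).
rewrite !prime_part_witt // -(bin_fact db) !natrM.
have -> : p.-1`!%:R ^+ a = p.-1`!%:R ^+ c * p.-1`!%:R ^+ (a - c) :> W.
  by rewrite -exprD subnKC.
set u := p.-1`!%:R ^+ c; set v := p.-1`!%:R ^+ (a - c).
set X := 'C(a * p + b, _)%:R; set x := eps (c%:R * _); set y := eps ((a - c)%:R * _).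
set z := eps (a%:R * _) => E.
have uu : u * v * (d`!%:R * (b - d)`!%:R) * ((1 + x) * (1 + y)) \is a GRing.unit.
  by rewrite !unitrM /u /v !unitrX ?fact_witt_unit ?eps1_unit ?prednK.
apply: (mulIr uu).
transitivity (X * (u * (d`!%:R * (1 + x)) * (v * ((b - d)`!%:R * (1 + y))))); first ring.
rewrite E /x /y eps1M.
transitivity ('C(a, c)%:R * 'C(b, d)%:R * (u * v * (d`!%:R * (b - d)`!%:R)) * (1 + z)).
  ring.
have -> : 1 + z = (1 + eps (a%:R * harm b - c%:R * harm d - (a - c)%:R * harm (b - d))) *
   (1 + eps (c%:R * harm d + (a - c)%:R * harm (b - d))).
  by rewrite eps1M /z; congr (1 + eps _); ring.
ring.
Qed.

(** Modulo p, C(2h, h) (-1/4)^h = C(-1/2, h) is C((p-1)/2, h); the correction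
    comes from 2h + 1 = -2 (N - h) + p in the ratio of consecutive terms. *)
Lemma central_binomial_witt N h : (h <= N)%N -> (N.*2.+1 = p)%N ->
  'C(h.*2, h)%:R = (-4%:R) ^+ h * 'C(N, h)%:R *
     (1 - eps ((harm N - harm (N - h)) / 2%:R)) :> W.
Proof.
move=> hN Np; elim: h hN => [|h IH] hN.
  by rewrite subn0 subrr mul0r raddf0 subr0 !bin0 expr0 !mulr1.
have {}IH := IH (ltnW hN).
have h1 : (0 < h.+1 < p)%N by lia.
have Nh : (0 < N - h < p)%N by lia.
apply: (mulrI (natr_witt_unit h1)).
have E1 := central_binS h; rewrite -mulnA in E1.
have E2 : (h.+1 * 'C(N, h.+1) = (N - h) * 'C(N, h))%N by rewrite mul_bin_left.
rewrite -natrM E1 !natrM IH.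
have u2 : (- (2%:R * (N - h)%:R) : W) \is a GRing.unit.
  rewrite unitrN unitrM; apply/andP; split; last exact: natr_witt_unit.
  by apply: natr_witt_unit; lia.
have -> : h.*2.+1%:R = - (2%:R * (N - h)%:R) + p%:R * 1 :> W.
  by apply/eqP; rewrite mulr1 eq_sym addrC subr_eq -natrM -natrD -Np; apply/eqP; congr _%:R; lia.
rewrite (addp_eps1 p_pr cardF _ u2).
have -> : witt2_fst 1 / witt2_fst (- (2%:R * (N - h)%:R) : W) =
    - (2%:R^-1 / (N - h)%:R) :> F.
  by rewrite rmorphN rmorphM !rmorph_nat mul1r invrN invfM.
have eN : (N - h = (N - h.+1).+1)%N by lia.
have -> : harm (N - h) = harm (N - h.+1) + (N - h)%:R^-1 by rewrite {1}eN harmS -eN.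
set n' : F := (N - h)%:R; set x := harm N; set y := harm (N - h.+1).
rewrite -!raddfN.
transitivity ((-4%:R) ^+ h.+1 * ((N - h)%:R * 'C(N, h)%:R) *
  ((1 + eps (- (2%:R^-1 / n'))) * (1 + eps (- ((x - (y + n'^-1)) / 2%:R)))) : W).
  by rewrite exprS -[4%:R]/((2 * 2)%:R) natrM; ring.
rewrite eps1M -natrM -E2 natrM.
have -> : - (2%:R^-1 / n') + - ((x - (y + n'^-1)) / 2%:R) = - ((x - y) / 2%:R) by ring.
ring.
Qed.

End BinomialsModP2.

(** * A terminating hypergeometric sum *)

Section SquareSum.

Lemma natr_bin_down n k : (k <= n.+1)%N ->
  (n%:R + 1) * 'C(n, k)%:R = (n%:R + 1 - k%:R) * 'C(n.+1, k)%:R :> rat.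
Proof. by move=> kn; rewrite natr1 -natrB // -!natrM -mul_bin_down. Qed.

Lemma natr_central_binS k :
  (k%:R + 1) * 'C(k.+1.*2, k.+1)%:R = 2 * (2 * k%:R + 1) * 'C(k.*2, k)%:R :> rat.
Proof.
have := congr1 (GRing.natmul (1 : rat)) (central_binS k).
rewrite !natrM -[k.+1%:R]natr1 => ->.
by rewrite -[k.*2.+1%:R]natr1 -[k.*2]mul2n natrM.
Qed.

Definition sq_term (n k : nat) : rat :=
  (-1) ^+ k * 'C(n, k)%:R * 'C(n + k, k)%:R * 'C(k.*2, k)%:R / 4%:R ^+ k.

(** The square of the value at 0 of the n-th Legendre polynomial, by Clausen's
    formula. *)
Definition sq_sum (n : nat) : rat := \sum_(k < n.+1) sq_term n k.

(** The rational certificate of Zeilberger's algorithm, with C(n, k) rewritten by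
    C(n+2, k) so that it needs no division by n + 1 - k or n + 2 - k. *)
Definition sq_cert (n k : nat) : rat :=
  - (2 * (2 * n%:R + 3) * k%:R ^+ 3 / ((n%:R + 1) * (n%:R + 2))) *
  ((-1) ^+ k * 'C(n.+2, k)%:R * 'C(n + k, k)%:R * 'C(k.*2, k)%:R / 4%:R ^+ k).

(** Both sides are the same rational multiple of C(n+2, k) C(n+k, k) C(2k, k) /
    4^k. *)
Lemma sq_term_wz n k : (k <= n.+2)%N ->
  (n%:R + 2) ^+ 2 * sq_term n.+2 k - (n%:R + 1) ^+ 2 * sq_term n k =
  sq_cert n k.+1 - sq_cert n k.
Proof.
move=> kn.
have n1 : n%:R + 1 != 0 :> rat by rewrite natr1 pnatr_eq0.
have n2 : n%:R + 2 != 0 :> rat by rewrite -(natrD _ n 2) pnatr_eq0 addn2.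
have k1 : k%:R + 1 != 0 :> rat by rewrite natr1 pnatr_eq0.
have kn' : (n.+2 - k)%:R = n%:R + 2 - k%:R :> rat by rewrite natrB // -addn2 natrD.
have e1 : 'C(n, k)%:R = 'C(n.+2, k)%:R * (n%:R + 2 - k%:R) * (n%:R + 1 - k%:R)
     / ((n%:R + 1) * (n%:R + 2)) :> rat.
  have [kle|kgt] := leqP k n.+1.
    apply: (mulfI (mulf_neq0 n1 n2)).
    have E1 := natr_bin_down kle; have E2 := natr_bin_down kn.
    rewrite -natr1 in E2.
    transitivity ((n%:R + 1 + 1) * ((n%:R + 1) * 'C(n, k)%:R) : rat); first ring.
    rewrite E1; transitivity ((n%:R + 1 - k%:R) * ((n%:R + 1 + 1) * 'C(n.+1, k)%:R) : rat).
      ring.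
    by rewrite E2; field; rewrite n1 n2.
  have -> : k = n.+2 by lia.
  rewrite bin_small // binn -!natr1; field.
  by rewrite n1 n2.
have e2 : 'C(n.+2 + k, k)%:R = 'C(n + k, k)%:R * (n%:R + k%:R + 1) * (n%:R + k%:R + 2)
     / ((n%:R + 1) * (n%:R + 2)) :> rat.
  have E1 := natr_bin_down (leq_trans (leq_addl n k) (leqnSn _)).
  have E2 := natr_bin_down (leq_trans (leq_addl n.+1 k) (leqnSn _)).
  rewrite addSn -natr1 natrD in E2; rewrite natrD in E1.
  apply: (mulfI (mulf_neq0 n1 n2)).
  transitivity ((n%:R + 1) * ((n%:R + k%:R + 1 + 1 - k%:R) * 'C((n + k).+2, k)%:R) : rat).
    by rewrite !addSn; ring.
  rewrite -E2.
  transitivity ((n%:R + k%:R + 1 + 1) * ((n%:R + k%:R + 1 - k%:R) * 'C((n + k).+1, k)%:R) : rat).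
    ring.
  by rewrite -E1; field; rewrite n1 n2.
have e3 : 'C(n.+2, k.+1)%:R = 'C(n.+2, k)%:R * (n%:R + 2 - k%:R) / (k%:R + 1) :> rat.
  apply: (mulfI k1); rewrite natr1 -natrM mul_bin_left natrM kn' -[k.+1%:R]natr1; field.
  exact: k1.
have e4 : 'C(n + k.+1, k.+1)%:R = 'C(n + k, k)%:R * (n%:R + k%:R + 1) / (k%:R + 1) :> rat.
  apply: (mulfI k1); rewrite natr1 -natrM addnS -mul_bin_diag natrM /= -!natr1 natrD.
  field; exact: k1.
have e5 : 'C(k.+1.*2, k.+1)%:R = 'C(k.*2, k)%:R * 2 * (2 * k%:R + 1) / (k%:R + 1) :> rat.
  apply: (mulfI k1); rewrite natr_central_binS.
  field; exact: k1.
rewrite /sq_term /sq_cert e1 e2 e3 e4 e5 !exprS -!natr1 expr0.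
have k4 : 4%:R ^+ k != 0 :> rat by rewrite expf_neq0.
field.
by rewrite n1 n2 k1 k4.
Qed.

Lemma sq_sumSS n : (n%:R + 2) ^+ 2 * sq_sum n.+2 = (n%:R + 1) ^+ 2 * sq_sum n.
Proof.
have pad : sq_sum n = \sum_(k < n.+3) sq_term n k.
  have z k : (n < k)%N -> sq_term n k = 0.
    by move=> nk; rewrite /sq_term bin_small // mulr0 !mul0r.
  by rewrite /sq_sum [RHS]big_ord_recr [X in _ = X + _]big_ord_recr /= !z ?addr0.
apply/eqP; rewrite -subr_eq0 pad !mulr_sumr -sumrB.
rewrite (eq_bigr (fun k : 'I_n.+3 => sq_cert n k.+1 - sq_cert n k)); last first.
  by move=> k _; apply: sq_term_wz; rewrite -ltnS.
rewrite -(big_mkord xpredT (fun k => sq_cert n k.+1 - sq_cert n k)).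
rewrite telescope_sumr // {1}/sq_cert bin_small // /sq_cert expr0n /=.
by rewrite !(mulr0, mul0r, oppr0, addr0).
Qed.

Lemma sq_sumE n :
  sq_sum n = if odd n then 0 else ('C(n, n./2)%:R / 2%:R ^+ n) ^+ 2.
Proof.
elim/ltn_ind: n => -[|[|n]] IH.
- by rewrite /sq_sum big_ord_recl big_ord0 /sq_term.
- by rewrite /sq_sum !big_ord_recl big_ord0 /sq_term.
have n2 : n%:R + 2 != 0 :> rat by rewrite -(natrD _ n 2) pnatr_eq0 addn2.
have n2' : (n%:R + 2) ^+ 2 != 0 :> rat by rewrite expf_neq0.
apply: (mulfI n2'); rewrite sq_sumSS IH ?leqnSn // [odd n.+2]/= negbK.
case: ifPn => [_|n_even]; first by rewrite !mulr0.
have [h nE] : exists h, n = h.*2 by exists n./2; rewrite -{1}(odd_double_half n) (negPf n_even).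
rewrite {}nE /= !doubleK; have h1 : h%:R + 1 != 0 :> rat by rewrite natr1 pnatr_eq0.
have -> : 'C(h.*2.+2, h.+1)%:R = 'C(h.*2, h)%:R * 2 * (2 * h%:R + 1) / (h%:R + 1) :> rat.
  apply: (mulfI h1); rewrite natr_central_binS.
  field; exact: h1.
rewrite !exprS -mul2n natrM; field.
by rewrite h1 expf_neq0.
Qed.

End SquareSum.

(** * Truncated hypergeometric sums modulo p^2 *)

Lemma sq_sum_int n :
  \sum_(k < n.+1) (-1) ^+ k * ('C(n, k) * 'C(n + k, k) * 'C(k.*2, k) * 4 ^ (n - k))%:Z =
  if odd n then 0 else ('C(n, n./2) ^ 2)%:Z.
Proof.
apply: (intr_inj (R := rat)).
have n4 : 4%:R ^+ n != 0 :> rat by rewrite expf_neq0.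
transitivity (4%:R ^+ n * sq_sum n).
  rewrite /sq_sum mulr_sumr rmorph_sum; apply: eq_bigr => k _ /=.
  rewrite /sq_term rmorphM rmorphXn rmorphN rmorph1 /= -pmulrn !natrM natrX.
  have kn : (k <= n)%N by rewrite -ltnS.
  have -> : 4%:R ^+ n = 4%:R ^+ (n - k) * 4%:R ^+ k :> rat by rewrite -exprD subnK.
  field.
  by rewrite expf_neq0.
rewrite sq_sumE; case: ifP => _; first by rewrite mulr0.
have four : 4%:R = 2%:R * 2%:R :> rat by rewrite -natrM.
rewrite -pmulrn natrX exprMn exprVn four exprMn; field.
by rewrite expf_neq0.
Qed.

Section TruncatedSum.
Variables (F : finFieldType) (p e : nat).
Hypotheses (p_pr : prime p) (p_odd : odd p) (e_gt0 : (0 < e)%N).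
Hypothesis cardF : #|F| = (p ^ e)%N.
Local Notation W := (witt2 F).
Local Notation eps := (@eps F).
Local Notation harm := (@harm F).
Let p_gt0 : (0 < p)%N := prime_gt0 p_pr.

(** At s = -(D-1)/D^2 the factor j(j+1) - s is (j + 1/D)(j + 1 - 1/D), and at
    s = m(m+1) it is (j - m)(j + m + 1). *)
Definition hyp_coef (s : W) (n : nat) : W :=
  \prod_(j < n) (j.*2.+1%:R * ((j * j.+1)%:R - s) / (2 * j.+1 ^ 3)%:R).

Definition trunc_sum (s : W) : W := \sum_(n < p) hyp_coef s n.

Lemma two_unit : (2%:R : W) \is a GRing.unit.
Proof. by apply: (natr_witt_unit p_pr cardF); have := prime_gt1 p_pr; case: p p_odd => [|[|[]]]. Qed.

Lemma four_unit : (4%:R : W) \is a GRing.unit.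
Proof. by rewrite -[4%N]/(2 * 2)%N natrM unitrMl ?two_unit. Qed.

Lemma den_unit j : (j.+1 < p)%N -> ((2 * j.+1 ^ 3)%:R : W) \is a GRing.unit.
Proof.
move=> jp; rewrite natrM natrX unitrMl ?two_unit // unitrX //.
exact: (natr_witt_unit p_pr cardF).
Qed.

Lemma hyp_coef_nat m n : (n < p)%N ->
  hyp_coef (m * m.+1)%:R n =
  (-1) ^+ n * ('C(m, n) * 'C(m + n, n) * 'C(n.*2, n))%:R / 4%:R ^+ n.
Proof.
elim: n => [|n IH] np; first by rewrite /hyp_coef big_ord0 !bin0 divr1 mulr1.
rewrite /hyp_coef big_ord_recr /= -/(hyp_coef _ n) IH ?(ltnW np) //.
have u1 : (n.+1%:R : W) \is a GRing.unit by apply: (natr_witt_unit p_pr cardF).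
have [nm|mn] := leqP n m; last first.
  by rewrite (bin_small mn) (bin_small (leqW mn)) !mul0n !mulr0 !mul0r.
have u3 : (n.+1%:R ^+ 3 : W) \is a GRing.unit by rewrite unitrX.
have PE : ('C(m, n.+1) * 'C(m + n.+1, n.+1) * 'C(n.+1.*2, n.+1))%:R =
    ('C(m, n) * 'C(m + n, n) * 'C(n.*2, n))%:R * (m - n)%:R * (m + n.+1)%:R *
    (2%:R * n.*2.+1%:R) / n.+1%:R ^+ 3 :> W.
  apply: (mulIr u3); rewrite divrK // -natrX -!natrM; congr _%:R.
  transitivity ((n.+1 * 'C(m, n.+1)) * (n.+1 * 'C(m + n.+1, n.+1)) *
    (n.+1 * 'C(n.+1.*2, n.+1)))%N; first by rewrite !expnS expn0; ring.
  by rewrite mul_bin_left central_binS -mul_bin_diag addnS /=; ring.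
have sE : (n * n.+1)%:R - (m * m.+1)%:R = - ((m - n)%:R * (m + n.+1)%:R) :> W.
  by rewrite natrB // natrD !natrM -!natr1; ring.
have four : 4%:R = 2%:R * 2%:R :> W by rewrite -natrM.
have i2 : 2%:R * 2%:R^-1 = 1 :> W by rewrite divrr ?two_unit.
rewrite PE sE [(2 * _)%:R]natrM natrX invrM ?two_unit // ![_ ^+ n.+1]exprS.
rewrite [(4%:R * _)^-1]invrM ?unitrX ?four_unit // [4%:R^-1](_ : _ = 2%:R^-1 * 2%:R^-1).
  set P := (_ * _)%:R; set c := (_ ^+ 3)^-1; set b := (_ ^+ n)^-1.
  transitivity (- (-1) ^+ n * P * ((m - n)%:R * (m + n.+1)%:R) * n.*2.+1%:R * c * b * 2%:R^-1
     * (2%:R * 2%:R^-1) : W); last ring.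
  rewrite i2; ring.
by rewrite four invrM ?two_unit.
Qed.

Lemma trunc_sum_nat m : (m < p)%N ->
  trunc_sum (m * m.+1)%:R = if odd m then 0 else 'C(m, m./2)%:R ^+ 2 / 4%:R ^+ m.
Proof.
move=> mp; have u4 n : (4%:R ^+ n : W) \is a GRing.unit by rewrite unitrX ?four_unit.
apply: (mulrI (u4 m)).
transitivity ((if odd m then 0 else ('C(m, m./2) ^ 2)%:Z)%:~R : W); last first.
  case: ifP => _; first by rewrite mulr0.
  by rewrite mulrC divrK // -pmulrn natrX.
rewrite -sq_sum_int rmorph_sum /= /trunc_sum mulr_sumr.
rewrite -(big_mkord xpredT (fun n => 4%:R ^+ m * hyp_coef (m * m.+1)%:R n)).
rewrite (big_cat_nat (n := m.+1)) //= [X in _ + X]big1_seq ?addr0.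
  rewrite big_mkord; apply: eq_bigr => n _.
  have nm : (n <= m)%N by rewrite -ltnS.
  rewrite hyp_coef_nat ?(leq_ltn_trans nm) // [in RHS]rmorphM rmorphXn rmorphN rmorph1 /=.
  rewrite -pmulrn [(_ * 4 ^ _)%:R]natrM natrX.
  have -> : 4%:R ^+ m = 4%:R ^+ (m - n) * 4%:R ^+ n :> W by rewrite -exprD subnK.
  set c := (_ * _ * _)%:R.
  transitivity (4%:R ^+ (m - n) * ((-1) ^+ n * c) * (4%:R ^+ n / 4%:R ^+ n) : W); first ring.
  by rewrite divrr // mulr1; ring.
move=> n; rewrite mem_index_iota => /andP[_ /andP[mn np]].
by rewrite hyp_coef_nat // bin_small // !mul0n mulr0 mul0r mulr0.
Qed.

(** Since p^2 = 0, restricting a polynomial to a line in the direction p gives an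
    affine function. *)
Lemma trunc_sum_affine (s c v : W) :
  trunc_sum (s + v * (p%:R * c)) =
  trunc_sum s + v * (trunc_sum (s + p%:R * c) - trunc_sum s).
Proof.
pose affine (f : W -> W) := exists D, forall u, f (s + u * (p%:R * c)) = f s + u * (p%:R * D).
have pp (a b : W) : p%:R * a * (p%:R * b) = 0.
  by rewrite mulrACA (witt2_pp p_pr cardF) mul0r.
have aff_coef n : affine (fun x => hyp_coef x n).
  elim: n => [|n [D DE]].
    by exists 0 => u; rewrite /hyp_coef !big_ord0 !mulr0 addr0.
  set q := n.*2.+1%:R : W; set d := (2 * n.+1 ^ 3)%:R^-1 : W.
  exists (D * (q * ((n * n.+1)%:R - s) * d) - hyp_coef s n * (q * c * d)) => u.
  rewrite /hyp_coef !big_ord_recr /= -/(hyp_coef _ n) DE -/q -/d -/(hyp_coef s n).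
  transitivity (hyp_coef s n * (q * ((n * n.+1)%:R - s) * d) +
    u * (p%:R * (D * (q * ((n * n.+1)%:R - s) * d) - hyp_coef s n * (q * c * d))) -
    u * u * q * d * (p%:R * D * (p%:R * c))); first ring.
  by rewrite pp mulr0 subr0.
have aff_sum m : affine (fun x => \sum_(n < m) hyp_coef x n).
  elim: m => [|m [D DE]]; first by exists 0 => u; rewrite !big_ord0 !mulr0 addr0.
  have [D' DE'] := aff_coef m.
  by exists (D + D') => u; rewrite !big_ord_recr /= DE DE'; ring.
have [D DE] := aff_sum p.
rewrite /trunc_sum DE; have := DE 1; rewrite mul1r => ->; ring.
Qed.

Section Evaluation.
Variables (D k : nat).
Hypotheses (D_gt1 : (1 < D)%N) (D_co : coprime D p).
Hypothesis pD : (D * k + 1 = p \/ D * k + (D - 1) = p)%N.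

Let delta : W := D%:R^-1.
Let Du : (D%:R : W) \is a GRing.unit. Proof. exact: (witt2_natr_unit p_pr cardF). Qed.
Let dD : D%:R * delta = 1. Proof. exact: divrr. Qed.

Lemma k_lt : (k < p)%N.
Proof. by case: pD => E; nia. Qed.

(** The parameter s lies on the segment joining m(m+1) for m = k and m = p-1-k,
    two points congruent modulo p. *)
Lemma trunc_sum_interp :
  trunc_sum (- (D%:R - 1) * delta ^+ 2) =
  (1 - delta) * trunc_sum (k * k.+1)%:R +
  delta * trunc_sum ((p.-1 - k) * (p.-1 - k).+1)%:R.
Proof.
have kp := k_lt; have pp := witt2_pp p_pr cardF.
pose c : W := - (2%:R * k%:R + 1).
have E1 : ((p.-1 - k) * (p.-1 - k).+1)%:R = (k * k.+1)%:R + p%:R * c :> W.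
  have -> : (p.-1 - k).+1 = (p - k)%N by lia.
  have -> : (p.-1 - k = p - k.+1)%N by lia.
  rewrite !natrM !natrB ?(ltnW kp) // -natr1 /c.
  transitivity (p%:R * p%:R + ((k%:R + 1) * k%:R + p%:R * - (2 * k%:R + 1)) : W); first ring.
  by rewrite pp add0r; ring.
have E2 : - (D%:R - 1) * delta ^+ 2 = (k * k.+1)%:R + delta * (p%:R * c).
  have sE : - (D%:R - 1) * delta ^+ 2 = delta ^+ 2 - delta.
    by transitivity (delta ^+ 2 - D%:R * delta * delta); [ring | rewrite dD mul1r].
  rewrite sE natrM -natr1 /c; case: pD => pE.
    have kE : k%:R = (p%:R - 1) * delta :> W.
      by rewrite -pE natrD addrK natrM mulrC mulrA [delta * _]mulrC dD mul1r.
    rewrite kE; apply/eqP; rewrite eq_sym -subr_eq0; apply/eqP.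
    transitivity (p%:R * p%:R * (delta ^+ 2 - 2 * delta ^+ 2)); first ring.
    by rewrite pp mul0r.
  have kE : k%:R = p%:R * delta - 1 + delta :> W.
    have D1 : (0 < D)%N by apply: ltnW.
    have : D%:R * k%:R = p%:R - D%:R + 1 :> W by rewrite -pE natrD natrM natrB //; ring.
    move/(congr1 (fun x => delta * x)); rewrite mulrA [delta * D%:R]mulrC dD mul1r => ->.
    by rewrite mulrDr mulrBr [delta * D%:R]mulrC dD; ring.
  rewrite kE; apply/eqP; rewrite eq_sym -subr_eq0; apply/eqP.
  transitivity (p%:R * p%:R * (delta ^+ 2 - 2 * delta ^+ 2)); first ring.
  by rewrite pp mul0r.
rewrite E2 trunc_sum_affine E1; ring.
Qed.

Lemma trunc_sum_odd : odd k -> trunc_sum (- (D%:R - 1) * delta ^+ 2) = 0.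
Proof.
move=> k_odd; have kp := k_lt.
rewrite trunc_sum_interp !trunc_sum_nat // ?k_odd; last lia.
have -> : odd (p.-1 - k) by rewrite oddB ?k_odd -?subn1 ?oddB // ?p_odd //; lia.
by rewrite !mulr0 addr0.
Qed.

(** The weights 1 - 1/D and 1/D of the interpolation become the weights of the two
    harmonic numbers, because both end points have the same value modulo p:
    k/2 and (p-1-k)/2 are complementary in (p-1)/2. *)
Lemma trunc_sum_even N h h' : (N.*2.+1 = p)%N -> (h + h' = N)%N -> k = h.*2 ->
  trunc_sum (- (D%:R - 1) * delta ^+ 2) =
  'C(N, h)%:R ^+ 2 *
    (1 - eps (harm N - (1 - D%:R^-1) * harm h' - D%:R^-1 * harm h)).
Proof.
move=> Np hN kE; have kp := k_lt.
have u4 n : (4%:R ^+ n : W) \is a GRing.unit by rewrite unitrX ?four_unit.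
have val i j : (i + j = N)%N -> trunc_sum (i.*2 * i.*2.+1)%:R =
    'C(N, i)%:R ^+ 2 * (1 - eps (harm N - harm j)).
  move=> ij; rewrite trunc_sum_nat ?odd_double ?doubleK; last lia.
  apply: (mulIr (u4 i.*2)); rewrite divrK //.
  have iN : (i <= N)%N by lia.
  rewrite (central_binomial_witt p_pr p_odd e_gt0 cardF iN Np).
  have -> : (N - i = j)%N by lia.
  have e2 : (1 - eps ((harm N - harm j) / 2%:R)) ^+ 2 = 1 - eps (harm N - harm j).
    rewrite -!raddfN eps1X; congr (1 + eps _); field.
    exact: (p2_neq0 p_pr p_odd cardF).
  rewrite 2!exprMn e2 -exprM muln2 -mul2n exprM sqrrN -exprM mul2n; ring.
rewrite trunc_sum_interp kE (val h h') //.
have -> : (p.-1 - h.*2 = h'.*2)%N by lia.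
rewrite (val h' h); last by rewrite addnC.
have -> : 'C(N, h') = 'C(N, h).
  by rewrite -bin_sub; [congr 'C(_, _); lia | lia].
have fd : witt2_fst delta = D%:R^-1 by rewrite rmorphV // rmorph_nat.
set x := harm N; set y := harm h'; set z := harm h; set b := 'C(N, h)%:R ^+ 2.
transitivity (b * (1 - ((1 - delta) * eps (x - y) + delta * eps (x - z)))); first ring.
have f1d : witt2_fst (1 - delta) = 1 - D%:R^-1 by rewrite -fd.
by rewrite !mul_eps f1d fd -raddfD; congr (b * (1 - eps _)); ring.
Qed.

End Evaluation.
End TruncatedSum.

(** * Reduction of p-integral rationals *)

Lemma coprime_denq (p n : nat) (m : int) (x : rat) :
  coprime n p -> x * n%:R = m%:~R -> coprime p `|denq x|%N.
Proof.
move=> np xn; have dvd : (denq x %| n%:Z)%Z.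
  have E : numq x * n%:Z = m * denq x.
    apply: (intr_inj (R := rat)); rewrite !rmorphM /= numqE -xn -pmulrn; ring.
  have : (denq x %| numq x * n%:Z)%Z by rewrite E dvdz_mull.
  by rewrite Gauss_dvdzr // /coprimez gcdzC /gcdz; have /eqP := coprime_num_den x; rewrite gcdnC => ->.
rewrite coprime_sym; apply: coprime_dvdl np.
by move: dvd; rewrite dvdzE.
Qed.

Section Reduction.
Variables (F : finFieldType) (p e : nat).
Hypotheses (p_pr : prime p) (e_gt0 : (0 < e)%N) (cardF : #|F| = (p ^ e)%N).
Local Notation W := (witt2 F).

(** w is the image of the p-integral rational x in W, with a common fraction m/n as
    witness. *)
Definition reduces (x : rat) (w : W) : Prop := exists m : int, exists n : nat,
  [/\ coprime n p, x * n%:R = m%:~R & n%:R * w = m%:~R].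

Lemma reduces_add x y w v : reduces x w -> reduces y v -> reduces (x + y) (w + v).
Proof.
case=> m [n [np xn wn]] [m' [n' [np' xn' wn']]].
exists (m * n'%:Z + m' * n%:Z), (n * n')%N; split; first by rewrite coprimeMl np.
  rewrite natrM !rmorphD !rmorphM /= -xn -xn' -!pmulrn; ring.
rewrite natrM !rmorphD !rmorphM /= -wn -wn' -!pmulrn; ring.
Qed.

Lemma reduces_mul x y w v : reduces x w -> reduces y v -> reduces (x * y) (w * v).
Proof.
case=> m [n [np xn wn]] [m' [n' [np' xn' wn']]].
exists (m * m'), (n * n')%N; split; first by rewrite coprimeMl np.
  rewrite natrM !rmorphM /= -xn -xn'; ring.
rewrite natrM !rmorphM /= -wn -wn'; ring.
Qed.

Lemma reduces_int (m : int) : reduces m%:~R m%:~R.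
Proof. by exists m, 1%N; rewrite coprime1n mulr1 mul1r. Qed.

Lemma reduces_sum n (f : nat -> rat) (h : nat -> W) :
  (forall i, (i < n)%N -> reduces (f i) (h i)) ->
  reduces (\sum_(0 <= i < n) f i) (\sum_(i < n) h i).
Proof.
elim: n => [|n IH] H; first by rewrite big_geq // big_ord0; exact: (reduces_int 0).
rewrite big_nat_recr // big_ord_recr /=; apply: reduces_add; last exact: H.
by apply: IH => i ?; apply: H; exact: leqW.
Qed.

Lemma reduces_prod n (f : 'I_n -> rat) (h : 'I_n -> W) :
  (forall i, reduces (f i) (h i)) -> reduces (\prod_(i < n) f i) (\prod_(i < n) h i).
Proof.
move=> H; elim/big_rec2: _ => [|i x y _ IH]; first exact: (reduces_int 1).
exact: reduces_mul (H i) IH.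
Qed.

Lemma reduces_congr (x : rat) (y : int) : reduces x y%:~R ->
  [&& coprime p `|denq x|%N, coprime p `|denq (y%:~R : rat)|%N &
      coprime p `|denq ((x - y%:~R) / p%:R ^+ 2)|%N].
Proof.
case=> m [n [np xn wn]]; apply/and3P; split; first exact: coprime_denq np xn.
  by rewrite denq_int coprimen1.
have /dvdzP[z zE] : ((p ^ 2)%:Z %| m - n%:Z * y)%Z.
  apply: (@witt2_intr_eq0 F p e) => //.
  by rewrite rmorphB rmorphM /= -wn -pmulrn subrr.
apply: (coprime_denq (m := z) np).
have p2 : p%:R ^+ 2 != 0 :> rat by rewrite expf_neq0 // pnatr_eq0 -lt0n prime_gt0.
have -> : (x - y%:~R) / p%:R ^+ 2 * n%:R = (x * n%:R - n%:R * y%:~R) / p%:R ^+ 2 by ring.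
apply: (mulIf p2); rewrite divfK // xn.
by rewrite -natrX (pmulrn _ (p ^ 2)%N) (pmulrn _ n) -!rmorphM -rmorphB zE.
Qed.

(** (1/2)_n (1/D)_n (1 - 1/D)_n / n!^3. *)
Definition hyp_rat (D n : nat) : rat :=
  \prod_(j < n) (((2 * j + 1) * (D * j + 1) * (D * j + (D - 1)))%N%:R /
                 (2 * D ^ 2 * j.+1 ^ 3)%N%:R).

Lemma hyp_rat_reduces D n : odd p -> (0 < D)%N -> coprime D p -> (n < p)%N ->
  reduces (hyp_rat D n) (hyp_coef (- (D%:R - 1) * D%:R^-1 ^+ 2) n).
Proof.
move=> p_odd D0 Dp np; apply: reduces_prod => -[j jn] /=.
have jp : (j.+1 < p)%N by lia.
have cop2 : coprime 2 p by rewrite coprime2n.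
have copj : coprime j.+1 p.
  by rewrite coprime_sym prime_coprime //; apply/negP => /(dvdn_leq (ltn0Sn _)); lia.
have Du : (D%:R : W) \is a GRing.unit := witt2_natr_unit p_pr cardF Dp.
have ud := den_unit p_pr p_odd cardF jp.
exists ((2 * j + 1) * (D * j + 1) * (D * j + (D - 1)))%N%:Z, (2 * D ^ 2 * j.+1 ^ 3)%N; split.
- by rewrite !coprimeMl cop2 Dp copj.
- by rewrite -pmulrn divfK // pnatr_eq0 -lt0n !muln_gt0 D0.
rewrite -pmulrn.
have -> : (2 * D ^ 2 * j.+1 ^ 3)%:R = (2 * j.+1 ^ 3)%:R * D%:R ^+ 2 :> W.
  by rewrite -natrX -natrM; congr _%:R; ring.
have dD : D%:R * D%:R^-1 = 1 :> W by rewrite divrr.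
set d := (2 * j.+1 ^ 3)%:R; set i := D%:R^-1.
transitivity ((d / d) * (j.*2.+1%:R * (D%:R ^+ 2 * (j * j.+1)%:R +
   (D%:R - 1) * (D%:R * i) ^+ 2)) : W); first ring.
rewrite divrr // dD !natrM !natrD -mul2n -natr1 !natrM natrB // -natr1; ring.
Qed.

End Reduction.

Lemma hyp_ratS D n : (0 < D)%N -> hyp_rat D n.+1 =
  hyp_rat D n * ((2%:R * n%:R + 1) * (D%:R * n%:R + 1) * (D%:R * n%:R + (D%:R - 1)) /
                 (2%:R * D%:R ^+ 2 * (n%:R + 1) ^+ 3)).
Proof.
move=> D0; rewrite /hyp_rat big_ord_recr /=; congr (_ * (_ / _)).
  rewrite natrM (natrM _ (2 * n + 1)%N) (natrD _ (2 * n)%N) (natrD _ (D * n)%N 1).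
  by rewrite (natrD _ (D * n)%N (D - 1)) (natrM _ 2 n) (natrM _ D n) natrB.
by rewrite -!natrX !natr1 -!natrX -!natrM.
Qed.

Lemma factSn (R : pzSemiRingType) n : n.+1`!%:R = (n%:R + 1) * n`!%:R :> R.
Proof. by rewrite factS natrM natr1. Qed.

(** Writes the factors of (a b + i)! / (a b)! as polynomials in a and b, to be
    simplified as rational functions. *)
Lemma natr_muln_succ (R : pzSemiRingType) a b :
  ((a * b).+1%:R = a%:R * b%:R + 1 :> R) *
  ((a * b).+2%:R = a%:R * b%:R + 1 + 1 :> R) *
  ((a * b).+3%:R = a%:R * b%:R + 1 + 1 + 1 :> R) *
  ((a * b).+4%:R = a%:R * b%:R + 1 + 1 + 1 + 1 :> R) *
  ((a * b).+4.+1%:R = a%:R * b%:R + 1 + 1 + 1 + 1 + 1 :> R).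
Proof. by rewrite -natrM !natr1. Qed.

Lemma fact_neq0 n : n`!%:R != 0 :> rat.
Proof. by rewrite pnatr_eq0 -lt0n fact_gt0. Qed.

Lemma hyp_rat3 n :
  ((3 * n)`! * (2 * n)`!)%:R / n`!%:R ^+ 5 * 108 ^- n = hyp_rat 3 n.
Proof.
elim: n => [|n IH]; first by rewrite /hyp_rat big_ord0.
rewrite hyp_ratS // -IH.
have -> : (3 * n.+1 = (3 * n).+3)%N by lia.
have -> : (2 * n.+1 = (2 * n).+2)%N by lia.
rewrite (natrM _ (3 * n).+3`!) (natrM _ (3 * n)`!) !factSn [_ ^+ n.+1]exprS !natr_muln_succ.
rewrite (natrM _ 3 n) (natrM _ 2 n).
have n0 : n%:R + 1 != 0 :> rat by rewrite natr1 pnatr_eq0.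
have c0 : 108 ^+ n != 0 :> rat by apply: expf_neq0; rewrite pnatr_eq0.
by field; rewrite n0 c0 fact_neq0.
Qed.

Lemma hyp_rat4 n : (4 * n)`!%:R / n`!%:R ^+ 4 * 256 ^- n = hyp_rat 4 n.
Proof.
elim: n => [|n IH]; first by rewrite /hyp_rat big_ord0.
rewrite hyp_ratS // -IH.
have -> : (4 * n.+1 = (4 * n).+4)%N by lia.
rewrite !factSn [_ ^+ n.+1]exprS !natr_muln_succ (natrM _ 4 n).
have n0 : n%:R + 1 != 0 :> rat by rewrite natr1 pnatr_eq0.
have c0 : 256 ^+ n != 0 :> rat by apply: expf_neq0; rewrite pnatr_eq0.
by field; rewrite n0 c0 fact_neq0.
Qed.

Lemma hyp_rat6 n :
  (6 * n)`!%:R / ((3 * n)`!%:R * n`!%:R ^+ 3) * 1728 ^- n = hyp_rat 6 n.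
Proof.
elim: n => [|n IH]; first by rewrite /hyp_rat big_ord0.
rewrite hyp_ratS // -IH.
have -> : (3 * n.+1 = (3 * n).+3)%N by lia.
have -> : (6 * n.+1 = (6 * n).+4.+2)%N by lia.
rewrite !factSn [_ ^+ n.+1]exprS !natr_muln_succ (natrM _ 3 n) (natrM _ 6 n).
have n1 : 3%:R * n%:R + 1 != 0 :> rat by rewrite -natrM natr1 pnatr_eq0.
have n2 : 3%:R * n%:R + 1 + 1 != 0 :> rat by rewrite -natrM !natr1 pnatr_eq0.
have n3 : 3%:R * n%:R + 1 + 1 + 1 != 0 :> rat by rewrite -natrM !natr1 pnatr_eq0.
have n0 : n%:R + 1 != 0 :> rat by rewrite natr1 pnatr_eq0.
have c0 : 1728 ^+ n != 0 :> rat by apply: expf_neq0; rewrite pnatr_eq0.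
by field; rewrite n0 c0 !fact_neq0 n1 n2 n3.
Qed.

(** * Comparison with a Jacobi sum over the prime field *)

Section SplitCase.
Variables (F : finFieldType) (g : F) (p : nat).
Local Notation q1 := (#|F|.-1).
Hypotheses (g_prim : q1.-primitive_root g) (p_pr : prime p) (p_odd : odd p).
Hypothesis cardF : #|F| = (p ^ 1)%N.
Local Notation W := (witt2 F).
Local Notation eps := (@eps F).
Local Notation harm := (@harm F).

(** In [jac_teich] with q = p, the exponents B + q - 1 = N + p - 1 are one less than
    numbers covered by [binomial_witt]; multiplying by N makes up for that.  The
    terms divisible by p then combine to the stated harmonic numbers. *)
Lemma jac_split N h h' : (N.*2.+1 = p)%N -> (h + h' = N)%N ->
  jac g (teich g ^+ (q1 - h)) =
  - (-1) ^+ h * 'C(N, h)%:R *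
  (1 + eps (N%:R * harm N - h'%:R * harm h' - h%:R * harm h)) :> W.
Proof.
move=> Np hN; have p_gt0 := prime_gt0 p_pr.
have q1E : q1 = N.*2 by rewrite cardF expn1 -Np.
have BE : q1./2 = N by rewrite q1E doubleK.
have hN' : (h <= N)%N by rewrite -hN leq_addr.
rewrite (jac_teich g_prim p_pr p_odd (isT : (0 < 1)%N) cardF) BE //.
have -> : (N - h = h')%N by lia.
have bE : (N + q1 = (N + p).-1)%N by rewrite q1E; lia.
rewrite bE.
pose C : W := 'C(N, h)%:R.
have CE' : 'C(N, h') = 'C(N, h) by rewrite (_ : h' = N - h)%N ?bin_sub //; lia.
have Np' : (N < p)%N by lia.
have big i j : (i + j = N)%N -> 'C(N + p, i)%:R = 'C(N, i)%:R * (1 + eps (harm N - harm j)) :> W.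
  move=> ij; have := @binomial_witt F p 1 p_pr p_odd isT cardF 1 N 0 i isT _ Np'.
  rewrite -ij leq_addr => /(_ isT); rewrite mul1n mul0n add0n addnC bin0 mul1r => ->.
  by rewrite addKn !mul1r mul0r subr0.
have lower i j : (i + j = N)%N ->
    N%:R * 'C((N + p).-1, i)%:R = j%:R * 'C(N + p, i)%:R +
      eps (witt2_fst ('C(N, i)%:R : W) * (1 - j%:R / N%:R)) :> W.
  move=> ij; have := congr1 (GRing.natmul (1 : W)) (mul_bin_down (N + p) i).
  have -> : (N + p - i = j + p)%N by lia.
  rewrite !natrM !natrD; set C1 := 'C(_.-1, _)%:R; set C2 := 'C(N + p, _)%:R => E.
  have {}E : N%:R * C1 = j%:R * C2 + (p%:R * C2 - p%:R * C1).
    apply: (addIr (p%:R * C1)); transitivity ((N%:R + p%:R) * C1); first ring.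
    by rewrite E; ring.
  have N0 : N%:R != 0 :> F by apply: (natr_neq0 p_pr cardF); have := prime_gt1 p_pr; lia.
  have f2 : witt2_fst C2 = witt2_fst ('C(N, i)%:R : W).
    by rewrite /C2 (big i j ij) -[LHS]/(_ * (1 + witt2_fst (eps _))) fst_eps addr0 mulr1.
  have f1 : witt2_fst C1 = witt2_fst C2 * (j%:R / N%:R).
    apply: (mulfI N0); have := congr1 (@witt2_fst F) E; rewrite !(eps_fst p_pr cardF) -raddfB.
    rewrite -[LHS]/(witt2_fst N%:R * witt2_fst C1) rmorph_nat => ->.
    rewrite -[LHS]/(witt2_fst j%:R * witt2_fst C2 + witt2_fst (eps _)) fst_eps addr0.
    by rewrite rmorph_nat; field.
  rewrite E !(eps_fst p_pr cardF) -raddfB f1 -f2; congr (_ + eps _); ring.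
have N0 : N%:R != 0 :> F by apply: (natr_neq0 p_pr cardF); have := prime_gt1 p_pr; lia.
have hNW : N%:R = h%:R + h'%:R :> W by rewrite -hN natrD.
have hNF : N%:R = h%:R + h'%:R :> F by rewrite -hN natrD.
have q1W : q1%:R = eps 1 - 1 :> W.
  have := eps_fst p_pr cardF 1; rewrite mulr1 => E.
  apply: (addIr 1); rewrite subrK natr1 -[RHS]/(eps (witt2_fst (1 : W))) -E.
  by congr _%:R; rewrite q1E -Np.
have lo1 := lower h h' hN; have lo2 := lower h' h (etrans (addnC _ _) hN).
rewrite (big h h' hN) in lo1; rewrite (big h' h (etrans (addnC _ _) hN)) CE' in lo2.
rewrite -/C in lo1 lo2 *.
set x := harm N; set y := harm h; set z := harm h'; rewrite -/x -/y -/z in lo1 lo2.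
have eC (a : F) : eps (witt2_fst C * a) = C * eps a by rewrite mul_eps.
rewrite !eC in lo1 lo2.
transitivity (q1%:R * (-1) ^+ h * ((1 - N%:R) * C +
  (N%:R * 'C((N + p).-1, h)%:R + N%:R * 'C((N + p).-1, h')%:R)) : W); first ring.
rewrite lo1 lo2.
transitivity ((eps 1 - 1) * (-1) ^+ h * C * (1 - N%:R + h%:R + h'%:R +
   (h'%:R * eps (x - z) + h%:R * eps (x - y) +
    (eps (1 - h'%:R / N%:R) + eps (1 - h%:R / N%:R)))) : W).
  by rewrite q1W; ring.
rewrite !mul_eps !rmorph_nat -!raddfD /=.
have -> : 1 - N%:R + h%:R + h'%:R = 1 :> W by rewrite hNW; ring.
set X := (X in _ * (1 + eps X) = _); have -> : eps 1 - 1 = - (1 + eps (-1)) :> W.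
  by rewrite raddfN opprD opprK addrC.
transitivity (- (-1) ^+ h * C * ((1 + eps (-1)) * (1 + eps X)) : W); first ring.
rewrite eps1M; congr (_ * (1 + eps _)).
rewrite /X; rewrite hNF in N0 *; field; exact: N0.
Qed.

Section Value.
Variables (D N h h' : nat).
Hypotheses (D_gt1 : (1 < D)%N) (D_co : coprime D p).
Hypotheses (Np : (N.*2.+1 = p)%N) (hN : (h + h' = N)%N) (pD : (D * h.*2 + 1 = p)%N).

(** Modulo p, N = -1/2 and h = -1/(2D), so that the coefficients of p in
    [trunc_sum_even] and in the square of [jac_split] agree. *)
Lemma trunc_sum_split :
  trunc_sum p (- (D%:R - 1) * D%:R^-1 ^+ 2) = jac g (teich g ^+ (q1 - h)) ^+ 2 :> W.
Proof.
rewrite (trunc_sum_even p_pr p_odd (isT : (0 < 1)%N) cardF D_gt1 D_co (or_introl pD) Np hN erefl).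
rewrite (jac_split Np hN) exprMn exprMn sqrrN -exprM mulnC exprM sqrrN !expr1n mul1r.
rewrite eps1X -raddfN; congr (_ * (1 + eps _)).
have D0 : D%:R != 0 :> F.
  by rewrite (pchar_natr_eq0 p_pr cardF) -prime_coprime // coprime_sym.
have n2 : 2%:R != 0 :> F := p2_neq0 p_pr p_odd cardF.
have p0 : p%:R = 0 :> F := pcharf0 (card_finPcharP cardF p_pr).
have NE : N%:R = - 2%:R^-1 :> F.
  apply: (mulfI n2); rewrite mulrN divff // -natrM; apply/eqP; rewrite -addr_eq0 natr1.
  by rewrite mul2n Np p0.
have hE : h%:R = - 2%:R^-1 / D%:R :> F.
  apply: (mulfI n2); apply: (mulfI D0); rewrite -!natrM mul2n.
  transitivity (-1 : F); last by field; rewrite n2 D0.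
  by apply/eqP; rewrite -addr_eq0 natr1 -addn1 pD p0.
have h'E : h'%:R = - 2%:R^-1 + 2%:R^-1 / D%:R :> F.
  by apply: (addrI h%:R); rewrite -natrD hN NE hE; ring.
rewrite NE hE h'E; field; rewrite n2 D0 //.
Qed.

Lemma jac_split_unit : jac g (teich g ^+ (q1 - h)) \is a @GRing.unit W.
Proof.
rewrite (jac_split Np hN) unitrMl ?eps1_unit // unitrMl ?unitrN ?unitrX ?unitrN1 //.
have hN' : (h <= N)%N by rewrite -hN leq_addr.
have := fact_witt_unit p_pr cardF (_ : (N < p)%N); rewrite -(bin_fact hN') natrM.
by rewrite unitrM => /(_ _)/andP[|//]; lia.
Qed.

End Value.
End SplitCase.

(** * Comparison with a Jacobi sum over the quadratic extension *)

Section InertCase.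
Variables (F : finFieldType) (g : F) (p : nat).
Local Notation q1 := (#|F|.-1).
Hypotheses (g_prim : q1.-primitive_root g) (p_pr : prime p) (p_odd : odd p).
Hypothesis cardF : #|F| = (p ^ 2)%N.
Local Notation W := (witt2 F).
Local Notation eps := (@eps F).
Local Notation harm := (@harm F).
Variables (D N h h' : nat).
Hypotheses (D_gt1 : (1 < D)%N) (D_co : coprime D p).
Hypotheses (Np : (N.*2.+1 = p)%N) (hN : (h + h' = N)%N).
Hypothesis pD : (D * h.*2 + (D - 1) = p)%N.
Let n := (h * p + h')%N.

Lemma inert_order : q1 = (2 * D * n)%N /\ q1./2 = (N * p + N)%N.
Proof.
have pE : p = (2 * h + 2 * h' + 1)%N by rewrite -Np -hN; lia.
have E : q1 = (2 * (N * p + N))%N.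
  by rewrite cardF expnS expn1 -Np -!mul2n; nia.
split; last by rewrite E mul2n doubleK.
rewrite E /n -mulnA; congr (2 * _)%N.
have p1 : (p + 1 = D * (2 * h + 1))%N by move: pD; rewrite -mul2n; nia.
have L : (2 * (N * p + N) + (p + 1) = p * (p + 1))%N.
  by rewrite -{3}Np -mul2n; ring.
have R : (2 * (D * (h * p + h')) + D * (2 * h + 1) = p * (D * (2 * h + 1)))%N.
  transitivity (D * (2 * h * p + (2 * h + 2 * h' + 1)))%N; first ring.
  by rewrite -pE; ring.
move: L R; rewrite -p1; lia.
Qed.

(** With q = p^2 the exponent n has base-p digits h and h', so the leading
    factors given by [binomial_witt] are all C(N, h) C(N, h') = C(N, h)^2. *)
Lemma jac_inert :
  jac g (teich g ^+ (q1 - n)) =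
  - (-1) ^+ N * 'C(N, h)%:R ^+ 2 *
  (1 + eps (2 * (N%:R * harm N - h%:R * harm h' - h'%:R * harm h))) :> W.
Proof.
have p_gt0 := prime_gt0 p_pr; have p2 : (0 < 2)%N by [].
have [qE BE] := inert_order.
have Np' : (N < p)%N by rewrite -Np; lia.
have hN' : (h <= N)%N by rewrite -hN leq_addr.
have nB : (n <= N * p + N)%N.
  by rewrite /n leq_add // ?leq_mul2r ?hN' ?orbT // -hN leq_addl.
rewrite (jac_teich g_prim p_pr p_odd p2 cardF) BE //.
have -> : (N * p + N - n = h' * p + h)%N by rewrite /n -hN mulnDl; lia.
have q1_gt0 : (0 < q1)%N := prim_order_gt0 g_prim.
have bE : (N * p + N + q1 = (N * p + N + p ^ 2).-1)%N.
  by rewrite -cardF; have := finNzRing_gt1 F; case: #|F| => //= m _; rewrite addnS.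
rewrite bE; set B := (N * p + N)%N.
have pp0 : (p ^ 2)%:R = 0 :> W by rewrite natrX expr2 (witt2_pp p_pr cardF).
have lower i j : (i + j = B)%N ->
    B%:R * 'C((B + p ^ 2).-1, i)%:R = j%:R * 'C(B + p ^ 2, i)%:R :> W.
  move=> ij; have := congr1 (GRing.natmul (1 : W)) (mul_bin_down (B + p ^ 2) i).
  have -> : (B + p ^ 2 - i = j + p ^ 2)%N by rewrite -ij; lia.
  by rewrite !natrM !(natrD _ _ (p ^ 2)) pp0 !addr0.
have C' : 'C(N, h') = 'C(N, h) by rewrite (_ : h' = N - h)%N ?bin_sub //; lia.
have pF0 : p%:R = 0 :> F := pcharf0 (card_finPcharP cardF p_pr).
have small i j : (i + j = N)%N ->
    'C(N + p, i)%:R = 'C(N, i)%:R * (1 + eps (harm N - harm j)) :> W.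
  move=> ij; have := @binomial_witt F p 2 p_pr p_odd p2 cardF 1 N 0 i isT _ Np'.
  rewrite -ij leq_addr => /(_ isT); rewrite mul1n mul0n add0n addnC bin0 mul1r => ->.
  by rewrite addKn !mul1r mul0r subr0.
have BpE : (B + p ^ 2 = (N + p) * p + N)%N by rewrite /B expnS expn1; ring.
pose C : W := 'C(N, h)%:R.
have big i j : (i + j = N)%N -> 'C(N, i) = 'C(N, h) -> 'C(N, j) = 'C(N, h) ->
    'C(B + p ^ 2, i * p + j)%:R = C ^+ 2 *
      (1 + eps (harm N - harm j + (N%:R * harm N - i%:R * harm j - j%:R * harm i))) :> W.
  move=> ij Ci Cj.
  have iNp : (i <= N + p)%N by lia.
  have jN : (j <= N)%N by lia.
  rewrite BpE (binomial_witt p_pr p_odd p2 cardF iNp jN Np').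
  rewrite (small i j ij) Ci Cj -/C.
  have -> : (N - j = i)%N by lia.
  have -> : (N + p - i)%:R = j%:R :> F.
    by rewrite (_ : N + p - i = j + p)%N ?natrD ?pF0 ?addr0 //; lia.
  rewrite natrD pF0 addr0 -[in RHS]eps1M; ring.
have base : 'C(B, n)%:R = C ^+ 2 *
      (1 + eps (N%:R * harm N - h%:R * harm h' - h'%:R * harm h)) :> W.
  rewrite /B /n (binomial_witt p_pr p_odd p2 cardF) //; last by rewrite -hN leq_addl.
  rewrite C' -/C.
  have -> : (N - h' = h)%N by lia.
  have -> : (N - h = h')%N by lia.
  by rewrite expr2.
have lo1 : B%:R * 'C((B + p ^ 2).-1, n)%:R = _ :> W :=
  lower n (h' * p + h)%N (_ : n + (h' * p + h) = B)%N.
have lo2 : B%:R * 'C((B + p ^ 2).-1, h' * p + h)%:R = _ :> W :=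
  lower (h' * p + h)%N n (_ : h' * p + h + n = B)%N.
rewrite /n (big h h' hN erefl C') in lo1.
rewrite (big h' h (etrans (addnC _ _) hN) C' erefl) in lo2.
set x := harm N; set y := harm h; set z := harm h'; rewrite -/x -/y -/z in lo1 lo2 base *.
have q1W : q1%:R = -1 :> W.
  apply: (addIr 1); rewrite addNr natr1 -[RHS]pp0 -cardF; congr _%:R.
  exact: prednK (ltnW (finNzRing_gt1 F)).
have sgn : (-1) ^+ n = (-1) ^+ N :> W.
  by rewrite -signr_odd -[RHS]signr_odd /n -hN !oddD oddM p_odd andbT.
rewrite q1W sgn.
transitivity (- (-1) ^+ N * ((1 - B%:R) * 'C(B, n)%:R +
  (B%:R * 'C((B + p ^ 2).-1, n)%:R + B%:R * 'C((B + p ^ 2).-1, h' * p + h)%:R)) : W).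
  ring.
rewrite lo1; last by rewrite /n /B -hN; ring.
rewrite lo2; last by rewrite /n /B -hN; ring.
rewrite base; set b := N%:R * x - h%:R * z - h'%:R * y.
have -> : N%:R * x - h'%:R * y - h%:R * z = b by rewrite /b; ring.
have Bs : B%:R = (h' * p + h)%:R + n%:R :> W by rewrite -natrD; congr _%:R; rewrite /n /B -hN; ring.
have eb c : 1 + eps (c + b) = (1 + eps c) * (1 + eps b) by rewrite eps1M.
rewrite !eb Bs.
set u := (h' * p + h)%:R; set v := n%:R.
transitivity (- (-1) ^+ N * C ^+ 2 * (1 + eps b) *
  (1 + (u * eps (x - z) + v * eps (x - y))) : W); first ring.
rewrite !mul_eps !rmorph_nat /n !natrD !natrM pF0 !mulr0 !add0r -raddfD -/C /=.
rewrite -mulrA eps1M; congr (_ * (1 + eps _)).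
have hNF : N%:R = h%:R + h'%:R :> F by rewrite -hN natrD.
by rewrite /b hNF; ring.
Qed.

Lemma trunc_sum_inert :
  trunc_sum p (- (D%:R - 1) * D%:R^-1 ^+ 2) =
  - (-1) ^+ N * jac g (teich g ^+ (q1 - n)) :> W.
Proof.
rewrite (trunc_sum_even p_pr p_odd (isT : (0 < 2)%N) cardF D_gt1 D_co (or_intror pD) Np hN erefl).
rewrite jac_inert !mulrA mulrNN -expr2 -exprM mulnC exprM sqrrN !expr1n mul1r.
rewrite -raddfN; congr (_ * (1 + eps _)).
have D0 : D%:R != 0 :> F.
  by rewrite (pchar_natr_eq0 p_pr cardF) -prime_coprime // coprime_sym.
have n2 : 2%:R != 0 :> F := p2_neq0 p_pr p_odd cardF.
have p0 : p%:R = 0 :> F := pcharf0 (card_finPcharP cardF p_pr).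
have NE : N%:R = - 2%:R^-1 :> F.
  apply: (mulfI n2); rewrite mulrN divff // -natrM; apply/eqP; rewrite -addr_eq0 natr1.
  by rewrite mul2n Np p0.
have hE : h%:R = - 2%:R^-1 + 2%:R^-1 / D%:R :> F.
  apply: (mulfI n2); apply: (mulfI D0); rewrite -!natrM mul2n.
  have := congr1 (GRing.natmul (1 : F)) pD; rewrite natrD natrB ?(ltnW D_gt1) // p0 => E.
  transitivity (1 - D%:R : F); last by field; rewrite n2 D0.
  by apply/eqP; rewrite -subr_eq0 opprB E.
have h'E : h'%:R = - (2%:R^-1 / D%:R) :> F.
  by apply: (addrI h%:R); rewrite -natrD hN NE hE; ring.
rewrite NE hE h'E; field; rewrite n2 D0 //.
Qed.

Lemma jac_inert_unit : jac g (teich g ^+ (q1 - n)) \is a @GRing.unit W.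
Proof.
rewrite jac_inert unitrMl ?eps1_unit // unitrMl ?unitrN ?unitrX ?unitrN1 //.
have hN' : (h <= N)%N by rewrite -hN leq_addr.
have := fact_witt_unit p_pr cardF (_ : (N < p)%N); rewrite -(bin_fact hN') natrM.
by rewrite unitrM => /(_ _)/andP[|//]; lia.
Qed.

End InertCase.

(** * Truncated sums and split primes *)

Definition hyp_sum (D p : nat) : rat := \sum_(0 <= n < p) hyp_rat D n.

Section Congruences.
Variables (F : finFieldType) (g : F) (p e : nat).
Local Notation q1 := (#|F|.-1).
Hypotheses (g_prim : q1.-primitive_root g) (p_pr : prime p) (p_odd : odd p).
Hypotheses (e_gt0 : (0 < e)%N) (cardF : #|F| = (p ^ e)%N).
Local Notation W := (witt2 F).

Lemma hyp_sum_congr D (y : int) : (0 < D)%N -> coprime D p ->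
  trunc_sum p (- (D%:R - 1) * D%:R^-1 ^+ 2) = y%:~R :> W ->
  p_congr p 2 (hyp_sum D p) y%:~R.
Proof.
move=> D0 Dp E; apply: (reduces_congr p_pr cardF).
rewrite -E; apply: (reduces_sum (f := hyp_rat D) (h := hyp_coef _)) => i ip.
exact: (hyp_rat_reduces p_pr e_gt0 cardF).
Qed.

Section RootOfMinusOne.
Variables (D n : nat).
Hypothesis qE : q1 = (2 * D * n)%N.
Local Notation z := (teich g ^+ (q1 - n) : W).

Let n_gt0 : (0 < n)%N.
Proof. by have := prim_order_gt0 g_prim; rewrite qE; case: n => //; rewrite muln0. Qed.

Lemma teich_root_mul m : z ^+ m * teich g ^+ (n * m) = 1.
Proof.
have nq : (n <= q1)%N.
  have := prim_order_gt0 g_prim; rewrite qE; case: D => [|d]; rewrite ?muln0 ?mul0n //; nia.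
by rewrite exprM -exprMn -exprD subnK // (teich_q1 g_prim) expr1n.
Qed.

Lemma teich_rootD : z ^+ D = -1.
Proof.
have := teich_root_mul D.
rewrite (_ : n * D = q1./2)%N; last by rewrite qE -mulnA mul2n doubleK mulnC.
by rewrite (teich_gB g_prim p_pr p_odd cardF) mulrN1 => /eqP; rewrite eqr_oppLR => /eqP.
Qed.

(** The root of unity stays primitive modulo p, so z^m + 1 vanishes modulo p only if
    D divides m.  This allows division of z^D + 1 = 0 by its non-primitive
    factor. *)
Lemma teich_root_unit m : (0 < m)%N -> ~~ (D %| m)%N -> (z ^+ m + 1) \is a GRing.unit.
Proof.
move=> m0 Dm; have := teich_root_mul m; rewrite -!teichX => E.
rewrite witt2_unitE -[X in X != 0]/((g ^+ (q1 - n)) ^+ m + 1) addr_eq0.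
apply: contra Dm => /eqP zm.
have {}E : (g ^+ (q1 - n)) ^+ m * g ^+ (n * m) = 1.
  by have := congr1 (@witt2_fst F) E.
have gN : g ^+ (n * m) = -1 by move/eqP: E; rewrite zm mulN1r eqr_oppLR => /eqP.
have : (q1 %| n * m * 2)%N by rewrite (prim_order_dvd g_prim) exprM gN sqrrN expr1n.
have -> : (n * m * 2 = m * (2 * n))%N by ring.
by rewrite qE (_ : 2 * D * n = D * (2 * n))%N ?dvdn_pmul2r ?muln_gt0 //; ring.
Qed.

End RootOfMinusOne.
End Congruences.

Lemma finField_exists p e : prime p -> (0 < e)%N ->
  exists (F : finFieldType) (g : F), #|F| = (p ^ e)%N /\ (#|F|.-1).-primitive_root g.
Proof.
move=> p_pr e0; have [F _ cF] := pPrimePowerField p_pr e0.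
by have [g gP] := finField_prim_root F; exists F, g.
Qed.

Lemma card_intr (R : pzRingType) (F : finFieldType) p e : #|F| = (p ^ e)%N ->
  (#|F|%:Z)%:~R = p%:R ^+ e :> R.
Proof. by move=> ->; rewrite -pmulrn natrX. Qed.

Lemma hyp_sum_odd D k p : prime p -> odd p -> (1 < D)%N -> coprime D p ->
  (D * k + 1 = p \/ D * k + (D - 1) = p)%N -> odd k -> p_congr p 2 (hyp_sum D p) 0%:~R.
Proof.
move=> p_pr p_odd D1 Dp pD k_odd.
have [F [g [cF gP]]] := finField_exists p_pr (isT : (0 < 1)%N).
apply: (hyp_sum_congr p_pr p_odd (isT : (0 < 1)%N) cF (ltnW D1) Dp).
exact: (trunc_sum_odd p_pr p_odd _ cF D1 Dp pD k_odd).
Qed.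

Section SplitPrime.
Variables (p D h : nat).
Hypotheses (p_pr : prime p) (p_odd : odd p) (D_gt1 : (1 < D)%N) (D_co : coprime D p).
Hypothesis pD : (D * h.*2 + 1 = p)%N.

Lemma split_prime_data : exists (F : finFieldType) (g : F) (z : witt2 F),
  [/\ #|F| = (p ^ 1)%N, (#|F|.-1).-primitive_root g,
      (2 * D %| #|F|.-1)%N,
      z ^+ D = -1 &
      (forall m, (0 < m)%N -> ~~ (D %| m)%N -> (z ^+ m + 1) \is a GRing.unit) /\
      (trunc_sum p (- (D%:R - 1) * D%:R^-1 ^+ 2) = jac g z ^+ 2 /\
       jac g z \is a GRing.unit)].
Proof.
have [F [g [cF gP]]] := finField_exists p_pr (isT : (0 < 1)%N).
have qE : #|F|.-1 = (2 * D * h)%N by rewrite cF expn1 -pD addn1 /= -mul2n; ring.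
pose N := (D * h)%N.
have Np : (N.*2.+1 = p)%N by rewrite -pD -!mul2n /N; ring.
have hN : (h + (N - h) = N)%N by rewrite subnKC // /N; nia.
exists F, g, (teich g ^+ (#|F|.-1 - h)); split => //.
- by rewrite qE dvdn_mulr.
- exact: (teich_rootD gP p_pr p_odd (isT : (0 < 1)%N) cF qE).
split; first exact: (teich_root_unit gP p_pr p_odd (isT : (0 < 1)%N) cF qE).
split; first exact: (trunc_sum_split gP p_pr p_odd cF D_gt1 D_co Np hN pD).
exact: (jac_split_unit gP p_pr p_odd cF D_gt1 D_co Np hN pD).
Qed.

End SplitPrime.

Lemma odd_pred_card (F : finFieldType) p e : odd p -> #|F| = (p ^ e)%N -> ~~ odd #|F|.-1.
Proof.
move=> p_odd cF; have : odd #|F| by rewrite cF oddX p_odd orbT.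
by rewrite -{1}(ltn_predK (finNzRing_gt1 F)) /=.
Qed.

(** As p^2 = 0, the conjugate p / J of J has square 0, so J^2 is equal to its trace. *)
Lemma conj_sqr0 (F : finFieldType) p e (J K : witt2 F) : prime p -> #|F| = (p ^ e)%N ->
  J \is a GRing.unit -> J * K = p%:R -> K ^+ 2 = 0.
Proof.
move=> p_pr cF uJ JK; apply: (mulrI uJ); apply: (mulrI uJ).
by rewrite !mulr0 mulrA -expr2 -exprMn JK expr2 (witt2_pp p_pr cF).
Qed.

(** J = a + b z with b = 2w even, so J = (a + w) + w sqrt(-3), and the trace of J^2
    is 2 ((a + w)^2 - 3 w^2). *)
Lemma hyp_sum_split3 p : prime p -> (5 <= p)%N -> (p %% 6 = 1)%N -> exists x y : int,
  p%:Z = x ^+ 2 + 3 * y ^+ 2 /\ p_congr p 2 (hyp_sum 3 p) (2 * (x ^+ 2 - 3 * y ^+ 2))%:~R.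
Proof.
move=> p_pr p5 p6; have pE := divn_eq p 6; rewrite p6 in pE; set h := (p %/ 6)%N in pE.
have p_odd : odd p by rewrite pE oddD oddM andbF.
have D_co : coprime 3 p by rewrite prime_coprime // pE; lia.
have pD : (3 * h.*2 + 1 = p)%N by lia.
have [F [g [z [cF gP dvd z3 [unitz [fE uJ]]]]]] := split_prime_data (D := 3) p_pr p_odd isT D_co pD.
have q1e := odd_pred_card p_odd cF.
have z2 : z ^+ 2 = z - 1.
  apply/eqP; rewrite -subr_eq0; apply/eqP/(mulrI (unitz 1%N isT isT)).
  by transitivity (z ^+ 3 + 1); [ring | rewrite z3 addNr mulr0].
have [a [b [ab [w bE] J]]] := jac_value6 gP q1e dvd.
have {}J := J _ z z2.
exists (a + w), w; split.
  have := congr1 (fun n : int => n) ab; rewrite cF expn1 => <-; rewrite bE; ring.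
apply: (hyp_sum_congr (D := 3) p_pr p_odd (isT : (0 < 1)%N) cF isT D_co).
rewrite fE; have K0 : (a%:~R + b%:~R * (1 - z)) ^+ 2 = 0 :> witt2 F.
  apply: (conj_sqr0 p_pr cF uJ); rewrite J.
  transitivity ((a%:~R ^+ 2 + a%:~R * b%:~R + b%:~R ^+ 2 * (z - z ^+ 2)) : witt2 F).
    ring.
  have := card_intr (witt2 F) cF; rewrite expr1 -ab => <-.
  by rewrite z2 !rmorphD rmorphM !rmorphXn /=; ring.
have bW : b%:~R = 2 * w%:~R :> witt2 F by rewrite bE rmorphM.
have -> : (2 * ((a + w) ^+ 2 - 3 * w ^+ 2))%:~R =
    2 * ((a%:~R + w%:~R) ^+ 2 - 3 * w%:~R ^+ 2) :> witt2 F.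
  by rewrite !expr2 !(intrM, intrB, intrD).
rewrite -[LHS]addr0 -K0 J bW.
set A : witt2 F := intmul 1 a; set B : witt2 F := intmul 1 w.
transitivity (2 * A ^+ 2 + 4 * A * B + 4 * B ^+ 2 - 8 * B ^+ 2 * (z - z ^+ 2) : witt2 F).
  ring.
by rewrite z2; ring.
Qed.

Lemma hyp_sum_split4 p : prime p -> (5 <= p)%N -> (p %% 8 = 1)%N -> exists x y : int,
  p%:Z = x ^+ 2 + 2 * y ^+ 2 /\ p_congr p 2 (hyp_sum 4 p) (2 * (x ^+ 2 - 2 * y ^+ 2))%:~R.
Proof.
move=> p_pr p5 p6; have pE := divn_eq p 8; rewrite p6 in pE; set h := (p %/ 8)%N in pE.
have p_odd : odd p by rewrite pE oddD oddM andbF.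
have D_co : coprime 4 p by rewrite (@coprimeXl 2 2) // coprime2n.
have pD : (4 * h.*2 + 1 = p)%N by lia.
have [F [g [z [cF gP dvd z4 [_ [fE uJ]]]]]] := split_prime_data (D := 4) p_pr p_odd isT D_co pD.
have q1e := odd_pred_card p_odd cF.
have [u [v [uv J]]] := jac_value8 gP q1e dvd.
have {}J := J _ z z4.
exists u, v; split; first by rewrite uv cF expn1.
apply: (hyp_sum_congr (D := 4) p_pr p_odd (isT : (0 < 1)%N) cF isT D_co).
have w2 : (z + z ^+ 3) ^+ 2 = - 2.
  by transitivity (z ^+ 2 + 2 * z ^+ 4 + z ^+ 4 * z ^+ 2); [ring | rewrite z4; ring].
rewrite fE; have K0 : (u%:~R - v%:~R * (z + z ^+ 3)) ^+ 2 = 0 :> witt2 F.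
  apply: (conj_sqr0 p_pr cF uJ); rewrite J mulrC -subr_sqr exprMn w2.
  have := card_intr (witt2 F) cF; rewrite expr1 -uv => <-.
  by rewrite rmorphD rmorphM !rmorphXn /=; ring.
rewrite -[LHS]addr0 -K0 J !expr2 !(intrM, intrB).
transitivity (2 * u%:~R ^+ 2 + 2 * v%:~R ^+ 2 * (z + z ^+ 3) ^+ 2 : witt2 F); first ring.
by rewrite w2; ring.
Qed.

Lemma hyp_sum_split6 p : prime p -> (5 <= p)%N -> (p %% 12 = 1)%N -> exists x y : int,
  [/\ p%:Z = x ^+ 2 + y ^+ 2, exists w, x = 1 + 2 * w &
      p_congr p 2 (hyp_sum 6 p) (2 * (x ^+ 2 - y ^+ 2))%:~R].
Proof.
move=> p_pr p5 p6; have pE := divn_eq p 12; rewrite p6 in pE; set h := (p %/ 12)%N in pE.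
have p_odd : odd p by rewrite pE oddD oddM andbF.
have D_co : coprime 6 p.
  rewrite (_ : 6 = 2 * 3)%N // coprimeMl coprime2n p_odd prime_coprime // pE; lia.
have pD : (6 * h.*2 + 1 = p)%N by lia.
have [F [g [z [cF gP dvd z6 [unitz [fE uJ]]]]]] := split_prime_data (D := 6) p_pr p_odd isT D_co pD.
have q1e := odd_pred_card p_odd cF.
have z4 : z ^+ 4 = z ^+ 2 - 1.
  apply/eqP; rewrite -subr_eq0; apply/eqP/(mulrI (unitz 2%N isT isT)).
  by transitivity (z ^+ 6 + 1); [ring | rewrite z6 addNr mulr0].
have [v [uv u_odd J]] := jac_value12 gP q1e dvd.
have {}J := J _ z z6 z4; move: (half_sum g 6 0 + _) uv u_odd J => u uv u_odd J.
exists u, v; split=> //; first by rewrite uv cF expn1.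
apply: (hyp_sum_congr (D := 6) p_pr p_odd (isT : (0 < 1)%N) cF isT D_co).
have w2 : (z ^+ 3) ^+ 2 = -1 by rewrite -exprM; exact: z6.
rewrite fE; have K0 : (u%:~R - v%:~R * z ^+ 3) ^+ 2 = 0 :> witt2 F.
  apply: (conj_sqr0 p_pr cF uJ); rewrite J mulrC -subr_sqr exprMn w2.
  have := card_intr (witt2 F) cF; rewrite expr1 -uv => <-.
  by rewrite rmorphD !rmorphXn /=; ring.
rewrite -[LHS]addr0 -K0 J !expr2 !(intrM, intrB).
transitivity (2 * u%:~R ^+ 2 + 2 * v%:~R ^+ 2 * (z ^+ 3) ^+ 2 : witt2 F); first ring.
by rewrite w2; ring.
Qed.

(** * Truncated sums and inert primes *)

Section InertPrime.
Variables (p D h : nat).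
Hypotheses (p_pr : prime p) (p_odd : odd p) (D_gt1 : (1 < D)%N) (D_co : coprime D p).
Hypothesis pD : (D * h.*2 + (D - 1) = p)%N.

Lemma inert_prime_data : exists (F : finFieldType) (g : F) (z : witt2 F),
  [/\ #|F| = (p ^ 2)%N, (#|F|.-1).-primitive_root g,
      (2 * D %| #|F|.-1)%N,
      z ^+ D = -1 &
      (forall m, (0 < m)%N -> ~~ (D %| m)%N -> (z ^+ m + 1) \is a GRing.unit) /\
      [/\ trunc_sum p (- (D%:R - 1) * D%:R^-1 ^+ 2) = - (-1) ^+ p./2 * jac g z,
          jac g z \is a GRing.unit &
          witt2_fst (jac g z) = - (-1) ^+ p./2 * 'C(p./2, h)%:R ^+ 2]].
Proof.
have [F [g [cF gP]]] := finField_exists p_pr (isT : (0 < 2)%N).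
pose N := p./2; have Np : (N.*2.+1 = p)%N.
  by rewrite -[RHS]odd_double_half p_odd.
have hN : (h + (N - h) = N)%N by rewrite subnKC //; lia.
have [qE _] := inert_order gP p_pr p_odd cF D_gt1 D_co Np hN pD.
exists F, g, (teich g ^+ (#|F|.-1 - (h * p + (N - h)))); split => //.
- by rewrite qE dvdn_mulr.
- exact: (teich_rootD gP p_pr p_odd (isT : (0 < 2)%N) cF qE).
split; first exact: (teich_root_unit gP p_pr p_odd (isT : (0 < 2)%N) cF qE).
split.
- exact: (trunc_sum_inert gP p_pr p_odd cF D_gt1 D_co Np hN pD).
- exact: (jac_inert_unit gP p_pr p_odd cF D_gt1 D_co Np hN pD).
rewrite (jac_inert gP p_pr p_odd cF D_gt1 D_co Np hN pD) -/N.
set s := - _ ^+ N * _ ^+ 2.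
rewrite -[LHS]/(witt2_fst s * (1 + witt2_fst (eps _))) fst_eps addr0 mulr1 /s.
by rewrite rmorphM rmorphN !rmorphXn rmorphN rmorph1 rmorph_nat.
Qed.

End InertPrime.

(** The norm p^2 vanishes in the Witt ring. *)
Lemma unit_conj0 (F : finFieldType) p (J K : witt2 F) : prime p -> #|F| = (p ^ 2)%N ->
  J \is a GRing.unit -> J * K = p%:R ^+ 2 -> K = 0.
Proof.
move=> p_pr cF uJ JK; apply: (mulrI uJ).
by rewrite mulr0 JK expr2 (witt2_pp p_pr cF).
Qed.

Lemma intr_double_unit (F : finFieldType) p e (u : int) : prime p -> #|F| = (p ^ e)%N ->
  (2 * u%:~R : witt2 F) \is a GRing.unit -> ~~ (p%:Z %| u)%Z.
Proof.
move=> p_pr cF; rewrite witt2_unitE -(pchar_intr_eq0 p_pr cF).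
apply: contra => /eqP u0.
have -> : witt2_fst (2 * u%:~R : witt2 F) = 2 * u%:~R.
  by rewrite rmorphM rmorph_int rmorph_nat.
by rewrite u0 mulr0.
Qed.

(** J is its own trace 2u, and modulo p it is a square by [jac_inert]: this is the
    integer c, which fixes the sign of u. *)
Lemma hyp_sum_inert4 p : prime p -> (p %% 8 = 3)%N -> exists u v c : int,
  [/\ (p%:Z) ^+ 2 = u ^+ 2 + 2 * v ^+ 2, ~~ (p%:Z %| u)%Z, (p%:Z %| 2 * u - c ^+ 2)%Z &
      p_congr p 2 (hyp_sum 4 p) (2 * u)%:~R].
Proof.
move=> p_pr p8; have pE := divn_eq p 8; rewrite p8 in pE; set h := (p %/ 8)%N in pE.
have p_odd : odd p by rewrite pE oddD oddM andbF.
have D_co : coprime 4 p by rewrite (@coprimeXl 2 2) // coprime2n.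
have pD : (4 * h.*2 + (4 - 1) = p)%N by lia.
have [F [g [z [cF gP dvd z4 [_ [fE uJ J1]]]]]] :=
  inert_prime_data (D := 4) p_pr p_odd isT D_co pD.
have q1e := odd_pred_card p_odd cF.
have [u [v [uv J]]] := jac_value8 gP q1e dvd.
have {}J := J _ z z4.
have Nodd : (-1) ^+ p./2 = -1 :> witt2 F.
  rewrite -signr_odd (_ : p./2 = (2 * h).*2.+1)%N /= ?odd_double ?expr1 //.
  by rewrite pE; lia.
have NoddF : (-1) ^+ p./2 = -1 :> F.
  rewrite -signr_odd (_ : p./2 = (2 * h).*2.+1)%N /= ?odd_double ?expr1 //.
  by rewrite pE; lia.
have w2 : (z + z ^+ 3) ^+ 2 = - 2.
  by transitivity (z ^+ 2 + 2 * z ^+ 4 + z ^+ 4 * z ^+ 2); [ring | rewrite z4; ring].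
have K0 : u%:~R - v%:~R * (z + z ^+ 3) = 0 :> witt2 F.
  apply: (unit_conj0 p_pr cF uJ); rewrite J mulrC -subr_sqr exprMn w2.
  have := card_intr (witt2 F) cF; rewrite -uv => <-.
  by rewrite rmorphD rmorphM !rmorphXn /=; ring.
have J2 : jac g z = 2 * u%:~R by rewrite J -[LHS]addr0 -K0; ring.
exists u, v, ('C(p./2, h)%:Z); split.
- by rewrite uv cF !expnS expn0 muln1 PoszM expr2.
- by apply: (intr_double_unit p_pr cF); rewrite -J2.
- rewrite -(pchar_intr_eq0 p_pr cF) intrB subr_eq0 intrM; apply/eqP.
  have := J1; rewrite J2 NoddF opprK mul1r -[LHS]/(2 * witt2_fst u%:~R).
  by rewrite rmorph_int => ->; rewrite !expr2 intrM.
apply: (hyp_sum_congr (D := 4) p_pr p_odd (isT : (0 < 2)%N) cF isT D_co).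
by rewrite fE Nodd opprK mul1r J2 intrM.
Qed.

(** J is its own trace 2u.  Here (p-1)/2 is even, so the truncated sum is -J; u is
    normalized by u = 1 mod 4. *)
Lemma hyp_sum_inert6 p : prime p -> (p %% 12 = 5)%N -> exists u v w : int,
  [/\ (p%:Z) ^+ 2 = u ^+ 2 + v ^+ 2, ~~ (p%:Z %| u)%Z, u = 1 + 4 * w &
      p_congr p 2 (hyp_sum 6 p) (- (2 * u))%:~R].
Proof.
move=> p_pr p12; have pE := divn_eq p 12; rewrite p12 in pE; set h := (p %/ 12)%N in pE.
have p_odd : odd p by rewrite pE oddD oddM andbF.
have D_co : coprime 6 p.
  rewrite (_ : 6 = 2 * 3)%N // coprimeMl coprime2n p_odd prime_coprime // pE; lia.
have pD : (6 * h.*2 + (6 - 1) = p)%N by lia.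
have [F [g [z [cF gP dvd z6 [unitz [fE uJ _]]]]]] :=
  inert_prime_data (D := 6) p_pr p_odd isT D_co pD.
have q1e := odd_pred_card p_odd cF.
have z4 : z ^+ 4 = z ^+ 2 - 1.
  apply/eqP; rewrite -subr_eq0; apply/eqP/(mulrI (unitz 2%N isT isT)).
  by transitivity (z ^+ 6 + 1); [ring | rewrite z6 addNr mulr0].
have [v [uv _ J]] := jac_value12 gP q1e dvd.
have [w uE] := jac_value12_sign gP q1e p_pr cF p12.
have {}J := J _ z z6 z4; move: (half_sum g 6 0 + _) uv uE J => u uv uE J.
have Neven : (-1) ^+ p./2 = 1 :> witt2 F.
  rewrite -signr_odd (_ : p./2 = (3 * h + 1).*2)%N ?odd_double ?expr0 //.
  by rewrite pE; lia.
have w2 : (z ^+ 3) ^+ 2 = -1 by rewrite -exprM; exact: z6.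
have K0 : u%:~R - v%:~R * z ^+ 3 = 0 :> witt2 F.
  apply: (unit_conj0 p_pr cF uJ); rewrite J mulrC -subr_sqr exprMn w2.
  have := card_intr (witt2 F) cF; rewrite -uv => <-.
  by rewrite rmorphD !rmorphXn /=; ring.
have J2 : jac g z = 2 * u%:~R by rewrite J -[LHS]addr0 -K0; ring.
exists u, v, w; split=> //.
- by rewrite uv cF !expnS expn0 muln1 PoszM expr2.
- by apply: (intr_double_unit p_pr cF); rewrite -J2.
apply: (hyp_sum_congr (D := 6) p_pr p_odd (isT : (0 < 2)%N) cF isT D_co).
by rewrite fE Neven mulN1r J2 mulrNz intrM.
Qed.

(** * Weighted sums over the representations of a prime *)

Definition zrange (L : nat) : seq int := [seq i%:Z - L%:Z | i <- iota 0 (2 * L + 1)].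

Lemma mem_zrange L (t : int) : (t \in zrange L) = (- L%:Z <= t <= L%:Z).
Proof.
apply/mapP/idP => [[k]|H].
  by rewrite mem_iota => /andP[_ kL] ->; lia.
by exists (absz (t + L%:Z)); [rewrite mem_iota; lia | lia].
Qed.

Lemma zrange_uniq L : uniq (zrange L).
Proof. by rewrite map_inj_uniq ?iota_uniq // => i j /addIr[]. Qed.

Definition zsquare (L : nat) : seq (int * int) := [seq (i, j) | i <- zrange L, j <- zrange L].

Lemma mem_zsquare L i j : ((i, j) \in zsquare L) = (i \in zrange L) && (j \in zrange L).
Proof.
apply/allpairsP/andP => [[[a b] /= [ha hb [-> ->]]] //|[hi hj]].
by exists (i, j).
Qed.

Lemma zsquare_uniq L : uniq (zsquare L).
Proof. by apply: allpairs_uniq; rewrite ?zrange_uniq // => -[a b] [c d]. Qed.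

Lemma sum_two (T : eqType) (r : seq T) (Q : pred T) (f : T -> int) s1 s2 :
  uniq r -> s1 \in r -> s2 \in r -> Q s1 -> Q s2 -> s1 != s2 ->
  (forall x, x \in r -> Q x -> x = s1 \/ x = s2) ->
  \sum_(x <- r | Q x) f x = f s1 + f s2.
Proof.
move=> ru r1 r2 Q1 Q2 s12 H.
suff P : perm_eq [seq x <- r | Q x] [:: s1; s2].
  by rewrite -big_filter (perm_big _ P) /= !big_cons big_nil addr0.
apply: uniq_perm; first exact: filter_uniq.
  by rewrite /= inE s12.
move=> x; rewrite mem_filter !inE; apply/andP/orP => [[Qx xr]|[] /eqP ->] //.
by case: (H x xr Qx) => ->; rewrite eqxx; [left | right].
Qed.

Lemma prime_dvdzM (p : nat) (a b : int) : prime p ->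
  (p%:Z %| a * b)%Z -> (p%:Z %| a)%Z \/ (p%:Z %| b)%Z.
Proof. by move=> p_pr; rewrite !dvdzE abszM Euclid_dvdM // => /orP. Qed.

(** Brahmagupta's identity
    p^2 = (xX + DyY)^2 + D (xY - yX)^2 and the divisibility of one of xY - yX and
    xY + yX by p leave only the values 0, p and -p for it; the last two force D = 1, where
    the two squares may be exchanged. *)
Lemma form_unique (p : nat) (D x y X Y : int) : prime p -> 1 <= D ->
  p%:Z = x ^+ 2 + D * y ^+ 2 -> p%:Z = X ^+ 2 + D * Y ^+ 2 ->
  X ^+ 2 = x ^+ 2 \/ (D = 1 /\ X ^+ 2 = y ^+ 2).
Proof.
move=> p_pr D1 pE PE; have p0 : p%:Z != 0 by rewrite -lt0n prime_gt0.
have key z : z ^+ 2 = Y ^+ 2 -> (p%:Z %| x * z - y * X)%Z ->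
    X ^+ 2 = x ^+ 2 \/ (D = 1 /\ X ^+ 2 = y ^+ 2).
  move=> zY /dvdzP[k kE].
  have PE' : p%:Z = X ^+ 2 + D * z ^+ 2 by rewrite zY.
  have E : p%:Z ^+ 2 = (x * X + D * y * z) ^+ 2 + D * k ^+ 2 * p%:Z ^+ 2.
    transitivity ((x ^+ 2 + D * y ^+ 2) * (X ^+ 2 + D * z ^+ 2)).
      by rewrite -pE -PE' expr2.
    transitivity ((x * X + D * y * z) ^+ 2 + D * (x * z - y * X) ^+ 2); first ring.
    by rewrite kE; ring.
  have [k0|k0] := eqVneq k 0.
    left; rewrite k0 mul0r in kE; apply: (mulIf p0).
    transitivity ((X * x) ^+ 2 + D * (y * X) ^+ 2); first by rewrite pE; ring.
    have -> : y * X = x * z by apply/eqP; rewrite eq_sym -subr_eq0 kE.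
    by rewrite PE'; ring.
  right; have k2 : 1 <= k ^+ 2 by rewrite -gtz0_ge1 exprn_even_gt0 //= k0.
  have DDk : D <= D * k ^+ 2 by rewrite ler_peMr // (le_trans _ D1).
  have p2 : 0 < p%:Z ^+ 2 by rewrite exprn_gt0 // -[0 < _]/(0 < p)%N prime_gt0.
  have s0 : 0 <= (x * X + D * y * z) ^+ 2 by rewrite sqr_ge0.
  have Dk : D * k ^+ 2 <= 1.
    by rewrite -(ler_pM2r p2) mul1r {2}E lerDr.
  have Dk1 : D * k ^+ 2 = 1 by apply/eqP; rewrite eq_le Dk (le_trans D1).
  have DE : D = 1 by apply/eqP; rewrite eq_le D1 andbT -[X in _ <= X]Dk1.
  have z0 : x * X + D * y * z = 0.
    by apply/eqP; rewrite -sqrf_eq0 -(inj_eq (addIr (p%:Z ^+ 2))) add0r {2}E Dk1 mul1r.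
  split=> //; apply: (mulIf p0); rewrite DE mul1r in z0 pE PE' *.
  transitivity ((X * x) ^+ 2 + (X * y) ^+ 2); first by rewrite pE; ring.
  have -> : X * x = - (y * z) by apply/eqP; rewrite -addr_eq0 mulrC z0.
  by rewrite PE'; ring.
have : (p%:Z %| (x * Y - y * X) * (x * - Y - y * X))%Z.
  apply/dvdzP; exists (y ^+ 2 - Y ^+ 2).
  transitivity (y ^+ 2 * X ^+ 2 - x ^+ 2 * Y ^+ 2); first ring.
  have -> : X ^+ 2 = p%:Z - D * Y ^+ 2 by rewrite PE addrK.
  have -> : x ^+ 2 = p%:Z - D * y ^+ 2 by rewrite pE addrK.
  ring.
by case/(prime_dvdzM p_pr); apply: key; rewrite ?sqrrN.
Qed.

Lemma sqr_eq_or (a b : int) : a ^+ 2 = b ^+ 2 -> a = b \/ a = - b.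
Proof. by move/eqP; rewrite eqf_sqr => /orP[] /eqP; [left | right]. Qed.

Lemma prime_neq_sqr (p : nat) (x : int) : prime p -> p%:Z <> x ^+ 2.
Proof.
move=> p_pr E; have {}E : p = (`|x| * `|x|)%N.
  by rewrite -abszM -expr2 -E.
have := p_pr; rewrite E => H; have := H.
case/primeP => _ /(_ `|x|%N (dvdn_mulr _ (dvdnn _))) /orP[/eqP x1|/eqP xx].
  by rewrite x1 in H.
by have : (`|x| = 0 \/ `|x| = 1)%N by [nia]; case=> z; rewrite z in H.
Qed.

Lemma int_le_sqr (x : int) : - x ^+ 2 <= x <= x ^+ 2.
Proof. by rewrite expr2; nia. Qed.

Lemma zmod_cases (x d : int) : 0 < d -> exists q r, x = q * d + r /\ 0 <= r < d.
Proof.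
move=> d0; exists (x %/ d)%Z, (x %% d)%Z; split; first exact: divz_eq.
by rewrite modz_ge0 ?ltz_pmod // gt_eqF.
Qed.

Lemma sqr_parity (x : int) : exists k, x ^+ 2 = x + 2 * k.
Proof.
have [q [r [-> r2]]] := @zmod_cases x 2 isT.
exists (2 * q ^+ 2 + 2 * q * r - q); have : r = 0 \/ r = 1 by lia.
by case=> ->; ring.
Qed.

Lemma odd_int (p : nat) : odd p -> exists k, p%:Z = 1 + 2 * k.
Proof. by move=> p_odd; exists (p./2)%:Z; lia. Qed.

Lemma prime_neq_mul (p d : nat) (n : int) : prime p -> (1 < d < p)%N -> p%:Z <> d%:Z * n.
Proof.
move=> p_pr /andP[d1 dp] E; have : (d %| p)%N.
  by apply/dvdnP; exists (absz n); rewrite mulnC -[d in RHS]/(absz d) -abszM -E.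
case/primeP: p_pr => _ H /H /orP[] /eqP dE; first by rewrite dE in d1.
by rewrite dE ltnn in dp.
Qed.

(** The coefficient of q^p in q J(q^4)^2, where J is the series of [jacobi]. *)
Definition coef_a (p : nat) : int :=
  \sum_(x <- zsquare p |
     1 + 4 * (x.1 * (2 * x.1 + 1) + x.2 * (2 * x.2 + 1)) == p%:Z)
    (4 * x.1 + 1) * (4 * x.2 + 1).

(** The coefficient of q^p in q J(q^6) J(q^2). *)
Definition coef_b (p : nat) : int :=
  \sum_(x <- zsquare p |
     1 + 6 * (x.1 * (2 * x.1 + 1)) + 2 * (x.2 * (2 * x.2 + 1)) == p%:Z)
    (4 * x.1 + 1) * (4 * x.2 + 1).

(** The coefficient of q^p in q F(q) F(q^2), where F is the series of
    [quintuple]. *)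
Definition coef_c (p : nat) : int :=
  \sum_(x <- zsquare p |
     1 + x.1 * (3 * x.1 + 2) + 2 * (x.2 * (3 * x.2 + 2)) == p%:Z)
    (3 * x.1 + 1) * (3 * x.2 + 1).

(** With u = 2(i + j) + 1 and v = 2(i - j) the condition on (i, j) is p = u^2 + v^2
    and the weight is u^2 - v^2.  As 4i + 1 = u + v, only one sign of u is possible, with
    both signs of v. *)
Lemma coef_aE (p : nat) (x y w : int) : prime p -> p%:Z = x ^+ 2 + y ^+ 2 ->
  x = 1 + 2 * w -> odd p -> coef_a p = 2 * (x ^+ 2 - y ^+ 2).
Proof.
move=> p_pr.
(* Since x is odd and y even, the sign of x can be chosen so that 4 | x + y - 1. *)
wlog : x w / exists m, x + y = 4 * m + 1.
  move=> H pE xE p_odd; have [z yE] : exists z, y = 2 * z.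
    have [k kE] := sqr_parity x; have [l lE] := sqr_parity y.
    have [n nE] := odd_int p_odd.
    by exists (n - k - l - w); lia.
  have [s [r [wE r2]]] := @zmod_cases (w + z) 2 isT.
  have [r0|r1] : r = 0 \/ r = 1 by lia.
    by apply: (H x w) => //; exists s; lia.
  rewrite -(sqrrN x); apply: (H (- x) (- w - 1)) => //; rewrite ?sqrrN //; last lia.
  by exists (z - s - 1); lia.
case=> m mE pE xE p_odd.
(* The two solutions come from v = y and v = - y; they differ as y != 0. *)
have y0 : y != 0.
  by apply/eqP => y0; apply: (@prime_neq_sqr p x p_pr); rewrite pE y0; ring.
have [z yE] : exists z, y = 2 * z by exists (2 * m - w); lia.
have Ep i j : (1 + 4 * (i * (2 * i + 1) + j * (2 * j + 1)) == p%:Z) =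
    (p%:Z == (2 * (i + j) + 1) ^+ 2 + (2 * (i - j)) ^+ 2).
  rewrite eq_sym; congr (_ == _); ring.
have [x2 y2] := (int_le_sqr x, int_le_sqr y).
rewrite /coef_a (@sum_two _ _ _ _ (m, m - z) (m - z, m)) ?zsquare_uniq //=.
- have -> : 4 * m + 1 = x + y by rewrite mE.
  have -> : 4 * (m - z) + 1 = x - y by rewrite yE; lia.
  ring.
- by rewrite mem_zsquare !mem_zrange; lia.
- by rewrite mem_zsquare !mem_zrange; lia.
- by rewrite Ep pE (_ : x = 2 * (m + (m - z)) + 1) ?yE; [apply/eqP; ring | lia].
- by rewrite Ep pE (_ : x = 2 * (m - z + m) + 1) ?yE; [apply/eqP; ring | lia].
- by apply/eqP => -[]; lia.
case=> i j _ /=; rewrite Ep => /eqP E.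
have pE1 : p%:Z = x ^+ 2 + 1 * y ^+ 2 by rewrite mul1r.
have E1 : p%:Z = (2 * (i + j) + 1) ^+ 2 + 1 * (2 * (i - j)) ^+ 2 by rewrite mul1r.
case: (form_unique p_pr (lexx 1) pE1 E1) => [H|[_ H]].
- have HY : (2 * (i - j)) ^+ 2 = y ^+ 2 by move: pE; rewrite E H => /addrI.
  case: (sqr_eq_or H) => HX; case: (sqr_eq_or HY) => {}HY.
  + by left; congr (_, _); lia.
  + by right; congr (_, _); lia.
  + by exfalso; lia.
  by exfalso; lia.
by case: (sqr_eq_or H) => HX; exfalso; lia.
Qed.

Lemma coef_a0 (p : nat) : (p %% 4 = 3)%N -> coef_a p = 0.
Proof.
move=> p4; rewrite /coef_a big1_seq // => -[i j] /andP[/= /eqP E _].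
by exfalso; lia.
Qed.

(** With u = 3i + j + 1 and v = j - i the condition is p = u^2 + 3v^2 and the weight
    u^2 + 2uv - 3v^2; of the four choices of signs for (u, v) two give integral
    (i, j), depending on the parity of y, and their cross terms cancel. *)
Lemma coef_bE (p : nat) (x y : int) : prime p -> p%:Z = x ^+ 2 + 3 * y ^+ 2 ->
  odd p -> (3 < p)%N -> coef_b p = 2 * (x ^+ 2 - 3 * y ^+ 2).
Proof.
move=> p_pr.
(* Since p is odd, so is x - y; its sign is changed with those of x and y. *)
wlog : x y / exists m, x - y = 4 * m + 1.
  move=> H pE p_odd p3.
  have [s [r [E r4]]] := @zmod_cases (x - y) 4 isT.
  have [r0|r2|r1|r3] : [\/ r = 0, r = 2, r = 1 | r = 3] by
    have : r = 0 \/ r = 2 \/ r = 1 \/ r = 3 by [lia]; 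
    case=> [->|[->|[->|->]]]; [constructor 1|constructor 2|constructor 3|constructor 4].
  - by exfalso; lia.
  - by exfalso; lia.
  - by apply: (H x y) => //; exists s; rewrite E r1; ring.
  rewrite -(sqrrN x) -(sqrrN y); apply: (H (- x) (- y)); rewrite ?sqrrN //.
  by exists (- s - 1); lia.
case=> m mE pE p_odd p3.
have y0 : y != 0.
  by apply/eqP => y0; apply: (@prime_neq_sqr p x p_pr); rewrite pE y0; ring.
have x0 : x != 0.
  apply/eqP => x0; apply: (@prime_neq_mul p 3 (y ^+ 2) p_pr) => //.
  by rewrite pE x0; ring.
have Ep i j : (1 + 6 * (i * (2 * i + 1)) + 2 * (j * (2 * j + 1)) == p%:Z) =
    (p%:Z == (3 * i + j + 1) ^+ 2 + 3 * (j - i) ^+ 2).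
  rewrite eq_sym; congr (_ == _); ring.
have [x2 y2] := (int_le_sqr x, int_le_sqr y).
have sol i j : 1 + 6 * (i * (2 * i + 1)) + 2 * (j * (2 * j + 1)) == p%:Z ->
    (3 * i + j + 1 = x \/ 3 * i + j + 1 = - x) /\ (j - i = y \/ j - i = - y).
  rewrite Ep => /eqP E; have [H|[] //] := form_unique p_pr (isT : 1 <= (3 : int)) pE E.
  split; first exact: sqr_eq_or.
  apply: sqr_eq_or; apply: (mulfI (isT : (3 : int) != 0)).
  by move: pE; rewrite E H => /addrI.
have val (i j X Y : int) : 3 * i + j + 1 = X -> j - i = Y ->
    (4 * i + 1) * (4 * j + 1) = X ^+ 2 + 2 * X * Y - 3 * Y ^+ 2.
  by move=> <- <-; ring.
have [z [r [yE r2]]] := @zmod_cases y 2 isT.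
have [r0|r1] : r = 0 \/ r = 1 by lia.
- rewrite /coef_b (@sum_two _ _ _ _ (m, y + m) (m + z, m + z - y)) ?zsquare_uniq //=.
  + have e1 := val m (y + m) x y ltac:(lia) ltac:(lia).
    have e2 := val (m + z) (m + z - y) x (- y) ltac:(lia) ltac:(lia).
    by rewrite e1 e2; ring.
  + by rewrite mem_zsquare !mem_zrange; lia.
  + by rewrite mem_zsquare !mem_zrange; lia.
  + by rewrite Ep pE; apply/eqP; congr (_ ^+ 2 + 3 * _ ^+ 2); lia.
  + by rewrite Ep pE -(sqrrN y); apply/eqP; congr (_ ^+ 2 + 3 * _ ^+ 2); lia.
  + by apply/eqP => -[]; lia.
  case=> i j _ /= /sol[[Hx|Hx] [Hy|Hy]].
  + by left; congr (_, _); lia.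
  + by right; congr (_, _); lia.
  + by exfalso; lia.
  by exfalso; lia.
- rewrite /coef_b (@sum_two _ _ _ _ (m, y + m) (- m - z - 1, z - m)) ?zsquare_uniq //=.
  + have e1 := val m (y + m) x y ltac:(lia) ltac:(lia).
    have e2 := val (- m - z - 1) (z - m) (- x) y ltac:(lia) ltac:(lia).
    by rewrite e1 e2; ring.
  + by rewrite mem_zsquare !mem_zrange; lia.
  + by rewrite mem_zsquare !mem_zrange; lia.
  + by rewrite Ep pE; apply/eqP; congr (_ ^+ 2 + 3 * _ ^+ 2); lia.
  + by rewrite Ep pE -(sqrrN x); apply/eqP; congr (_ ^+ 2 + 3 * _ ^+ 2); lia.
  + by apply/eqP => -[]; lia.
  case=> i j _ /= /sol[[Hx|Hx] [Hy|Hy]].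
  + by left; congr (_, _); lia.
  + by exfalso; lia.
  + by right; congr (_, _); lia.
  by exfalso; lia.
Qed.

Lemma coef_b0 (p : nat) : (p %% 3 = 2)%N -> coef_b p = 0.
Proof.
move=> p3; rewrite /coef_b big1_seq // => -[i j] /andP[/= /eqP E _]; exfalso.
have [q [r [qE r3]]] := @zmod_cases (j + 1) 3 isT.
have {}E : p%:Z = (j + 1) ^+ 2 + 3 * ((j - i) ^+ 2 + 3 * i ^+ 2 + 2 * i * (j + 1)).
  by rewrite -E; ring.
have : p%:Z = r ^+ 2 + 3 * (3 * q ^+ 2 + 2 * q * r +
    ((j - i) ^+ 2 + 3 * i ^+ 2 + 2 * i * (j + 1))) by rewrite E qE; ring.
move: (_ + _ * r + _) => n; have : [\/ r = 0, r = 1 | r = 2].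
  by have : r = 0 \/ r = 1 \/ r = 2 by [lia]; case=> [|[]] ->;
     [constructor 1 | constructor 2 | constructor 3].
by case=> -> ; rewrite ?expr0n ?expr1n //=; lia.
Qed.

(** With u = i + 2j + 1 and v = i - j the condition is p = u^2 + 2v^2 and the weight
    u^2 + uv - 2v^2; of the four choices of signs for (u, v) two give integral
    (i, j), depending on x and y modulo 3, and their cross terms cancel. *)
Lemma coef_cE (p : nat) (x y : int) : prime p -> p%:Z = x ^+ 2 + 2 * y ^+ 2 ->
  (3 < p)%N -> coef_c p = 2 * (x ^+ 2 - 2 * y ^+ 2).
Proof.
have cube (z : int) : exists k r, z ^+ 2 = r ^+ 2 + 3 * k /\ (0 <= r < 3) /\ exists q, z = 3 * q + r.
  have [q [r [-> r3]]] := @zmod_cases z 3 isT.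
  exists (3 * q ^+ 2 + 2 * q * r), r; split; first ring.
  by split=> //; exists q; ring.
move=> p_pr.
(* As p is not 0 mod 3, x and y differ mod 3; simultaneous change of signs makes
   the difference 1. *)
wlog : x y / exists m, x - y = 3 * m + 1.
  move=> H pE p3.
  have [k [r [kE [r3 [q qE]]]]] := cube x; have [l [s [lE [s3 [t tE]]]]] := cube y.
  have rs : r <> s.
    move=> rs; apply: (@prime_neq_mul p 3 (r ^+ 2 + k + 2 * l) p_pr) => //.
    by rewrite pE kE lE -rs; ring.
  have [E|E] : (r = s + 1 \/ r = s - 2) \/ (r = s + 2 \/ r = s - 1) by lia.
    by apply: (H x y) => //; case: E => E; [exists (q - t) | exists (q - t - 1)]; lia.
  rewrite -(sqrrN x) -(sqrrN y); apply: (H (- x) (- y)); rewrite ?sqrrN //.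
  by case: E => E; [exists (t - q - 1) | exists (t - q)]; lia.
case=> m mE pE p3.
have y0 : y != 0.
  by apply/eqP => y0; apply: (@prime_neq_sqr p x p_pr); rewrite pE y0; ring.
have x0 : x != 0.
  apply/eqP => x0; apply: (@prime_neq_mul p 2 (y ^+ 2) p_pr); first by lia.
  by rewrite pE x0; ring.
have Ep i j : (1 + i * (3 * i + 2) + 2 * (j * (3 * j + 2)) == p%:Z) =
    (p%:Z == (i + 2 * j + 1) ^+ 2 + 2 * (i - j) ^+ 2).
  rewrite eq_sym; congr (_ == _); ring.
have [x2 y2] := (int_le_sqr x, int_le_sqr y).
have sol i j : 1 + i * (3 * i + 2) + 2 * (j * (3 * j + 2)) == p%:Z ->
    (i + 2 * j + 1 = x \/ i + 2 * j + 1 = - x) /\ (i - j = y \/ i - j = - y).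
  rewrite Ep => /eqP E; have [H|[] //] := form_unique p_pr (isT : 1 <= (2 : int)) pE E.
  split; first exact: sqr_eq_or.
  apply: sqr_eq_or; apply: (mulfI (isT : (2 : int) != 0)).
  by move: pE; rewrite E H => /addrI.
have val (i j X Y : int) : i + 2 * j + 1 = X -> i - j = Y ->
    (3 * i + 1) * (3 * j + 1) = X ^+ 2 + X * Y - 2 * Y ^+ 2.
  by move=> <- <-; ring.
have [z [r [yE r2]]] := @zmod_cases y 3 isT.
have d3 : r = 0 \/ exists z', x = 3 * z'.
  have : r = 0 \/ r = 1 \/ r = 2 by lia.
  case=> [|[r1|r2']]; first by left.
    exfalso; apply: (@prime_neq_mul p 3
      ((z + m) * (3 * (z + m) + 4) + 2 + 2 * (z * (3 * z + 2))) p_pr) => //.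
    by rewrite pE yE r1 (_ : x = 3 * (z + m) + 2); [ring | lia].
  by right; exists (z + m + 1); lia.
case: d3 => [r0|[t tE]].
- rewrite /coef_c (@sum_two _ _ _ _ (m + y, m) (m + z * 2 - y, m + z * 2)) ?zsquare_uniq //=.
  + have e1 := val (m + y) m x y ltac:(lia) ltac:(lia).
    have e2 := val (m + z * 2 - y) (m + z * 2) x (- y) ltac:(lia) ltac:(lia).
    by rewrite e1 e2; ring.
  + by rewrite mem_zsquare !mem_zrange; lia.
  + by rewrite mem_zsquare !mem_zrange; lia.
  + by rewrite Ep pE; apply/eqP; congr (_ ^+ 2 + 2 * _ ^+ 2); lia.
  + by rewrite Ep pE -(sqrrN y); apply/eqP; congr (_ ^+ 2 + 2 * _ ^+ 2); lia.
  + by apply/eqP => -[]; lia.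
  case=> i j _ /= /sol[[Hx|Hx] [Hy|Hy]].
  + by left; congr (_, _); lia.
  + by right; congr (_, _); lia.
  + by exfalso; lia.
  by exfalso; lia.
- rewrite /coef_c (@sum_two _ _ _ _ (m + y, m) (m - 2 * t + y, m - 2 * t)) ?zsquare_uniq //=.
  + have e1 := val (m + y) m x y ltac:(lia) ltac:(lia).
    have e2 := val (m - 2 * t + y) (m - 2 * t) (- x) y ltac:(lia) ltac:(lia).
    by rewrite e1 e2; ring.
  + by rewrite mem_zsquare !mem_zrange; lia.
  + by rewrite mem_zsquare !mem_zrange; lia.
  + by rewrite Ep pE; apply/eqP; congr (_ ^+ 2 + 2 * _ ^+ 2); lia.
  + by rewrite Ep pE -(sqrrN x); apply/eqP; congr (_ ^+ 2 + 2 * _ ^+ 2); lia.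
  + by apply/eqP => -[]; lia.
  case=> i j _ /= /sol[[Hx|Hx] [Hy|Hy]].
  + by left; congr (_, _); lia.
  + by exfalso; lia.
  + by right; congr (_, _); lia.
  by exfalso; lia.
Qed.

Lemma coef_c0 (p : nat) : (p %% 8 = 5)%N \/ (p %% 8 = 7)%N -> coef_c p = 0.
Proof.
move=> p8; rewrite /coef_c big1_seq // => -[i j] /andP[/= /eqP E _]; exfalso.
have sq8 (X : int) : exists n, [\/ X ^+ 2 = 8 * n, X ^+ 2 = 8 * n + 1 | X ^+ 2 = 8 * n + 4].
  have [q [r [-> r4]]] := @zmod_cases X 4 isT.
  have : r = 0 \/ r = 1 \/ r = 2 \/ r = 3 by lia.
  case=> [|[|[|] ] ] ->; [exists (2 * q ^+ 2)|exists (2 * q ^+ 2 + q)|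
    exists (2 * q ^+ 2 + 2 * q)|exists (2 * q ^+ 2 + 3 * q + 1)].
  - by constructor 1; ring.
  - by constructor 2; ring.
  - by constructor 3; ring.
  by constructor 2; ring.
have {}E : p%:Z = (i + 2 * j + 1) ^+ 2 + 2 * (i - j) ^+ 2 by rewrite -E; ring.
have [n nE] := sq8 (i + 2 * j + 1); have [m mE] := sq8 (i - j).
by case: p8 => p8; case: nE => nE; case: mE => mE; rewrite nE mE in E; lia.
Qed.

(** * Gaussian binomials and polynomials modulo a power of X *)

Section QBinomial.
Variables (S : comPzRingType) (q : S).

(** Defined by the q-Pascal recurrence, hence without division, in any ring. *)
Fixpoint qbin (n k : nat) : S :=
  match n, k with
  | _, 0%N => 1
  | 0%N, _.+1 => 0
  | n'.+1, k'.+1 => qbin n' k' + q ^+ k'.+1 * qbin n' k'.+1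
  end.

Lemma qbin0 n : qbin n 0 = 1. Proof. by case: n. Qed.

Lemma qbin_small n k : (n < k)%N -> qbin n k = 0.
Proof.
elim: n k => [|n IH] [|k] //= nk.
by rewrite !IH ?mulr0 ?addr0 // ltnW.
Qed.

Definition euler (n : nat) : S := \prod_(i < n) (1 - q ^+ i.+1).

Lemma eulerS n : euler n.+1 = euler n * (1 - q ^+ n.+1).
Proof. by rewrite /euler big_ord_recr. Qed.

Lemma qbin_euler n k : (k <= n)%N -> qbin n k * (euler k * euler (n - k)) = euler n.
Proof.
elim: n k => [|n IH] [|k] //; rewrite ?qbin0 /euler ?big_ord0 ?subn0 ?mul1r //.
rewrite -!/(euler _) ltnS subSS => kn /=; rewrite mulrDl eulerS.
have [kn'|nk] := ltnP k n; last first.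
  have -> : k = n by apply/eqP; rewrite eqn_leq kn.
  rewrite (qbin_small (ltnSn n)) mulr0 mul0r addr0 [RHS]eulerS.
  by rewrite -[X in _ = X * _](IH n (leqnn n)); ring.
have -> : euler (n - k) = euler (n - k.+1) * (1 - q ^+ (n - k)).
  by rewrite -(subnSK kn') eulerS.
transitivity ((1 - q ^+ k.+1) * (qbin n k * (euler k * (euler (n - k.+1) * (1 - q ^+ (n - k)))))
  + q ^+ k.+1 * (1 - q ^+ (n - k)) *
    (qbin n k.+1 * ((euler k * (1 - q ^+ k.+1)) * euler (n - k.+1)))); first ring.
have -> : euler (n - k.+1) * (1 - q ^+ (n - k)) = euler (n - k).
  by rewrite -(subnSK kn') eulerS.
rewrite -eulerS !IH // [RHS]eulerS.
have -> : q ^+ n.+1 = q ^+ k.+1 * q ^+ (n - k) by rewrite -exprD addSn subnKC.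
ring.
Qed.

(** The homogeneous form of the theorem can be evaluated at x, y powers of q, or at
    y an indeterminate, without inverting anything. *)
Lemma qbinomial (x y : S) M : \prod_(j < M) (y + x * q ^+ j) =
  \sum_(k < M.+1) q ^+ 'C(k, 2) * qbin M k * x ^+ k * y ^+ (M - k).
Proof.
elim: M x => [|M IH] x; first by rewrite big_ord0 big_ord1 !expr0 !mulr1.
rewrite big_ord_recl expr0 mulr1.
under eq_bigr => j _ do rewrite exprS mulrA.
rewrite IH mulrDl !mulr_sumr [X in X + _ = _]big_ord_recl [RHS]big_ord_recl /=.
rewrite [X in _ + X = _]big_ord_recr [X in _ = _ + X]big_ord_recr /=.
rewrite !qbin0 !expr0 !subn0 !mulr1 !mul1r -exprS -!addrA; congr (_ + _).
rewrite addrA -big_split /=; congr (_ + _).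
  apply: eq_bigr => k _; rewrite /bump /= add1n subSS binS bin1.
  have -> : (M - k = (M - k.+1).+1)%N by rewrite subnSK.
  rewrite !add0n exprD !exprS !exprMn; ring.
rewrite /bump /= !add1n !add0n (qbin_small (ltnSn M)) mulr0 addr0 !subnn binS bin1.
rewrite exprD !exprS exprMn; ring.
Qed.

End QBinomial.

Lemma rmorph_qbin (S T : comPzRingType) (f : {rmorphism S -> T}) q n k :
  f (qbin q n k) = qbin (f q) n k.
Proof.
elim: n k => [|n IH] [|k] /=; rewrite ?rmorph1 ?rmorph0 //.
by rewrite rmorphD rmorphM rmorphXn !IH.
Qed.

Arguments qbin : simpl never.

Section Truncation.

(** Equality of power series modulo X^L. *)
Definition eqm (L : nat) (a b : {poly int}) := forall i, (i < L)%N -> a`_i = b`_i.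

Lemma eqm_refl L a : eqm L a a. Proof. by []. Qed.
Lemma eqm_sym L a b : eqm L a b -> eqm L b a. Proof. by move=> H i /H. Qed.
Lemma eqm_trans L b a c : eqm L a b -> eqm L b c -> eqm L a c.
Proof. by move=> H K i iL; rewrite H // K. Qed.
Lemma eqm_le L M a b : (L <= M)%N -> eqm M a b -> eqm L a b.
Proof. by move=> LM H i iL; apply: H; exact: leq_trans LM. Qed.

Lemma eqm_sum L (I : Type) (r : seq I) (P : pred I) (f h : I -> {poly int}) :
  (forall i, P i -> eqm L (f i) (h i)) ->
  eqm L (\sum_(i <- r | P i) f i) (\sum_(i <- r | P i) h i).
Proof. by move=> H i iL; rewrite !coef_sum; apply: eq_bigr => j /H ->. Qed.

Lemma eqm_mul L a b c d : eqm L a b -> eqm L c d -> eqm L (a * c) (b * d).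
Proof.
move=> H K i iL; rewrite !coefM; apply: eq_bigr => j _.
rewrite H ?K //; first exact: leq_ltn_trans (leq_subr _ _) iL.
by apply: leq_ltn_trans iL; rewrite -ltnS.
Qed.

Lemma eqm_exp L a b n : eqm L a b -> eqm L (a ^+ n) (b ^+ n).
Proof. by move=> H; elim: n => [|n IH]; rewrite ?expr0 // !exprS; apply: eqm_mul. Qed.

Lemma eqmP L a b : eqm L a b <-> exists r, a = b + r * 'X^L.
Proof.
split=> [H|[r ->] i iL]; last by rewrite coefD coefMXn iL addr0.
exists (drop_poly L (a - b)); apply/eqP; rewrite addrC -subr_eq; apply/eqP.
rewrite -{1}(poly_take_drop L (a - b)) -[RHS]add0r; congr (_ + _).
apply/polyP => i; rewrite coef_take_poly coef0; case: ifP => // iL.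
by rewrite coefB H // subrr.
Qed.

Lemma eqm_comp L a b d : (0 < d)%N -> eqm L a b -> eqm L (a \Po 'X^d) (b \Po 'X^d).
Proof.
move=> d0 /eqmP[r ->]; apply: (@eqm_le _ (d * L)); first exact: leq_pmull.
apply/eqmP; exists (r \Po 'X^d).
by rewrite comp_polyD comp_polyM comp_Xn_poly -exprM.
Qed.

Lemma eqm_mulXn L e a b : eqm L a b -> eqm (e + L) ('X^e * a) ('X^e * b).
Proof. by move=> /eqmP[r ->]; apply/eqmP; exists r; rewrite mulrDr exprD; ring. Qed.

(** Power series with constant term 1 are invertible. *)
Lemma eqm_cancel L (c a b : {poly int}) : c`_0 = 1 -> eqm L (c * a) (c * b) -> eqm L a b.
Proof.
move=> c0 H i; elim/ltn_ind: i => i IH iL.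
have := H i iL; rewrite !coefM !big_ord_recl /= c0 !mul1r !subn0.
rewrite (eq_bigr (fun j : 'I_i => c`_(lift ord0 j) * b`_(i - lift ord0 j))); last first.
  move=> j _; rewrite IH //; first by rewrite /= /bump /= ltn_subrL (leq_ltn_trans _ (ltn_ord j)).
  exact: leq_ltn_trans (leq_subr _ _) iL.
by move/addIr.
Qed.

Lemma euler_coef0 n d : (0 < d)%N -> (euler ('X^d : {poly int}) n)`_0 = 1.
Proof.
move=> d0; elim: n => [|n IH]; first by rewrite /euler big_ord0 coef1.
rewrite eulerS coefM big_ord1 IH mul1r coefB coef1 -exprM coefXn.
by rewrite (_ : (0 == d * n.+1)%N = false) ?subr0 //; lia.
Qed.

Lemma euler_stable n m d : (n <= m)%N ->
  eqm (d * n.+1) (euler ('X^d : {poly int}) m) (euler 'X^d n).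
Proof.
move=> nm; rewrite -(subnKC nm); elim: (m - n)%N => [|k IH]; first by rewrite addn0.
rewrite addnS eulerS; apply: (eqm_trans (b := euler 'X^d (n + k) * 1)); last by rewrite mulr1.
apply: eqm_mul => // i iL; rewrite coefB -exprM coefXn.
rewrite ltn_eqF ?subr0 //; apply: leq_trans iL _.
by rewrite leq_mul2l ltnS leq_addr orbT.
Qed.

(** Gaussian binomials tend to 1/(q;q) away from the ends. *)
Lemma qbin_limit n k m d : (0 < d)%N -> (m <= k)%N -> (m <= n - k)%N -> (k <= n)%N ->
  eqm (d * m.+1) (qbin ('X^d : {poly int}) n k * euler 'X^d m) 1.
Proof.
move=> d0 mk mnk kn; apply: (@eqm_cancel _ (euler 'X^d m)); first exact: euler_coef0.
rewrite mulr1; apply: (eqm_trans (b := euler 'X^d n)); last first.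
  by apply: euler_stable; exact: leq_trans kn.
rewrite -(qbin_euler _ kn) mulrCA; apply: eqm_mul => //.
by apply: eqm_mul; apply: eqm_sym; exact: euler_stable.
Qed.

End Truncation.

(** * Theta series from the q-binomial theorem *)

Lemma sum_bij (T U : eqType) (r : seq T) (s : seq U) (P : pred T) (Q : pred U)
    (h : T -> U) (g : U -> T) (f : T -> int) (k : U -> int) :
  uniq r -> uniq s ->
  (forall x, x \in r -> P x -> [/\ h x \in s, Q (h x), g (h x) = x & f x = k (h x)]) ->
  (forall y, y \in s -> Q y -> [/\ g y \in r, P (g y) & h (g y) = y]) ->
  \sum_(x <- r | P x) f x = \sum_(y <- s | Q y) k y.
Proof.
move=> ur us H K; rewrite -big_filter -[RHS]big_filter.
transitivity (\sum_(x <- [seq x <- r | P x]) k (h x)).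
  by rewrite big_seq [RHS]big_seq; apply: eq_bigr => x; rewrite mem_filter => /andP[Px /H[]].
rewrite -(big_map h predT k); apply: perm_big; apply: uniq_perm.
- rewrite map_inj_in_uniq ?filter_uniq // => x y.
  rewrite !mem_filter => /andP[Px xr] /andP[Py yr] E.
  by have [_ _ <- _] := H x xr Px; have [_ _ <- _] := H y yr Py; rewrite E.
- exact: filter_uniq.
move=> y; rewrite mem_filter; apply/mapP/andP => [[x]|[Qy ys]].
  by rewrite mem_filter => /andP[Px xr] ->; have [? ? _ _] := H x xr Px.
by have [gr Pg hg] := K y ys Qy; exists (g y); rewrite ?hg // mem_filter Pg.
Qed.

Definition zsg (t : int) : int := (-1) ^+ absz t.

Lemma zsgB (k n : nat) : zsg (k%:Z - n%:Z) = (-1) ^+ k * (-1) ^+ n.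
Proof.
rewrite /zsg -exprD -signr_odd -[RHS]signr_odd oddD; congr (_ ^+ nat_of_bool _); lia.
Qed.

Lemma zsg_even t : zsg (2 * t) = 1.
Proof. by rewrite /zsg -signr_odd (_ : odd _ = false) //; lia. Qed.

Lemma zsg_odd t : zsg (2 * t + 1) = -1.
Proof. by rewrite /zsg -signr_odd (_ : odd _ = true) //; lia. Qed.

(** A theta series sum_t w(t) X^e(t), truncated to |t| <= L. *)
Definition gen (L : nat) (w e : int -> int) : {poly int} :=
  \sum_(t <- zrange L) (w t)%:P * 'X^(absz (e t)).

Lemma zrange_sum (V : nmodType) L (f : int -> V) :
  \sum_(t <- zrange L) f t = \sum_(k < 2 * L + 1) f (k%:Z - L%:Z).
Proof. by rewrite -(big_mkord xpredT (fun k : nat => f (k%:Z - L%:Z))) /index_iota subn0 big_map. Qed.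

Lemma coef_gen L w e i : (forall t, 0 <= e t) ->
  (gen L w e)`_i = \sum_(t <- zrange L | e t == i%:Z) w t.
Proof.
move=> e0; rewrite coef_sum [RHS]big_mkcond; apply: eq_bigr => t _.
rewrite coefCM coefXn (_ : (i == _) = (e t == i%:Z)); last by have := e0 t; lia.
by case: ifP; rewrite ?mulr1 ?mulr0.
Qed.

Lemma coef_genM L M w e v f i : (forall t, 0 <= e t) -> (forall t, 0 <= f t) ->
  (gen L w e * gen M v f)`_i =
  \sum_(x <- [seq (s, t) | s <- zrange L, t <- zrange M] | e x.1 + f x.2 == i%:Z)
    w x.1 * v x.2.
Proof.
move=> e0 f0; rewrite [RHS]big_mkcond big_allpairs_dep /= /gen mulr_suml coef_sum.
apply: eq_bigr => s _; rewrite mulr_sumr coef_sum; apply: eq_bigr => t _.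
rewrite mulrACA -polyCM -exprD coefCM coefXn.
rewrite (_ : (i == _) = (e s + f t == i%:Z)); last by have := e0 s; have := f0 t; lia.
by case: ifP; rewrite ?mulr1 ?mulr0.
Qed.

Lemma gen_comp L w e d : gen L w e \Po 'X^d = gen L w (fun t => e t * d%:Z).
Proof.
rewrite /gen raddf_sum; apply: eq_bigr => t _ /=.
by rewrite comp_polyM comp_polyC comp_Xn_poly -exprM abszM mulnC.
Qed.

Lemma euler_comp n d : euler ('X : {poly int}) n \Po 'X^d = euler 'X^d n.
Proof.
rewrite /euler rmorph_prod; apply: eq_bigr => i _ /=.
by rewrite comp_polyB comp_polyC comp_Xn_poly.
Qed.

Lemma qbin_limit_le n k m N d : (0 < d)%N -> (m <= k)%N -> (m <= n - k)%N -> (k <= n)%N ->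
  (m <= N)%N -> eqm (d * m.+1) (qbin ('X^d : {poly int}) n k * euler 'X^d N) 1.
Proof.
move=> d0 mk mnk kn mN; apply: eqm_trans (qbin_limit d0 mk mnk kn).
by apply: eqm_mul => //; exact: euler_stable.
Qed.

Lemma theta_exponent_ge0 A B (e : int -> int) t : (B <= A)%N ->
  (forall t, 2 * e t = A%:Z * (t * (t - 1)) + 2 * B%:Z * t) -> 0 <= e t.
Proof.
move=> BA /(_ t) eE; suff : 0 <= 2 * e t by lia.
rewrite eE; have [->|[t0|t0]] : t = 0 \/ 1 <= t \/ t <= -1 by lia.
- by rewrite mul0r !mulr0.
- by rewrite addr_ge0 // mulr_ge0 // ?mulr_ge0 //; lia.
have -> : A%:Z * (t * (t - 1)) + 2 * B%:Z * t =
  A%:Z * (t * (t + 1)) + 2 * (A%:Z - B%:Z) * - t by ring.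
by rewrite addr_ge0 // mulr_ge0 //; try lia; nia.
Qed.

(** The q-binomial theorem with q = X^A, x = -1, y = X^(An - B) and 2n factors,
    divided by a monomial: the first n factors give the exponents A(i+1) - B and the
    last n the exponents A i + B. *)
Lemma finite_theta A B n (e : int -> int) : (0 < B < A)%N ->
  (forall t, 2 * e t = A%:Z * (t * (t - 1)) + 2 * B%:Z * t) ->
  \prod_(i < n) ((1 - 'X^(A * i.+1 - B)) * (1 - 'X^(A * i + B))) =
  \sum_(t <- zrange n) (zsg t)%:P * 'X^(absz (e t)) *
     qbin ('X^A : {poly int}) (2 * n) (absz (t + n%:Z)).
Proof.
move=> /andP[B0 BA] eE.
pose c : {poly int} := 'X^(A * 'C(n, 2) + n * (A * n - B)).
have c0 : c != 0 by rewrite expf_neq0 // polyX_eq0.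
have s0 : (-1) ^+ n != 0 :> {poly int} by rewrite signr_eq0.
apply: (mulfI c0); apply: (mulfI s0).
transitivity (\prod_(j < n + n) ('X^(A * n - B) + (-1) * ('X^A : {poly int}) ^+ j)).
  rewrite big_split_ord /= big_split /= [in LHS](reindex_inj rev_ord_inj) /=.
  have -> : \prod_(i < n) ('X^(A * n - B) + -1 * ('X^A : {poly int}) ^+ i) =
      (-1) ^+ n * 'X^(A * 'C(n, 2)) * \prod_(i < n) (1 - 'X^(A * (n - i.+1).+1 - B)).
    have -> : 'X^(A * 'C(n, 2)) = \prod_(i < n) ('X^(A * i) : {poly int}).
      by rewrite -expr_sum -big_distrr /= -bin2_sum big_mkord.
    rewrite -[in (-1) ^+ n](card_ord n) -prodr_const -!big_split /=.
    apply: eq_bigr => i _; have ni := ltn_ord i.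
    have -> : 'X^(A * n - B) = 'X^(A * i) * 'X^(A * (n - i.+1).+1 - B) :> {poly int}.
      by rewrite -exprD; congr (_ ^+ _); rewrite subnSK //; nia.
    rewrite -exprM; ring.
  have -> : \prod_(i < n) ('X^(A * n - B) + -1 * ('X^A : {poly int}) ^+ (n + i)) =
      'X^(n * (A * n - B)) * \prod_(i < n) (1 - 'X^(A * i + B)).
    have -> : 'X^(n * (A * n - B)) = \prod_(i < n) ('X^(A * n - B) : {poly int}).
      by rewrite prodr_const card_ord -exprM mulnC.
    rewrite -big_split /=; apply: eq_bigr => i _.
    rewrite mulrBr mulr1 -exprD -exprM mulN1r; congr (_ - 'X^_).
    have ni := ltn_ord i; have : (B <= A * n)%N by nia.
    by rewrite mulnDr; lia.
  by rewrite /c exprD; ring.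
rewrite qbinomial addnn -mul2n zrange_sum addn1 !mulr_sumr; apply: eq_bigr => k _.
have kn := ltn_ord k; rewrite subrK zsgB polyCM !polyC_exp polyCN polyC1.
rewrite absz_nat.
transitivity ((-1) ^+ k * ('X^(A * 'C(k, 2)) * 'X^((A * n - B) * (2 * n - k))) *
   qbin ('X^A : {poly int}) (2 * n) k); first by rewrite -!exprM; ring.
rewrite -exprD; have -> : (A * 'C(k, 2) + (A * n - B) * (2 * n - k) =
   A * 'C(n, 2) + n * (A * n - B) + absz (e (k%:Z - n%:Z)%R))%N.
  have e0 : 0 <= e (k%:Z - n%:Z) by exact: (@theta_exponent_ge0 A B e _ (ltnW BA) eE).
  have bin2Z m : A%:Z * (2 * 'C(m, 2)%:Z) = A%:Z * (m%:Z * (m%:Z - 1)).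
    by congr (_ * _); have := mul_bin_diag m 1; rewrite bin1; case: m => //= m; lia.
  have := bin2Z k; have := bin2Z n; move: (eE (k%:Z - n%:Z)).
  have : (B <= A * n)%N \/ (n = 0)%N by nia.
  case=> [BAn|n0]; last first.
    have k0 : nat_of_ord k = 0%N by lia.
    rewrite k0 n0 subrr => H _ _; have -> : e 0 = 0 by have := eE 0; rewrite mul0r !mulr0; lia.
    by rewrite !muln0.
  have : ((A * n - B) * (2 * n - k))%N%:Z = (A%:Z * n%:Z - B%:Z) * (2 * n%:Z - k%:Z).
    rewrite PoszM -!subzn //; lia.
  have : (n * (A * n - B))%N%:Z = n%:Z * (A%:Z * n%:Z - B%:Z) by rewrite PoszM -subzn //; lia.
  move: ((A * n - B) * (2 * n - k))%N (n * (A * n - B))%N (e _) e0 'C(k, 2) 'C(n, 2) => u v w w0 ck cn.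
  lia.
rewrite exprD -/c; transitivity (((-1) ^+ n * (-1) ^+ n) * ((-1) ^+ k * (c * 'X^(absz (e (k%:Z - n%:Z)%R))) *
   qbin ('X^A : {poly int}) (2 * n) k)); last ring.
by rewrite -exprD addnn -mul2n exprM sqrrN !expr1n mul1r.
Qed.

Lemma eqm_sum_seq L (I : eqType) (r : seq I) (f h : I -> {poly int}) :
  (forall i, i \in r -> eqm L (f i) (h i)) ->
  eqm L (\sum_(i <- r) f i) (\sum_(i <- r) h i).
Proof. by move=> H; rewrite big_seq [X in eqm L _ X]big_seq; apply: eqm_sum. Qed.

Lemma theta_exponent_ge A B (e : int -> int) t : (B <= A)%N ->
  (forall t, 2 * e t = A%:Z * (t * (t - 1)) + 2 * B%:Z * t) ->
  A%:Z * (`|t| - 1) <= e t.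
Proof.
move=> BA eE.
suff : 2 * (A%:Z * (`|t| - 1)) <= 2 * e t by lia.
rewrite eE; have [->|[t0|t0]] : t = 0 \/ 1 <= t \/ t <= -1 by lia.
- by rewrite normr0; lia.
- rewrite ger0_norm; last lia.
  rewrite -subr_ge0 (_ : _ - _ = A%:Z * ((t - 1) * (t - 2)) + 2 * B%:Z * t); last ring.
  rewrite addr_ge0 // mulr_ge0 //; try lia.
  have [->|t2] : t = 1 \/ 2 <= t by lia.
    by rewrite subrr mul0r.
  by rewrite mulr_ge0 //; lia.
- rewrite ler0_norm; last lia.
  rewrite -subr_ge0 (_ : _ - _ = A%:Z * ((t + 1) * (t + 2)) + 2 * (A%:Z - B%:Z) * (- t)); last ring.
  rewrite addr_ge0 // mulr_ge0 //; try lia.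
  have [->|t2] : t = -1 \/ t <= -2 by lia.
    by [].
  by rewrite -mulrNN mulr_ge0 //; lia.
Qed.

(** A finite form of Jacobi's triple product.  The error in the t-th term has order
    e(t) + A (n - |t| + 1), which is at least n because e grows quadratically. *)
Lemma theta_limit A B n (e : int -> int) : (0 < B < A)%N ->
  (forall t, 2 * e t = A%:Z * (t * (t - 1)) + 2 * B%:Z * t) ->
  eqm n (euler 'X^A n * \prod_(i < n) ((1 - 'X^(A * i.+1 - B)) * (1 - 'X^(A * i + B))))
    (gen n zsg e).
Proof.
move=> AB eE; rewrite (@finite_theta A B n e AB eE) mulr_sumr /gen; have /andP[B0 BA] := AB.
apply: eqm_sum_seq => t; rewrite mem_zrange => tn.
have e0 : 0 <= e t by exact: (@theta_exponent_ge0 A B e _ (ltnW BA) eE).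
(* The distance of n + t to the ends of the range of the Gaussian binomial. *)
pose m := (n - absz t)%N.
apply: (@eqm_le _ (absz (e t) + A * m.+1)).
  have eA := @theta_exponent_ge A B e t (ltnW BA) eE.
  have mE : m%:Z = n%:Z - `|t| by rewrite /m; lia.
  suff : n%:Z <= e t + A%:Z * (m%:Z + 1) by nia.
  have -> : e t + A%:Z * (m%:Z + 1) = e t - A%:Z * (`|t| - 1) + A%:Z * n%:Z by rewrite mE; ring.
  nia.
rewrite (_ : euler 'X^A n * _ = 'X^(absz (e t)) * ((zsg t)%:P *
   (qbin 'X^A (2 * n) (absz (t + n%:Z)) * euler 'X^A n))); last ring.
rewrite [X in eqm _ _ X]mulrC; apply: eqm_mulXn; rewrite -[X in eqm _ _ X]mulr1; apply: eqm_mul => //.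
by apply: qbin_limit_le; rewrite /m; lia.
Qed.

Lemma euler_double n : euler ('X : {poly int}) (2 * n) =
  euler 'X^2 n * \prod_(i < n) (1 - 'X^(2 * i + 1)).
Proof.
elim: n => [|n IH]; first by rewrite /euler !big_ord0 mulr1.
rewrite (_ : (2 * n.+1 = (2 * n).+2)%N); last by rewrite mulnS.
rewrite 2![in LHS]eulerS IH big_ord_recr eulerS -exprM /=.
by rewrite (_ : (2 * n.+1 = (2 * n).+2)%N) ?addn1; [ring | lia].
Qed.

Lemma euler_triple n : euler ('X^4 : {poly int}) (3 * n) =
  euler 'X^12 n * \prod_(i < n) ((1 - 'X^(12 * i.+1 - 8)) * (1 - 'X^(12 * i + 8))).
Proof.
elim: n => [|n IH]; first by rewrite /euler !big_ord0 mulr1.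
rewrite (_ : (3 * n.+1 = (3 * n).+3)%N); last by rewrite mulnS.
rewrite 3![in LHS]eulerS IH big_ord_recr eulerS -!exprM /=.
rewrite (_ : (4 * (3 * n).+1 = 12 * n.+1 - 8)%N); last lia.
rewrite (_ : (4 * (3 * n).+2 = 12 * n + 8)%N); last lia.
rewrite (_ : (4 * (3 * n).+3 = 12 * n.+1)%N); last lia.
ring.
Qed.

(** Gauss' identity sum (-1)^t X^(t^2) = E(X)^2 / E(X^2): the case A = 2, B = 1 of the
    triple product. *)
Lemma theta_square n :
  eqm n (euler 'X^2 n * gen n zsg (fun t => t ^+ 2)) (euler 'X n ^+ 2).
Proof.
apply: (eqm_trans (b := euler 'X (2 * n) ^+ 2)); last first.
  apply: eqm_exp; apply: (@eqm_le _ (1 * n.+1)); first by rewrite mul1n.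
  by rewrite -['X]/('X^1); apply: euler_stable; lia.
have H := @theta_limit 2 1 n (fun t => t ^+ 2) isT ltac:(by move=> t; rewrite /= expr2; lia).
apply: (eqm_trans (eqm_mul (@eqm_refl n (euler 'X^2 n)) (eqm_sym H))).
rewrite euler_double big_split /=.
have -> : \prod_(i < n) (1 - 'X^(2 * i.+1 - 1)) = \prod_(i < n) (1 - 'X^(2 * i + 1)) :> {poly int}.
  by apply: eq_bigr => i _; congr (1 - 'X^_); lia.
move: (euler 'X^2 n) (\prod_(i < n) _) => E P.
by have -> : E * (E * (P * P)) = (E * P) ^+ 2 by ring.
Qed.

(** Euler's pentagonal number theorem in the variable X^4, so that the exponents are
    polynomials in t: the case A = 12, B = 8 of the triple product. *)
Lemma pentagonal4 n :
  eqm n (euler 'X^4 n) (gen n zsg (fun t => 6 * t ^+ 2 + 2 * t)).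
Proof.
apply: (eqm_trans (b := euler 'X^4 (3 * n))).
  by apply/eqm_sym; apply: (@eqm_le _ (4 * n.+1)); [lia | apply: euler_stable; lia].
rewrite euler_triple; apply: theta_limit => // t; rewrite /= expr2; lia.
Qed.

(** * The cube of the Euler product *)

Lemma deriv_at_root (S : comNzRingType) (p : {poly S}) a :
  (('X - a%:P) * p)^`().[a] = p.[a].
Proof. by rewrite derivM derivXsubC mul1r hornerD hornerM hornerXsubC subrr mul0r addr0. Qed.

(** Dividing the q-binomial theorem by a vanishing factor: with 2n + 1 factors
    y - X^j, the derivative in y at its root y = X^n is the product of the other
    factors, up to sign a monomial times (X;X)_n^2. *)
Lemma finite_jacobi n (e : int -> int) : (forall t, 2 * e t = t * (t - 1)) ->
  euler 'X n ^+ 2 = \sum_(t <- zrange n) (zsg t * (n%:Z + 1 - t))%:P * 'X^(absz (e t)) *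
     qbin ('X : {poly int}) (2 * n).+1 (absz (t + n%:Z)).
Proof.
move=> eE.
pose c : {poly int} := 'X^('C(n, 2) + n * n).
have c0 : c != 0 by rewrite expf_neq0 // polyX_eq0.
have s0 : (-1) ^+ n != 0 :> {poly int} by rewrite signr_eq0.
apply: (mulfI c0); apply: (mulfI s0).
pose F : {poly {poly int}} := \prod_(j < (2 * n).+1) ('X + (-1) * (('X : {poly int})%:P) ^+ j).
transitivity (F^`().['X^n]).
  have -> : F = ('X - ('X^n)%:P) * (\prod_(i < n) ('X - ('X^i)%:P) * \prod_(i < n) ('X - ('X^(n + i.+1))%:P)).
    rewrite /F (_ : (2 * n).+1 = (n + n.+1)%N); last by rewrite addnS addnn mul2n.
    rewrite big_split_ord /= big_ord_recl /= mulrCA addn0.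
    congr (_ * (_ * _)); rewrite ?mulN1r -?polyC_exp //.
      by apply: eq_bigr => i _; rewrite mulN1r polyC_exp.
    by apply: eq_bigr => i _; rewrite mulN1r polyC_exp.
  rewrite deriv_at_root hornerM !horner_prod.
  have -> : \prod_(i < n) ('X - ('X^i)%:P).['X^n] = (-1) ^+ n * 'X^('C(n, 2)) * euler ('X : {poly int}) n.
    have -> : 'X^('C(n, 2)) = \prod_(i < n) ('X^i : {poly int}).
      by rewrite -expr_sum -bin2_sum big_mkord.
    rewrite -[in (-1) ^+ n](card_ord n) -prodr_const /euler [X in _ * X](reindex_inj rev_ord_inj).
    rewrite -!big_split /=; apply: eq_bigr => i _; rewrite hornerXsubC.
    rewrite -{1}(subnKC (ltnW (ltn_ord i))) exprD subnSK ?ltn_ord //; ring.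
  have -> : \prod_(i < n) ('X - ('X^(n + i.+1))%:P).['X^n] = 'X^(n * n) * euler ('X : {poly int}) n.
    have -> : 'X^(n * n) = \prod_(i < n) ('X^n : {poly int}) by rewrite prodr_const card_ord exprM.
    rewrite /euler -big_split /=.
    by apply: eq_bigr => i _; rewrite hornerXsubC exprD; ring.
  rewrite /c exprD; ring.
have tE k : (('X : {poly int})%:P) ^+ 'C(k, 2) * qbin (('X : {poly int})%:P) (2 * n).+1 k * (-1) ^+ k =
    ('X^('C(k, 2)) * qbin 'X (2 * n).+1 k * (-1) ^+ k)%:P.
  by rewrite !rmorphM rmorph_qbin !rmorphXn rmorphN1.
have dE k m : ((('X : {poly int})%:P) ^+ 'C(k, 2) * qbin (('X : {poly int})%:P) (2 * n).+1 k *
      (-1) ^+ k * 'X^m)^`().['X^n] =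
    ('X^('C(k, 2)) * qbin 'X (2 * n).+1 k * (-1) ^+ k) * ('X^(n * m.-1) *+ m).
  by rewrite tE mul_polyC derivZ hornerZ derivXn hornerMn hornerXn exprM.
rewrite /F qbinomial raddf_sum horner_sum big_ord_recr /= !dE subnn mulr0n mulr0 addr0.
rewrite zrange_sum addn1 !mulr_sumr; apply: eq_bigr => k _; rewrite dE.
have kn := ltn_ord k; rewrite subrK zsgB absz_nat.
have -> : (n%:Z + 1 - (k%:Z - n%:Z)) = ((2 * n).+1 - k)%N%:Z by lia.
have E : ('C(k, 2) + n * (2 * n - k) = 'C(n, 2) + n * n + absz (e (k%:Z - n%:Z)%R))%N.
  have e0 : 0 <= e (k%:Z - n%:Z).
    by apply: (@theta_exponent_ge0 1 0 e _ isT) => t; rewrite eE; ring.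
  have bin2Z m : 2 * 'C(m, 2)%:Z = m%:Z * (m%:Z - 1).
    by have := mul_bin_diag m 1; rewrite bin1; case: m => //= m; lia.
  have := bin2Z k; have := bin2Z n; move: (eE (k%:Z - n%:Z)).
  have : (n * (2 * n - k))%N%:Z = n%:Z * (2 * n%:Z - k%:Z) by rewrite PoszM -subzn //; lia.
  move: (n * (2 * n - k))%N (e _) e0 'C(k, 2) 'C(n, 2) => u w w0 ck cn; lia.
rewrite subSn // -mulr_natr succnK.
transitivity ('X^('C(k, 2) + n * (2 * n - k)) * qbin 'X (2 * n).+1 k * (-1) ^+ k *
    (2 * n - k).+1%:R : {poly int}); first by rewrite exprD; ring.
have polyC_nat m : (m%:Z)%:P = m%:R :> {poly int} by rewrite -natz rmorph_nat.
rewrite E exprD -/c !polyCM !polyC_exp polyCN polyC1 polyC_nat.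
transitivity (((-1) ^+ n * (-1) ^+ n) * (c * 'X^(absz (e (k%:Z - n%:Z)%R)) * qbin 'X (2 * n).+1 k * (-1) ^+ k *
    (2 * n - k).+1%:R : {poly int})); last ring.
by rewrite -exprD addnn -mul2n exprM sqrrN !expr1n mul1r.
Qed.

Lemma parity_cases (t : int) : if odd (absz t) then exists s, t = 2 * s + 1 else exists s, t = 2 * s.
Proof.
case: ifP => ot; [exists ((t - 1) %/ 2)%Z | exists (t %/ 2)%Z]; lia.
Qed.

Lemma tri_bound (u : int) (i : nat) : u * (2 * u + 1) = i%:Z ->
  u = 0 \/ - i%:Z <= 2 * u + 1 <= i%:Z.
Proof.
move=> E; have [->|[u1|u1]] : u = 0 \/ 1 <= u \/ u <= -1 by lia.
- by left.
- by right; rewrite -E; nia.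
by right; rewrite -E; nia.
Qed.

(** In [finite_jacobi] times another Euler product the t-th term becomes
    (-1)^t (n + 1 - t) X^(t(t-1)/2).  The terms t = -2u and t = 2u + 1 have the same
    exponent u(2u + 1), and their sum is free of n. *)
Lemma jacobi n : eqm n (euler 'X n ^+ 3) (gen n (fun t => 4 * t + 1) (fun t => t * (2 * t + 1))).
Proof.
have [e eE] : exists e : int -> int, forall t, 2 * e t = t * (t - 1).
  exists (fun t => (t * (t - 1)) %/ 2)%Z => t; have [k kE] := sqr_parity t.
  have -> : t * (t - 1) = 2 * k by rewrite mulrBr mulr1 -expr2 kE; ring.
  by rewrite mulKz.
have eE' t : 2 * e t = 1%:Z * (t * (t - 1)) + 2 * 0%:Z * t by rewrite eE; ring.
have e0 t : 0 <= e t by exact: (@theta_exponent_ge0 1 0 e t isT eE').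
apply: (eqm_trans (b := gen n (fun t => zsg t * (n%:Z + 1 - t)) e)).
  rewrite exprS (finite_jacobi n eE) mulr_sumr /gen.
  apply: eqm_sum_seq => t; rewrite mem_zrange => tn.
  have eA := @theta_exponent_ge 1 0 e t isT eE'.
  pose m := (n - absz t)%N.
  apply: (@eqm_le _ (absz (e t) + 1 * m.+1)); first by have := e0 t; rewrite /m; lia.
  set w := zsg t * _.
  rewrite (_ : euler 'X n * _ = 'X^(absz (e t)) * (w%:P *
     (qbin 'X^1 (2 * n).+1 (absz (t + n%:Z)) * euler 'X^1 n))); last by rewrite !expr1; ring.
  rewrite [X in eqm _ _ X]mulrC; apply: eqm_mulXn.
  rewrite -[X in eqm _ _ X]mulr1; apply: eqm_mul => //.
  by apply: qbin_limit_le; rewrite /m; lia.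
move=> i iL; rewrite !coef_gen //; last by move=> t; nia.
rewrite (bigID (fun t => odd (absz t))) /=.
rewrite (@sum_bij _ _ _ (zrange n) _ (fun u => u * (2 * u + 1) == i%:Z)
  (fun t => ((t - 1) %/ 2)%Z) (fun u => 2 * u + 1) _ (fun u => 2 * u - n%:Z)) ?zrange_uniq //.
rewrite (@sum_bij _ _ _ (zrange n) (fun t => (e t == i%:Z) && ~~ odd (absz t)) (fun u => u * (2 * u + 1) == i%:Z)
  (fun t => - (t %/ 2)%Z) (fun u => - (2 * u)) _ (fun u => n%:Z + 1 + 2 * u)) ?zrange_uniq //.
- by rewrite -big_split; apply: eq_bigr => u _ /=; ring.
- move=> t; rewrite mem_zrange => tn /andP[/eqP ei ot].
  have := parity_cases t; rewrite (negPf ot) => -[s tE].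
  have := eE t; rewrite ei tE mulKz // mem_zrange zsg_even => E.
  split; [lia | apply/eqP; lia | lia | lia].
- move=> u; rewrite !mem_zrange => un /eqP E.
  split; [have := tri_bound E; lia | | lia..].
  by apply/andP; split; [have := eE (- (2 * u)); lia | lia].
- move=> t; rewrite mem_zrange => tn /andP[/eqP ei ot].
  have := parity_cases t; rewrite ot => -[s tE].
  have := eE t; rewrite ei tE addrK mulKz // mem_zrange zsg_odd => E.
  split; [lia | apply/eqP; lia | lia | lia].
- move=> u; rewrite !mem_zrange => un /eqP E.
  split; [have := tri_bound E; lia | | lia..].
  by apply/andP; split; [have := eE (2 * u + 1); lia | lia].
Qed.

(** * The eta products as double theta series *)

Lemma sum_antisym (T : eqType) (r : seq T) (P : pred T) (h : T -> T) (f : T -> int) :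
  uniq r ->
  (forall x, x \in r -> P x -> [/\ h x \in r, P (h x), h (h x) = x & f (h x) = - f x]) ->
  \sum_(x <- r | P x) f x = 0.
Proof.
move=> ur H; suff : \sum_(x <- r | P x) f x = - \sum_(x <- r | P x) f x by lia.
rewrite -sumrN; apply: (sum_bij (h := h) (g := h)) => // x xr Px; have [? ? ? fh] := H x xr Px => //.
by rewrite fh opprK.
Qed.

Lemma zsg_eq a b : odd (absz a) = odd (absz b) -> zsg a = zsg b.
Proof. by move=> H; rewrite /zsg -signr_odd H signr_odd. Qed.

Lemma zsg_neq a b : odd (absz a) = ~~ odd (absz b) -> zsg a = - zsg b.
Proof. by move=> H; rewrite /zsg -signr_odd H signrN signr_odd. Qed.

(** Comparison of the theta functions of two lattices.  The odd function a of the
    first factor may be added to the weight 4t + 1, as it cancels between a and -a.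
    The new weight s = a + 4t + 1 changes sign under an involution of the points with
    3 | s, the reflection (a, t) -> (a - 2s/3, t - s/3) preserving the exponent.  The
    other points correspond to the pairs (n, k) with s = 3n + 1 or s = -(3n + 1),
    where n + k is even in the first case and odd in the second. *)
Lemma theta_product L :
  eqm L (gen L zsg (fun t => t ^+ 2) *
         gen L (fun t => 4 * t + 1) (fun t => t * (2 * t + 1) * 4))
        (gen L (fun t => 3 * t + 1) (fun t => t * (3 * t + 2)) *
         gen L zsg (fun t => 6 * t ^+ 2 + 2 * t)).
Proof.
have p1 (t : int) : `|t| <= t ^+ 2 by have /andP[] := int_le_sqr t; lia.
have p2 (t : int) : `|t| <= t * (2 * t + 1).
  by rewrite mulrDr mulr1; have := p1 t; rewrite expr2; lia.
have p3 (t : int) : `|t| <= t * (3 * t + 2).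
  by have := p1 t; rewrite expr2; nia.
have p4 (t : int) : `|t| <= 6 * t ^+ 2 + 2 * t.
  by have := p1 t; lia.
move=> i iL; rewrite !coef_genM; try by [move=> t; have := p1 t; have := p2 t; have := p3 t; have := p4 t; lia].
rewrite -!/(zsquare L).
have rg1 a t : a ^+ 2 + t * (2 * t + 1) * 4 = i%:Z -> (a, t) \in zsquare L.
  by move=> E; rewrite mem_zsquare !mem_zrange; have := p1 a; have := p2 t; lia.
have rg2 n k : n * (3 * n + 2) + (6 * k ^+ 2 + 2 * k) = i%:Z -> (n, k) \in zsquare L.
  by move=> E; rewrite mem_zsquare !mem_zrange; have := p3 n; have := p4 k; lia.
pose P (x : int * int) := x.1 ^+ 2 + x.2 * (2 * x.2 + 1) * 4 == i%:Z.
have S0 : \sum_(x <- zsquare L | P x) zsg x.1 * x.1 = 0.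
  apply: (@sum_antisym _ _ _ (fun x => (- x.1, x.2))); first exact: zsquare_uniq.
  move=> [a t] /= _ /eqP /= E; split.
  - by apply: rg1; rewrite sqrrN.
  - by rewrite /P /= sqrrN E.
  - by rewrite opprK.
  by rewrite mulrN (@zsg_eq (- a) a) // abszN.
transitivity (\sum_(x <- zsquare L | P x) zsg x.1 * (4 * x.2 + 1 + x.1)).
  by under [RHS]eq_bigr => x _ do rewrite mulrDr; rewrite big_split /= S0 addr0.
rewrite (bigID (fun x => 3 %| x.1 + 4 * x.2 + 1)%Z) /= (@sum_antisym _ _ _
  (fun x => (x.1 - 2 * ((x.1 + 4 * x.2 + 1) %/ 3)%Z, x.2 - ((x.1 + 4 * x.2 + 1) %/ 3)%Z))).
- rewrite add0r.
  (* For s = 3n + 1 the correspondence is n = a + 2k, t = (n + k)/2, and for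
     s = -(3n + 1) it is n = 2k - a, t = -(n + k + 1)/2. *)
  pose h (x : int * int) : int * int := let s := x.1 + 4 * x.2 + 1 in
    if (s %% 3)%Z == 1 then (((s - 1) %/ 3)%Z, 2 * x.2 - ((s - 1) %/ 3)%Z)
    else (((- s - 1) %/ 3)%Z, - 2 * x.2 - 1 - ((- s - 1) %/ 3)%Z).
  pose g (y : int * int) := if odd (absz (y.1 + y.2))
     then (2 * y.2 - y.1, - ((y.1 + y.2 + 1) %/ 2)%Z)
     else (y.1 - 2 * y.2, ((y.1 + y.2) %/ 2)%Z).
  apply: (@sum_bij _ _ _ _ _ _ h g); rewrite ?zsquare_uniq //.
  + move=> [a t] _ /andP[/eqP /= E s3].
    have [q [r [sE r3]]] := @zmod_cases (a + 4 * t + 1) 3 isT.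
    have [r1|r2] : r = 1 \/ r = 2.
      have : r <> 0 by move=> r0; case/negP: s3; apply/dvdzP; exists q; rewrite sE r0 addr0.
      lia.
    - have aE : a = 3 * q - 4 * t by lia.
      have -> : h (a, t) = (q, 2 * t - q).
        by rewrite /h /= sE r1 (_ : _ == _ = true) ?addrK ?mulzK //; lia.
      have E2 : q * (3 * q + 2) + (6 * (2 * t - q) ^+ 2 + 2 * (2 * t - q)) = i%:Z.
        by rewrite -E aE; ring.
      split; [exact: rg2 | exact/eqP | |].
        rewrite /g /= (_ : odd _ = false); last lia.
        by congr (_, _); [lia | rewrite subrKC mulKz].
      by rewrite /= aE (@zsg_eq (3 * q - 4 * t) (2 * t - q)); [ring | lia].
    - have aE : a = 3 * q + 1 - 4 * t by lia.
      have -> : h (a, t) = (- q - 1, q - 2 * t).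
        rewrite /h /= sE r2 (_ : _ == _ = false); last lia.
        have -> : - (q * 3 + 2) - 1 = (- q - 1) * 3 by lia.
        by rewrite mulzK //; congr (_, _); lia.
      have E2 : (- q - 1) * (3 * (- q - 1) + 2) + (6 * (q - 2 * t) ^+ 2 + 2 * (q - 2 * t)) = i%:Z.
        by rewrite -E aE; ring.
      split; [exact: rg2 | exact/eqP | |].
        rewrite /g /= (_ : odd _ = true); last lia.
        have -> : - q - 1 + (q - 2 * t) + 1 = 2 * - t by lia.
        by rewrite mulKz // opprK; congr (_, _); lia.
      by rewrite /= aE (@zsg_neq (3 * q + 1 - 4 * t) (q - 2 * t)); [ring | lia].
  + move=> [n k] _ /eqP /= E; rewrite /g /=.
    have := parity_cases (n + k); case: ifP => _ [m nk].
    - have nE : n = 2 * m + 1 - k by lia.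
      have -> : n + k + 1 = 2 * (m + 1) by lia.
      rewrite mulKz //.
      have E2 : (2 * k - n) ^+ 2 + - (m + 1) * (2 * - (m + 1) + 1) * 4 = i%:Z.
        by rewrite -E nE; ring.
      have sE : 2 * k - n + 4 * - (m + 1) + 1 = - (3 * n + 1) by lia.
      split; [exact: rg1 | |].
        apply/andP; split; [exact/eqP | apply/negP => /dvdzP[z] /=; lia].
      rewrite /h /= sE (_ : _ == _ = false) ?opprK ?addrK ?mulKz //; last lia.
      by congr (_, _); lia.
    - have nE : n = 2 * m - k by lia.
      rewrite nk mulKz //.
      have E2 : (n - 2 * k) ^+ 2 + m * (2 * m + 1) * 4 = i%:Z by rewrite -E nE; ring.
      have sE : n - 2 * k + 4 * m + 1 = 3 * n + 1 by lia.
      split; [exact: rg1 | |].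
        apply/andP; split; [exact/eqP | apply/negP => /dvdzP[z] /=; lia].
      rewrite /h /= sE (_ : _ == _ = true) ?addrK ?mulKz //; last lia.
      by congr (_, _); lia.
- exact: zsquare_uniq.
move=> [a t] /= _ /andP[/eqP /= E /dvdzP[q qE]].
have aE : a = q * 3 - 4 * t - 1 by lia.
rewrite qE mulzK //; have E2 : (a - 2 * q) ^+ 2 + (t - q) * (2 * (t - q) + 1) * 4 = i%:Z.
  by rewrite -E aE; ring.
have qE2 : a - 2 * q + 4 * (t - q) + 1 = - q * 3 by lia.
split; [exact: rg1 | | |].
- by rewrite /P /= E2 eqxx; apply/dvdzP; exists (- q).
- by rewrite qE2 mulzK //; congr (_, _); lia.
rewrite (@zsg_eq (a - 2 * q) a); last lia.
have -> : 4 * (t - q) + 1 + (a - 2 * q) = - (4 * t + 1 + a) by lia.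
by rewrite mulrN.
Qed.

Lemma eqm_eq L a b : a = b -> eqm L a b. Proof. by move->. Qed.

(** A form of the quintuple product identity.  By [theta_product] and
    [pentagonal4], F(X) E(X^4) is the product of the series of [theta_square] and of
    E(X^4)^3. *)
Lemma quintuple n :
  eqm n (gen n (fun t => 3 * t + 1) (fun t => t * (3 * t + 2)) * euler 'X^2 n)
        (euler 'X n ^+ 2 * euler 'X^4 n ^+ 2).
Proof.
set Q := gen _ _ _.
apply: (@eqm_cancel _ (euler 'X^4 n)); first exact: euler_coef0.
rewrite (_ : euler 'X^4 n * (Q * _) = euler 'X^2 n * (Q * euler 'X^4 n)); last ring.
rewrite (_ : euler 'X^4 n * _ = euler 'X n ^+ 2 * euler 'X^4 n ^+ 3); last ring.
apply: (eqm_trans (eqm_mul (@eqm_refl n (euler 'X^2 n))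
  (eqm_mul (@eqm_refl n Q) (@pentagonal4 n)))).
apply: (eqm_trans (eqm_mul (@eqm_refl n (euler 'X^2 n)) (eqm_sym (@theta_product n)))).
rewrite mulrA; apply: eqm_mul; first exact: theta_square.
have := @eqm_comp n _ _ 4 isT (eqm_sym (@jacobi n)).
by rewrite gen_comp rmorphXn /= euler_comp.
Qed.

(** Truncates the q-expansion of prod_d eta(dz), for ds of sum 24. *)
Definition eta_poly (ds : seq nat) (n : nat) : {poly int} :=
  'X * \prod_(d <- ds) euler 'X^d n.

Lemma coef_eta_poly ds n i (g : {poly int}) : (0 < i <= n)%N ->
  eqm n (\prod_(d <- ds) euler 'X^d n) g -> (eta_poly ds n)`_i = g`_i.-1.
Proof. by case: i => // i /= iN H; rewrite /eta_poly coefXM /= H. Qed.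

Lemma jacobi_comp n d : (0 < d)%N -> eqm n (euler 'X^d n ^+ 3)
  (gen n (fun t => 4 * t + 1) (fun t => t * (2 * t + 1) * d%:Z)).
Proof.
by move=> d0; have := eqm_comp d0 (@jacobi n); rewrite gen_comp rmorphXn /= euler_comp.
Qed.

Lemma quintuple_comp n d : (0 < d)%N ->
  eqm n (gen n (fun t => 3 * t + 1) (fun t => t * (3 * t + 2) * d%:Z) * euler 'X^(2 * d) n)
        (euler 'X^d n ^+ 2 * euler 'X^(4 * d) n ^+ 2).
Proof.
move=> d0; have := eqm_comp d0 (@quintuple n).
rewrite -gen_comp !comp_polyM -!euler_comp -!comp_polyA.
by rewrite !comp_Xn_poly -!exprM ![(d * _)%N]mulnC !expr2.
Qed.

Lemma eta_poly_a p : (0 < p)%N -> (eta_poly (nseq 6 4%N) p)`_p = coef_a p.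
Proof.
move=> p0; have J := @jacobi_comp p 4 isT.
rewrite (@coef_eta_poly _ p p _ _ (eqm_trans _ (eqm_mul J J))) ?p0 //=; last first.
  by apply: eqm_eq; rewrite /= !big_cons big_nil; ring.
rewrite coef_genM /coef_a; try by move=> t; nia.
by apply: eq_bigl => x; apply/eqP/eqP; lia.
Qed.

Lemma eta_poly_b p : (0 < p)%N -> (eta_poly (nseq 3 6%N ++ nseq 3 2%N) p)`_p = coef_b p.
Proof.
move=> p0; have J6 := @jacobi_comp p 6 isT; have J2 := @jacobi_comp p 2 isT.
rewrite (@coef_eta_poly _ p p _ _ (eqm_trans _ (eqm_mul J6 J2))) ?p0 //=; last first.
  by apply: eqm_eq; rewrite /= !big_cons big_nil; ring.
rewrite coef_genM /coef_b; try by move=> t; nia.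
by apply: eq_bigl => x; apply/eqP/eqP; lia.
Qed.

(** Two instances of [quintuple], after clearing E(X^2) E(X^4). *)
Lemma eta_poly_c p : (0 < p)%N -> (eta_poly [:: 8; 8; 4; 2; 1; 1]%N p)`_p = coef_c p.
Proof.
move=> p0; have Q1 := @quintuple_comp p 1 isT; have Q2 := @quintuple_comp p 2 isT.
rewrite (@coef_eta_poly _ p p (gen p (fun t => 3 * t + 1) (fun t => t * (3 * t + 2) * 1%:Z) *
   gen p (fun t => 3 * t + 1) (fun t => t * (3 * t + 2) * 2%:Z))) ?p0 //=; last first.
  apply: (@eqm_cancel _ (euler 'X^2 p * euler 'X^4 p)).
    by rewrite coefM big_ord1 !euler_coef0.
  rewrite !big_cons big_nil; move: (eqm_sym (eqm_mul Q1 Q2)).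
  move: (gen _ _ _) (gen _ _ _) => G1 G2 H.
  apply: (eqm_trans (eqm_eq _) (eqm_trans H (eqm_eq _))); ring.
rewrite coef_genM /coef_c; try by move=> t; nia.
by apply: eq_bigl => x; apply/eqP/eqP; lia.
Qed.

(** * Power series and infinite products of a small real variable *)

Section RealEstimates.
Variable R : realType.
Local Open Scope classical_set_scope.

Lemma horner_bounded (D : {poly R}) (d : R) : 0 < d ->
  exists2 M : R, 0 <= M & forall w, 0 < w <= d -> `|D.[w]| <= M.
Proof.
move=> d0; elim/poly_ind: D => [|p c [M M0 HM]].
  by exists 0 => // w _; rewrite horner0 normr0.
exists (M * d + `|c|) => [|w wd].
  by rewrite addr_ge0 ?normr_ge0 // mulr_ge0 // ltW.
rewrite hornerMXaddC (le_trans (ler_normD _ _)) // lerD2r normrM.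
have /andP[w0 wd'] := wd; rewrite (gtr0_norm w0).
by rewrite ler_pM ?normr_ge0 ?HM // ltW.
Qed.

(** The constant term is a limit at 0; divide by the variable and repeat. *)
Lemma coef0_of_bigO (D : {poly R}) (K d : R) N : 0 < d ->
  (forall w, 0 < w <= d -> `|D.[w]| <= K * w ^+ N) -> forall n, (n < N)%N -> D`_n = 0.
Proof.
move=> d0; elim: N D => // N IH D; elim/poly_ind: D => [|p c _] H n nN.
  by rewrite coef0.
have [M M0 HM] := horner_bounded p d0.
have c0 : c = 0.
  apply/eqP; apply/negPn/negP => c0; have nc0 : 0 < `|c| by rewrite normr_gt0.
  (* |c| <= B w for all small w, and this fails for w < |c| / B. *)
  pose B := `|K| * d ^+ N + M; have B0 : 0 <= B.
    by rewrite addr_ge0 // mulr_ge0 ?normr_ge0 // exprn_ge0 // ltW.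
  pose w := Num.min d (`|c| / (B + 1)).
  have B1 : 0 < B + 1 by rewrite ltr_wpDl.
  have w0 : 0 < w by rewrite lt_min d0 divr_gt0.
  have wd : w <= d by rewrite ge_min lexx.
  have wc : w <= `|c| / (B + 1) by rewrite ge_min lexx orbT.
  have w_in : 0 < w <= d by rewrite w0 wd.
  have : `|c| <= B * w.
    have -> : c = (p * 'X + c%:P).[w] - p.[w] * w by rewrite hornerMXaddC addrC addKr.
    rewrite (le_trans (ler_normB _ _)) // mulrDl lerD //.
      rewrite (le_trans (H w w_in)) // exprS mulrCA mulrC ler_wpM2r ?(ltW w0) //.
      rewrite (le_trans (ler_norm _)) // normrM ler_wpM2l ?normr_ge0 //.
      by rewrite ger0_norm ?exprn_ge0 ?(ltW w0) // lerXn2r // ?nnegrE ltW.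
    by rewrite normrM (gtr0_norm w0) ler_wpM2r ?HM // ltW.
  apply/negP; rewrite -ltNge.
  have : w * (B + 1) <= `|c| by rewrite -ler_pdivlMr.
  by apply: lt_le_trans; rewrite mulrC ltr_pM2l // ltrDl.
move: H; rewrite c0 => H; rewrite polyC0 addr0 coefMX; case: n nN => // n nN /=.
apply: (IH p) => // w wd; have /andP[w0 _] := wd.
have := H w wd; rewrite polyC0 addr0 hornerMX normrM (gtr0_norm w0) exprSr mulrA.
by rewrite ler_pM2r.
Qed.

Lemma geometric_bound (q : R) N k : 0 <= q <= 2^-1 ->
  \sum_(N.+1 <= n < (N + k).+1) q ^+ n <= 2 * q ^+ N.+1.
Proof.
move=> /andP[q0 q2]; suff : \sum_(N.+1 <= n < (N + k).+1) q ^+ n + 2 * q ^+ (N + k).+1 <= 2 * q ^+ N.+1.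
  by apply: le_trans; rewrite lerDl mulr_ge0 // exprn_ge0.
elim: k => [|k IH]; first by rewrite addn0 big_geq // add0r.
rewrite addnS big_nat_recr ?ltnS ?leq_addr //= -addrA (le_trans _ IH) // lerD2l.
have -> : 2 * q ^+ (N + k).+1 = q ^+ (N + k).+1 + q ^+ (N + k).+1 by ring.
rewrite lerD2l exprS mulrA ler_piMl ?exprn_ge0 //.
by rewrite -ler_pdivlMl // mulr1.
Qed.

Lemma cvg_dist_le (u : nat -> R) (s c B : R) N : u @ \oo --> s ->
  (forall k, `|u (N + k)%N - c| <= B) -> `|s - c| <= B.
Proof.
move=> /cvgrPdist_lt us H; apply/ler_addgt0Pr => e e0.
have [M _ HM] := us e e0.
have := HM (N + M)%N (leq_addl _ _) => /ltW sM.
have -> : s - c = (s - u (N + M)%N) + (u (N + M)%N - c) by ring.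
by rewrite (le_trans (ler_normD _ _)) // addrC lerD.
Qed.

Lemma power_series_remainder (u : nat -> R) (C r w s : R) N :
  0 < r -> (forall n, (0 < n)%N -> `|u n| * r ^+ n <= C) -> 0 < w <= r / 2 ->
  (fun N => \sum_(1 <= n < N.+1) u n * w ^+ n) @ \oo --> s ->
  `|s - \sum_(1 <= n < N.+1) u n * w ^+ n| <= 2 * C / r ^+ N.+1 * w ^+ N.+1.
Proof.
move=> r0 uC /andP[w0 wr] us.
apply: (cvg_dist_le (N := N) us) => k.
have C0 : 0 <= C by apply: le_trans (uC 1%N isT); rewrite mulr_ge0 ?normr_ge0 // exprn_ge0 // ltW.
pose q := w / r; have q0 : 0 <= q by rewrite divr_ge0 ?ltW.
have q2 : 0 <= q <= 2^-1 by rewrite q0 /= ler_pdivrMr // mulrC.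
rewrite (@big_cat_nat _ _ _ N.+1) //=; last by rewrite ltnS leq_addr.
rewrite [_ + _ - _]addrAC subrr add0r (le_trans (ler_norm_sum _ _ _)) //.
apply: (@le_trans _ _ (C * \sum_(N.+1 <= n < (N + k).+1) q ^+ n)).
  rewrite mulr_sumr big_nat [X in _ <= X]big_nat; apply: ler_sum => n /andP[nN _].
  rewrite normrM (ger0_norm (exprn_ge0 _ (ltW w0))) /q expr_div_n mulrA.
  rewrite ler_pdivlMr ?exprn_gt0 // mulrAC ler_wpM2r ?exprn_ge0 ?(ltW w0) //.
  by apply: uC; apply: leq_ltn_trans nN.
apply: (le_trans (ler_wpM2l C0 (geometric_bound N k q2))).
by rewrite /q expr_div_n (_ : C * _ = 2 * C / r ^+ N.+1 * w ^+ N.+1); last ring.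
Qed.

(** The partial products of (x;x). *)
Definition qpoch (x : R) (N : nat) : R := \prod_(1 <= n < N.+1) (1 - x ^+ n).

Lemma qpochS x N : qpoch x N.+1 = qpoch x N * (1 - x ^+ N.+1).
Proof. by rewrite /qpoch big_nat_recr. Qed.

Lemma qpoch_bound x N : 0 <= x <= 1 -> 0 <= qpoch x N <= 1.
Proof.
move=> /andP[x0 x1]; elim: N => [|N /andP[h0 h1]]; first by rewrite /qpoch big_geq // ler01 lexx.
have f0 : 0 <= 1 - x ^+ N.+1 by rewrite subr_ge0 exprn_ile1.
rewrite qpochS mulr_ge0 //= mulr_ile1 // lerBlDr lerDl exprn_ge0 //.
Qed.

Lemma qpoch_dist x N k : 0 <= x <= 2^-1 -> `|qpoch x (N + k) - qpoch x N| <= 2 * x ^+ N.+1.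
Proof.
move=> x2; apply: le_trans (geometric_bound N k x2); have /andP[x0 x2'] := x2.
have x1 : 0 <= x <= 1 by rewrite x0 (le_trans x2') // invf_le1 // ler1n.
elim: k => [|k IH]; first by rewrite addn0 subrr normr0 big_geq.
rewrite addnS qpochS big_nat_recr ?ltnS ?leq_addr //= mulrBr mulr1 addrAC.
rewrite (le_trans (ler_normB _ _)) // lerD //.
have /andP[p0 p1] := qpoch_bound (N + k) x1.
by rewrite ger0_norm ?mulr_ge0 ?exprn_ge0 // ler_piMl // exprn_ge0.
Qed.

Lemma qpoch_cvg x : 0 <= x <= 1 -> cvgn (qpoch x).
Proof.
move=> x1; apply: nonincreasing_is_cvgn.
  apply/nonincreasing_seqP => N; rewrite qpochS.
  have /andP[x0 x1'] := x1; have /andP[p0 p1] := qpoch_bound N x1.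
  by rewrite ler_piMr // lerBlDr lerDl exprn_ge0.
by exists 0 => _ [N _ <-]; have /andP[] := qpoch_bound N x1.
Qed.

Lemma limn_qpoch_bound x : 0 <= x <= 1 -> 0 <= limn (qpoch x) <= 1.
Proof.
move=> x1; have c := qpoch_cvg x1; apply/andP; split.
  by apply: limr_ge => //; near=> N; have /andP[] := qpoch_bound N x1.
by apply: limr_le => //; near=> N; have /andP[] := qpoch_bound N x1.
Unshelve. all: by end_near.
Qed.

Lemma limn_qpoch_dist x N : 0 <= x <= 2^-1 -> `|limn (qpoch x) - qpoch x N| <= 2 * x ^+ N.+1.
Proof.
move=> x2; have /andP[x0 x2'] := x2.
have x1 : 0 <= x <= 1 by rewrite x0 (le_trans x2') // invf_le1 // ler1n.
by apply: (cvg_dist_le (N := N) (qpoch_cvg x1)) => k; apply: qpoch_dist.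
Qed.

Lemma prod_dist (I : eqType) (r : seq I) (f g : I -> R) (B : R) :
  (forall i, 0 <= f i <= 1) -> (forall i, 0 <= g i <= 1) ->
  (forall i, i \in r -> `|f i - g i| <= B) ->
  `|\prod_(i <- r) f i - \prod_(i <- r) g i| <= (size r)%:R * B.
Proof.
move=> f1 g1; elim: r => [|i r IH fg]; first by rewrite !big_nil subrr normr0 mul0r.
have {}IH := IH (fun j jr => fg j (mem_behead (s := i :: r) jr)).
rewrite !big_cons /= -natr1 mulrDl mul1r [X in _ <= X]addrC.
have -> : f i * \prod_(j <- r) f j - g i * \prod_(j <- r) g j =
  (f i - g i) * \prod_(j <- r) f j + g i * (\prod_(j <- r) f j - \prod_(j <- r) g j) by ring.
have /andP[p0 p1] : 0 <= \prod_(j <- r) f j <= 1.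
  elim: r {IH fg} => [|j r /andP[h0 h1]]; first by rewrite big_nil ler01 lexx.
  by have /andP[? ?] := f1 j; rewrite big_cons mulr_ge0 //= mulr_ile1.
rewrite (le_trans (ler_normD _ _)) // lerD // normrM.
  by rewrite (ger0_norm p0) (le_trans _ (fg i (mem_head i r))) // ler_piMr ?normr_ge0.
have /andP[g0 g1'] := g1 i; rewrite (ger0_norm g0) (le_trans _ IH) //.
by rewrite ler_piMl ?normr_ge0.
Qed.

End RealEstimates.

(** * Eta products on the imaginary axis *)

Section ComplexToReal.
Variable R : realType.
Local Open Scope classical_set_scope.
Local Open Scope complex_scope.
Local Open Scope ring_scope.

Lemma normc_real (x : R) : `|x%:C| = `|x|%:C.
Proof. by rewrite normc_def /= expr0n addr0 sqrtr_sqr. Qed.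

(** Convergence in the complex plane is tested against positive complex numbers,
    which are real. *)
Lemma cvg_real_complex (u : nat -> R) (l : R) : u @ \oo --> l ->
  (fun n => (u n)%:C : R[i]^o) @ \oo --> (l%:C : R[i]^o).
Proof.
move=> /cvgrPdist_lt ul; apply/cvgrPdist_lt => e.
rewrite ltcE /= => /andP[/eqP ie re]; have [N _ HN] := ul _ re.
exists N => // n Nn; rewrite /= -rmorphB normc_real ltcE /= ie eqxx /=; exact: HN.
Qed.

Lemma cvg_complex_real (u : nat -> R) (l : R) :
  (fun n => (u n)%:C : R[i]^o) @ \oo --> (l%:C : R[i]^o) -> u @ \oo --> l.
Proof.
move=> /cvgrPdist_lt ul; apply/cvgrPdist_lt => e e0.
have e0' : 0 < (e%:C : R[i]) by rewrite ltcR.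
have [N _ HN] := ul _ e0'.
by exists N => // n Nn; have := HN n Nn; rewrite /= -rmorphB normc_real ltcR.
Qed.

Lemma cexp_real (x : R) : cexp (x%:C) = (expR x)%:C.
Proof. by rewrite /cexp /= cos0 sin0 complexr0 mulr1. Qed.

Lemma expq_imaginary (s y : R) (d : nat) :
  expq s%:C (d%:R * ('i * y%:C)) = (expR (- (2 * pi * s * (d%:R * y))))%:C.
Proof.
rewrite /expq -cexp_real; congr cexp.
rewrite !rmorphN !rmorphM !rmorph_nat.
transitivity (('i * 'i) * (2 * pi%:C * s%:C * (d%:R * y%:C)) : R[i]); first ring.
by rewrite -expr2 sqrCi mulN1r.
Qed.

(** On the imaginary axis the nome is real. *)
Lemma eta_imaginary (y x : R) (d : nat) : (0 < d)%N -> 0 <= x <= 1 -> expR (- (2 * pi * y)) = x ->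
  eta (d%:R * ('i * y%:C)) = (expR (- (2 * pi * 24^-1 * (d%:R * y))) * limn (qpoch (x ^+ d)))%:C.
Proof.
move=> d0 x1 xE; rewrite /eta.
rewrite [X in expq X _](_ : _ = (24^-1)%:C); last by rewrite fmorphV rmorph_nat.
rewrite expq_imaginary rmorphM /=; congr (_ * _).
have nE : nome (d%:R * ('i * y%:C)) = (x ^+ d)%:C.
  rewrite /nome (_ : (1 : R[i]) = 1%:C) // expq_imaginary -xE -expRM_natl; congr (expR _)%:C.
  ring.
have H : (fun N : nat => \prod_(1 <= n < N.+1) (1 - nome (d%:R * ('i * y%:C)) ^+ n) : R[i]^o)
    @ \oo --> ((limn (qpoch (x ^+ d)))%:C : R[i]^o).
  rewrite nE.
  have -> : (fun N : nat => \prod_(1 <= n < N.+1) (1 - (x ^+ d)%:C ^+ n) : R[i]^o) =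
    (fun N => (qpoch (x ^+ d) N)%:C : R[i]^o).
    apply/funext => N; rewrite /qpoch rmorph_prod; apply: eq_bigr => n _.
    by rewrite rmorphB !rmorphXn rmorph1.
  apply: cvg_real_complex; apply: qpoch_cvg.
  by have /andP[x0 x1'] := x1; rewrite exprn_ge0 ?exprn_ile1.
exact: (cvg_lim (@norm_hausdorff _ _) H).
Qed.

(** The product of the eta(dz) as a function of the nome w, for ds of sum 24, where
    the factors w^(d/24) multiply to w. *)
Definition etaR (ds : seq nat) (w : R) : R := w * \prod_(d <- ds) limn (qpoch (w ^+ d)).

Lemma q_expansion_real ds (a : nat -> int) (f : R[i] -> R[i]) :
  all (leq 1) ds -> sumn ds = 24%N ->
  (forall z, f z = \prod_(d <- ds) eta (d%:R * z)) -> q_expansion a f ->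
  forall w : R, 0 < w < 1 ->
  (fun N : nat => \sum_(1 <= n < N.+1) (a n)%:~R * w ^+ n) @ \oo --> etaR ds w.
Proof.
move=> ds0 ds24 fE aE w /andP[w0 w1].
pose y : R := - ln w / (2 * pi).
have pi2 : 0 < 2 * pi :> R by rewrite mulr_gt0 ?pi_gt0.
have y0 : 0 < y by rewrite divr_gt0 // oppr_gt0 ln_lt0 // w0.
have wE : expR (- (2 * pi * y)) = w.
  by rewrite /y mulrC divfK ?gt_eqF // opprK lnK.
have imE : complex.Im ('i * y%:C : R[i]) = y by rewrite -complexiE /=; ring.
have := aE ('i * y%:C); rewrite imE => /(_ y0).
have -> : (fun N : nat => \sum_(1 <= n < N.+1) (a n)%:~R * nome ('i * y%:C) ^+ n : R[i]^o) =
    (fun N => (\sum_(1 <= n < N.+1) (a n)%:~R * w ^+ n)%:C : R[i]^o).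
  have -> : nome ('i * y%:C) = w%:C :> R[i].
    rewrite -[y%:C]mul1r mulrCA /nome (_ : (1 : R[i]) = 1%:C) // (expq_imaginary 1 y 1).
    by rewrite -wE; congr (expR _)%:C; ring.
  apply/funext => N; rewrite rmorph_sum; apply: eq_bigr => n _.
  by rewrite rmorphM rmorphXn rmorph_int.
have -> : f ('i * y%:C) = (etaR ds w)%:C; last exact: cvg_complex_real.
rewrite fE /etaR [RHS]rmorphM [X in _ = _ * X]rmorph_prod /=.
have w01 : 0 <= w <= 1 by rewrite !ltW.
have -> : \prod_(d <- ds) eta (d%:R * ('i * y%:C)) = \prod_(d <- ds)
    (expR (- (2 * pi * y) * (d%:R / 24)) * limn (qpoch (w ^+ d)))%:C :> R[i].
  rewrite big_seq [RHS]big_seq; apply: eq_bigr => d dds.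
  rewrite (eta_imaginary (allP ds0 d dds) w01 wE); congr (expR _ * _)%:C; ring.
rewrite (eq_bigr (fun d => (expR (- (2 * pi * y) * (d%:R / 24)))%:C * (limn (qpoch (w ^+ d)))%:C)); last first.
  by move=> d _; rewrite rmorphM.
rewrite big_split /=; congr (_ * _); rewrite -rmorph_prod -{}wE; congr (_%:C).
rewrite -expR_sum -mulr_sumr -mulr_suml -natr_sum -sumnE ds24.
by rewrite divff ?mulr1 // pnatr_eq0.
Qed.

End ComplexToReal.

Lemma horner_eta_poly (R : realType) ds n (w : R) :
  (map_poly intr (eta_poly ds n)).[w] = w * \prod_(d <- ds) qpoch (w ^+ d) n.
Proof.
rewrite /eta_poly rmorphM /= map_polyX hornerM hornerX rmorph_prod horner_prod; congr (_ * _).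
apply: eq_bigr => d _; rewrite /euler /qpoch rmorph_prod horner_prod big_add1 big_mkord.
by apply: eq_bigr => i _; rewrite rmorphB rmorph1 !rmorphXn /= map_polyX hornerD hornerN !horner_exp hornerX hornerC.
Qed.

(** Let w > 0 be small.  The power series differs from its n-th partial sum by
    O(w^(n+1)), and the infinite product from the n-th partial product by the same
    order; so a polynomial with the difference of the coefficients up to n is
    O(w^(n+1)). *)
Lemma eta_product_coef (R : realType) ds (a : nat -> int) (f : R[i] -> R[i]) n :
  all (leq 1) ds -> sumn ds = 24%N ->
  (forall z, f z = \prod_(d <- ds) eta (d%:R * z)) -> q_expansion a f ->
  (0 < n)%N -> a n = (eta_poly ds n)`_n.
Proof.
move=> ds0 ds24 fE aE n0; have S := q_expansion_real ds0 ds24 fE aE.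
have r0 : 0 < (2^-1 : R) by rewrite invr_gt0.
have r1 : (2^-1 : R) <= 1 by rewrite invf_le1 // ler1n.
have [C uC] : exists C : R, forall n, (0 < n)%N -> `|(a n)%:~R| * (2^-1) ^+ n <= C.
  have r01 : 0 < (2^-1 : R) < 1 by rewrite r0 invf_lt1 // ltr1n.
  have [M [_ HM]] := cvg_seq_bounded (cvgP _ (S _ r01)).
  exists ((M + 1) + (M + 1)) => -[//|k] _.
  have b j : `|\sum_(1 <= n < j.+1) (a n)%:~R * (2^-1 : R) ^+ n| <= M + 1.
    by apply: HM; rewrite ?ltrDl.
  have := lerD (b k.+1) (b k); apply: le_trans.
  have -> : `|(a k.+1)%:~R| * (2^-1) ^+ k.+1 = `|(a k.+1)%:~R * (2^-1) ^+ k.+1 : R|.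
    by rewrite normrM [X in _ = _ * X]ger0_norm // exprn_ge0 // ltW.
  apply: le_trans (ler_normB _ _).
  by rewrite [X in `|X - _|]big_nat_recr //= [_ + _ - _]addrAC subrr add0r.
pose D : {poly R} := \poly_(i < n.+1) (if i == 0%N then 0 else (a i)%:~R) - map_poly intr (eta_poly ds n).
have D0 : forall w : R, 0 < w <= 2^-1 / 2 ->
    `|D.[w]| <= (2 * C / 2^-1 ^+ n.+1 + (size ds)%:R * 2) * w ^+ n.+1.
  move=> w w_in; have /andP[w0 w4] := w_in.
  have w2 : w <= 2^-1 by rewrite (le_trans w4) // ler_piMr // ltW.
  have w1 : w < 1 by rewrite (le_lt_trans w2) // invf_lt1 // ltr1n.
  have w01 : 0 < w < 1 by rewrite w0 w1.
  have -> : D.[w] = (etaR ds w - (map_poly intr (eta_poly ds n)).[w]) -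
      (etaR ds w - \sum_(1 <= n < n.+1) (a n)%:~R * w ^+ n).
    rewrite /D hornerD hornerN horner_poly big_ord_recl /= mul0r add0r.
    by rewrite big_add1 big_mkord; ring.
  rewrite (le_trans (ler_normB _ _)) // [X in X <= _]addrC mulrDl lerD //.
    exact: (power_series_remainder (u := fun n => (a n)%:~R) n r0 uC w_in (S w w01)).
  rewrite horner_eta_poly /etaR -mulrBr normrM (gtr0_norm w0) -mulrA.
  have wd d : 0 <= w ^+ d <= 1 by rewrite exprn_ge0 ?exprn_ile1 ?ltW.
  apply: (@le_trans _ _ (1 * ((size ds)%:R * (2 * w ^+ n.+1)))); last by rewrite mul1r.
  apply: ler_pM; rewrite ?normr_ge0 ?(ltW w0) ?(ltW w1) //.
  apply: prod_dist => d; [exact: limn_qpoch_bound | exact: qpoch_bound | move=> dds].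
  have d0 := allP ds0 d dds; have wdw : w ^+ d <= w by
    rewrite -(prednK d0) exprS ler_piMr ?(ltW w0) //; have /andP[] := wd d.-1.
  apply: (le_trans (limn_qpoch_dist _ _)).
    by rewrite exprn_ge0 ?(ltW w0) //= (le_trans wdw).
  by rewrite ler_wpM2l // lerXn2r ?nnegrE ?exprn_ge0 ?(ltW w0).
have d0 : 0 < (2^-1 / 2 : R) by rewrite divr_gt0.
have := coef0_of_bigO d0 D0 (ltnSn n); rewrite /D coefB coef_poly ltnSn coef_map gtn_eqF //=.
by move/eqP; rewrite subr_eq0 => /eqP/intr_inj.
Qed.

(** * Quadratic forms representing the square of a prime *)

Lemma coprime_mul_sqr (a b m : nat) : coprime a b -> (a * b = m ^ 2)%N -> a = (gcdn a m ^ 2)%N.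
Proof.
move=> ab E; symmetry; transitivity (gcdn (a * gcdn a m) (m * gcdn a m)).
  by rewrite -mulnn muln_gcdl.
rewrite [X in gcdn _ X]muln_gcdr mulnn -E (mulnC m a) -!muln_gcdr.
rewrite (_ : gcdn (gcdn a m) _ = 1%N) ?muln1 //.
by apply/eqP; apply: coprime_dvdl (dvdn_gcdl a m) (coprime_dvdr (dvdn_gcdr m b) ab).
Qed.

(** A common divisor of A and B divides p and is smaller than p. *)
Lemma mul_sqr_prime_sum (p d : nat) (A B m : int) : prime p -> (0 < d)%N ->
  d%:Z * A + B = p%:Z -> 0 < A -> 0 < B ->
  A * B = m ^+ 2 -> exists s t, A = s ^+ 2 /\ B = t ^+ 2.
Proof.
case: A B => [a|a] // [b|b] // p_pr d0 [abp] a0 b0 ABm.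
have abm : (a * b = absz m ^ 2)%N by rewrite -mulnn -abszM -expr2 -ABm.
have cab : coprime a b.
  rewrite /coprime -(gcdnMDl d) abp -/(coprime _ _) coprime_sym prime_coprime //.
  by rewrite gtnNdvd // -abp -ltn_psubLR ?subnn; nia.
exists (gcdn a (absz m))%:Z, (gcdn b (absz m))%:Z; split.
  by rewrite {1}(coprime_mul_sqr cab abm) -mulnn PoszM expr2.
by rewrite coprime_sym in cab; rewrite mulnC in abm; rewrite {1}(coprime_mul_sqr cab abm) -mulnn PoszM expr2.
Qed.

Lemma neg_square_mod (p : nat) (c d : int) : prime p -> (p %% 4 = 3)%N ->
  (p%:Z %| c ^+ 2 + d ^+ 2)%Z -> (p%:Z %| d)%Z.
Proof.
move=> p_pr p4; have cF : #|'F_p| = (p ^ 1)%N by rewrite card_Fp // expn1.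
rewrite -!(pchar_intr_eq0 p_pr cF) rmorphD !rmorphXn /=.
move: (c%:~R) (d%:~R) => x y; rewrite addr_eq0 => /eqP xy.
apply/negPn/negP => y0; have x0 : x != 0 by rewrite -sqrf_eq0 xy oppr_eq0 sqrf_eq0.
have fermat (z : 'F_p) : z != 0 -> z ^+ p.-1 = 1.
  move=> z0; apply: (mulIf z0); rewrite -exprSr prednK ?prime_gt0 // mul1r.
  by have := expf_card z; rewrite card_Fp.
have [k kE] : exists k, p.-1 = (2 * (2 * k + 1))%N by exists (p %/ 4)%N; lia.
have := fermat x x0; rewrite kE exprM xy exprNn -exprM -kE fermat // mulr1.
rewrite exprD exprM sqrrN !expr1n mul1r expr1 => /eqP; rewrite eq_sym -addr_eq0 => p2.
have : (2%:~R == 0 :> 'F_p) by [].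
by rewrite (pchar_intr_eq0 p_pr cF) dvdzE /= gtnNdvd //; lia.
Qed.

Lemma sqr_lt_prime (p : nat) (u : int) : ~~ (p%:Z %| u)%Z -> u ^+ 2 <= p%:Z ^+ 2 ->
  - p%:Z < u < p%:Z.
Proof.
move=> pu E; have /andP[h1 h2] : - p%:Z <= u <= p%:Z.
  by rewrite -ler_norml -[p%:Z]ger0_norm // -ler_sqr ?nnegrE // !real_normK ?num_real.
rewrite !lt_neqAle h1 h2 !andbT; apply/andP; split; apply: contraNN pu => /eqP.
  by move<-; rewrite dvdzE abszN.
by move->.
Qed.

(** (p - u)/2 and (p + u)/2 are coprime with product (v/2)^2, so both are squares; the
    condition u = 1 mod 4 tells which of them is odd. *)
Lemma inert_form1 (p : nat) (u v w : int) : prime p -> odd p ->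
  p%:Z ^+ 2 = u ^+ 2 + v ^+ 2 -> ~~ (p%:Z %| u)%Z -> u = 1 + 4 * w ->
  exists x y z : int, [/\ p%:Z = x ^+ 2 + y ^+ 2, x = 1 + 2 * z & u = x ^+ 2 - y ^+ 2].
Proof.
move=> p_pr p_odd E pu uE; have [k pE] := odd_int p_odd.
have /andP[up1 up2] : - p%:Z < u < p%:Z by apply: sqr_lt_prime pu _; rewrite E lerDl sqr_ge0.
have A0 : 0 < k - 2 * w by clear - up1 up2 pE uE; lia.
have B0 : 0 < k + 1 + 2 * w by clear - up1 up2 pE uE; lia.
have AB : 1%:Z * (k - 2 * w) + (k + 1 + 2 * w) = p%:Z by rewrite pE; ring.
have vE : v ^+ 2 = 4 * ((k - 2 * w) * (k + 1 + 2 * w)).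
  by rewrite -[v ^+ 2](addKr (u ^+ 2)) -E pE uE; ring.
have [m mE] : exists m, v = 2 * m.
  have [r rE] := sqr_parity v; exists (2 * ((k - 2 * w) * (k + 1 + 2 * w)) - r).
  by rewrite vE in rE; move: ((k - 2 * w) * _) rE => n rE; clear - rE; lia.
have m2 : (k - 2 * w) * (k + 1 + 2 * w) = m ^+ 2.
  by apply: (mulfI (isT : (4 : int) != 0)); rewrite -vE mE; ring.
have [s [t [sE tE]]] := mul_sqr_prime_sum (d := 1) p_pr isT AB A0 B0 m2.
have [q [r [tq r2]]] := @zmod_cases t 2 isT; have [a [b [sq b2]]] := @zmod_cases s 2 isT.
have pts : p%:Z = t ^+ 2 + s ^+ 2 by rewrite -AB -sE -tE; ring.
have uts : u = t ^+ 2 - s ^+ 2 by rewrite uE -sE -tE; ring.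
have [r1|r0] : r = 1 \/ r = 0 by clear - r2; lia.
  by exists t, s, q; split=> //; rewrite tq r1; ring.
have {}uE : 1 + 4 * w = t ^+ 2 - s ^+ 2 by rewrite -uE.
exfalso; move: uE; rewrite tq sq r0; clear - b2.
by have [->|->] : b = 1 \/ b = 0 by [lia]; lia.
Qed.

(** (p - u)/2 and (p + u)/2 are coprime with product 2 (v/2)^2, so one is a square and
    the other twice a square.  If they are t^2 = (p - u)/2 and 2 s^2 = (p + u)/2, then
    2u = -4t^2 mod p, and -1 would be a square modulo p. *)
Lemma inert_form2 (p : nat) (u v c : int) : prime p -> odd p -> (p %% 4 = 3)%N ->
  p%:Z ^+ 2 = u ^+ 2 + 2 * v ^+ 2 -> ~~ (p%:Z %| u)%Z -> (p%:Z %| 2 * u - c ^+ 2)%Z ->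
  exists x y : int, p%:Z = x ^+ 2 + 2 * y ^+ 2 /\ u = x ^+ 2 - 2 * y ^+ 2.
Proof.
move=> p_pr p_odd p4 E pu uc; have [k pE] := odd_int p_odd.
have /andP[up1 up2] : - p%:Z < u < p%:Z.
  by apply: sqr_lt_prime pu _; rewrite E lerDl mulr_ge0 // sqr_ge0.
have [w uE] : exists w, u = 1 + 2 * w.
  have [r rE] := sqr_parity u; have {}rE : u ^+ 2 = u + 2 * r by [].
  exists (2 * k + 2 * k ^+ 2 - v ^+ 2 - r).
  have : u + 2 * r + 2 * v ^+ 2 = (1 + 2 * k) ^+ 2 by rewrite -rE -pE -E.
  clear; lia.
have A0 : 0 < k - w by clear - up1 up2 pE uE; lia.
have B0 : 0 < k + 1 + w by clear - up1 up2 pE uE; lia.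
have vE : v ^+ 2 = 2 * ((k - w) * (k + 1 + w)).
  apply: (mulfI (isT : (2 : int) != 0)).
  by rewrite -[2 * v ^+ 2](addKr (u ^+ 2)) -E pE uE; ring.
have [m mE] : exists m, v = 2 * m.
  have [r rE] := sqr_parity v; exists ((k - w) * (k + 1 + w) - r).
  by rewrite vE in rE; move: ((k - w) * _) rE => n rE; clear - rE; lia.
have m2 : (k - w) * (k + 1 + w) = 2 * m ^+ 2.
  by apply: (mulfI (isT : (2 : int) != 0)); rewrite -vE mE; ring.
(* k - w = (p - u)/2 and k + 1 + w = (p + u)/2 have opposite parities. *)
have [h [r [kw r2]]] := @zmod_cases (k - w) 2 isT.
have [r0|r1] : r = 0 \/ r = 1 by clear - r2; lia.
  have {}m2 : h * (k + 1 + w) = m ^+ 2.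
    by apply: (mulfI (isT : (2 : int) != 0)); rewrite -m2 kw r0; ring.
  have AB : 2%:Z * h + (k + 1 + w) = p%:Z.
    by rewrite mulrC -[h * _]addr0 -{1}r0 -kw pE; ring.
  have h0 : 0 < h by clear - A0 kw r0; lia.
  have [s [t [sE tE]]] := mul_sqr_prime_sum (d := 2) p_pr isT AB h0 B0 m2.
  exists t, s; rewrite -sE -tE -AB uE; split; first ring.
  by clear - kw r0; lia.
have [g gE] : exists g, k + 1 + w = 2 * g by exists (k - h); clear - kw r1; lia.
have {}m2 : g * (k - w) = m ^+ 2.
  by apply: (mulfI (isT : (2 : int) != 0)); rewrite -m2 gE; ring.
have AB : 2%:Z * g + (k - w) = p%:Z by rewrite -[2%:Z * g]gE pE; ring.
have g0 : 0 < g by clear - B0 gE; lia.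
have [s [t [sE tE]]] := mul_sqr_prime_sum (d := 2) p_pr isT AB g0 A0 m2.
have pts : p%:Z = t ^+ 2 + 2 * s ^+ 2 by rewrite -AB -sE -tE; ring.
have uts : u = 2 * s ^+ 2 - t ^+ 2 by rewrite -sE -tE -gE uE; ring.
have : (p%:Z %| c ^+ 2 + (2 * t) ^+ 2)%Z.
  have -> : c ^+ 2 + (2 * t) ^+ 2 = 2 * p%:Z - (2 * u - c ^+ 2) by rewrite pts uts; ring.
  by rewrite rpredB // dvdz_mull.
move=> /(neg_square_mod p_pr p4) /(prime_dvdzM p_pr)[|/dvdzP[n tn]].
  by rewrite dvdzE /= gtnNdvd //; clear - p4 p_pr; case: p p_pr p4 => [|[|[|]]].
case/negP: pu; apply/dvdzP; exists (1 - 2 * t * n).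
transitivity (p%:Z - 2 * t * t); first by rewrite pts uts; ring.
by rewrite {2}tn; ring.
Qed.

(** * The congruences *)

Lemma odd_prime_ge5 p : prime p -> (5 <= p)%N -> odd p.
Proof. by move=> p_pr p5; case: (even_prime p_pr) p5 => [->|]. Qed.

Lemma prime_ge5_mod3 p : prime p -> (5 <= p)%N -> (p %% 3 != 0)%N.
Proof.
move=> p_pr p5; apply/negP => /eqP p3; have : (3 %| p)%N by rewrite /dvdn p3.
by rewrite dvdn_prime2 // => /eqP p3'; rewrite -p3' in p5.
Qed.

Lemma hyp_sum3_coef_b p : prime p -> (5 <= p)%N -> p_congr p 2 (hyp_sum 3 p) (coef_b p)%:~R.
Proof.
move=> p_pr p5; have p_odd := odd_prime_ge5 p_pr p5; have p3 := prime_ge5_mod3 p_pr p5.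
have [p6|p6] : (p %% 6 = 1)%N \/ (p %% 3 = 2)%N by lia.
  have [x [y [pE]]] := hyp_sum_split3 p_pr p5 p6.
  by rewrite (coef_bE p_pr pE p_odd) //; lia.
rewrite coef_b0 //; apply: (@hyp_sum_odd 3 (p %/ 3)) => //; try lia.
by rewrite prime_coprime // /dvdn p6.
Qed.

Lemma hyp_sum4_coef_c p : prime p -> (5 <= p)%N -> p_congr p 2 (hyp_sum 4 p) (coef_c p)%:~R.
Proof.
move=> p_pr p5; have p_odd := odd_prime_ge5 p_pr p5.
have [p8|[p8|p8]] : (p %% 8 = 1)%N \/ (p %% 8 = 3)%N \/ ((p %% 8 = 5)%N \/ (p %% 8 = 7)%N) by lia.
- have [x [y [pE]]] := hyp_sum_split4 p_pr p5 p8.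
  by rewrite (coef_cE p_pr pE) //; lia.
- have [u [v [c [E pu uc]]]] := hyp_sum_inert4 p_pr p8.
  have p4 : (p %% 4 = 3)%N by lia.
  have [x [y [pE uE]]] := inert_form2 p_pr p_odd p4 E pu uc.
  by rewrite (coef_cE p_pr pE) ?uE //; lia.
rewrite coef_c0 //; apply: (@hyp_sum_odd 4 (p %/ 4)) => //; try lia.
by rewrite (@coprimeXl 2 2) // coprime2n.
Qed.

Lemma hyp_sum6_coef_a p : prime p -> (5 <= p)%N ->
  p_congr p 2 (hyp_sum 6 p) (gamma_sign p * coef_a p)%:~R.
Proof.
move=> p_pr p5; have p_odd := odd_prime_ge5 p_pr p5; have p3 := prime_ge5_mod3 p_pr p5.
have [p12|[p12|p12]] : (p %% 12 = 1)%N \/ (p %% 12 = 5)%N \/ (p %% 12 = 7 \/ p %% 12 = 11)%N by lia.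
- have [x [y [pE [w xE]]]] := hyp_sum_split6 p_pr p5 p12.
  by rewrite /gamma_sign p12 mul1r (coef_aE p_pr pE xE p_odd).
- have [u [v [w [E pu uE]]]] := hyp_sum_inert6 p_pr p12.
  have [x [y [z [pE xE ->]]]] := inert_form1 p_pr p_odd E pu uE.
  by rewrite /gamma_sign p12 mulN1r (coef_aE p_pr pE xE p_odd).
rewrite coef_a0 ?mulr0; last lia.
apply: (@hyp_sum_odd 6 (p %/ 6)) => //; try lia.
by rewrite (_ : 6 = 2 * 3)%N // coprimeMl coprime2n p_odd prime_coprime.
Qed.

Local Open Scope complex_scope.
Local Open Scope ring_scope.

Theorem corollary1p7 (R : realType) (p : nat) (a b c : nat -> int)
    (p_prime : prime p) (p_ge5 : (5 <= p)%N)
    (a_def : q_expansion a (fun z : R[i] => eta (4 * z) ^+ 6))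
    (b_def : q_expansion b (fun z : R[i] => eta (6 * z) ^+ 3 * eta (2 * z) ^+ 3))
    (c_def : q_expansion c (fun z : R[i] =>
       eta (8 * z) ^+ 2 * eta (4 * z) * eta (2 * z) * eta z ^+ 2)) :
  [/\ p_congr p 2
        (\sum_(0 <= n < p)
           ((3 * n)`! * (2 * n)`!)%:R / n`!%:R ^+ 5 * 108 ^- n)
        (b p)%:~R,
      p_congr p 2
        (\sum_(0 <= n < p) (4 * n)`!%:R / n`!%:R ^+ 4 * 256 ^- n)
        (c p)%:~R
    & p_congr p 2
        (\sum_(0 <= n < p)
           (6 * n)`!%:R / ((3 * n)`!%:R * n`!%:R ^+ 3) * 1728 ^- n)
        (gamma_sign p * a p)%:~R].
Proof.
have p0 : (0 < p)%N := prime_gt0 p_prime.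
have aE : a p = coef_a p.
  rewrite -(eta_poly_a p0); apply: (eta_product_coef _ _ _ a_def p0) => // z.
  by rewrite !big_cons big_nil; ring.
have bE : b p = coef_b p.
  rewrite -(eta_poly_b p0); apply: (eta_product_coef _ _ _ b_def p0) => // z.
  by rewrite !big_cons big_nil; move: (eta (6 * z)) (eta (2 * z)) => x y; ring.
have cE : c p = coef_c p.
  rewrite -(eta_poly_c p0); apply: (eta_product_coef _ _ _ c_def p0) => // z.
  rewrite !big_cons big_nil mul1r.
  move: (eta (8 * z)) (eta (4 * z)) (eta (2 * z)) (eta z) => w x y t; ring.
rewrite aE bE cE; split.
- by rewrite (eq_bigr _ (fun n _ => hyp_rat3 n)); exact: hyp_sum3_coef_b.
- by rewrite (eq_bigr _ (fun n _ => hyp_rat4 n)); exact: hyp_sum4_coef_c.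
by rewrite (eq_bigr _ (fun n _ => hyp_rat6 n)); exact: hyp_sum6_coef_a.
Qed.
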